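(* Let $\Sigma_\tau$ be a simplicial subdivision of a convex cone $\tau$ in $N_{\mathbb{R}}$. Then the cohomology of the corresponding $l$-th Ishida complex is $$H^k(\Sigma_\tau,l)\cong A(\Sigma_\tau)_k\otimes{\bigwedge}^{l-k}\tau^\perp.$$
   Context: $M$ is a lattice of rank $d$, $N=\mathrm{Hom}(M,\mathbb{Z})$, $N_{\mathbb{R}}=N\otimes\mathbb{R}$, $N_{\mathbb{Q}}=N\otimes\mathbb{Q}$, $M_{\mathbb{Q}}=M\otimes\mathbb{Q}$. Fans are finite and rational; a simplicial subdivision of $\tau$ is a simplicial fan with support $\tau$. For a cone $\gamma$, $\gamma^\perp$ denotes the $\mathbb{Q}$-subspace of $M_{\mathbb{Q}}$ of elements vanishing on $\gamma$. Exterior powers and tensor products are over $\mathbb{Q}$; exterior powers of negative degree are zero. Ishida complex. For a fan $\Sigma$ in $N_{\mathbb{R}}$ and $l=0,\dots,d$, the $l$-th Ishida complex $C^*(\Sigma,l)$ of $\mathbb{Q}$-modules has $C^j(\Sigma,l)=\bigoplus_{\gamma\in\Sigma(j)}\bigwedge^{l-j}\gamma^\perp$, where $\Sigma(j)$ is the set of $j$-dimensional cones of $\Sigma$. The coboundary homomorphism $\delta:C^j\to C^{j+1}$ is the direct sum of maps $\delta_{\gamma,\gamma'}:\bigwedge^{l-j}\gamma^\perp\to\bigwedge^{l-j-1}\gamma'^\perp$, which are zero if $\gamma$ is not a facet of $\gamma'$, while for $\gamma$ a facet of $\gamma'$, $\delta_{\gamma,\gamma'}(w)=e_{\gamma,\gamma'}\lrcorner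 w$ (contraction), where $e_{\gamma,\gamma'}\in N_{\mathbb{Q}}$ satisfies $\gamma'+(-\gamma)=\mathbb{R}_{\ge0}e_{\gamma,\gamma'}+\mathbb{R}\gamma$. (Thus the maps $\delta_{\gamma,\gamma'}$ are allowed to be defined up to a rational multiple.) $H^k(\Sigma,l)$ denotes the $k$-th cohomology of $C^*(\Sigma,l)$. Chow ring. For a fan $\Sigma$ with primitive generators $e_1,\dots,e_n$ of its 1-dimensional cones, $A(\Sigma)=\mathbb{Q}[D_1,\dots,D_n]/(P(\Sigma)+SR(\Sigma))$, graded by $\deg D_i=1$, with $P(\Sigma)=\bigl\langle\sum_{i=1}^n\langle m,e_i\rangle D_i:m\in M\bigr\rangle$ and $SR(\Sigma)=\bigl\langle D_{i_1}\cdots D_{i_k}:\{e_{i_1},\dots,e_{i_k}\}\not\subset\sigma\text{ for all }\sigma\in\Sigma\bigr\rangle$; $A(\Sigma)_k$ is its degree $k$ part. *)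

(* Defs.v *)
From HB Require Import structures.
From mathcomp Require Import all_boot all_order all_algebra.
From mathcomp Require Import ring finmap freeg.
From mathcomp Require Import mpoly.
From mathcomp Require Import boolp classical_sets reals.

Set Implicit Arguments.
Unset Strict Implicit.
Unset Printing Implicit Defensive.

Import Order.TTheory GRing.Theory Num.Theory.
Local Open Scope classical_set_scope.
Local Open Scope ring_scope.
Local Open Scope quotient_scope.

Section Span.
Variables (K : fieldType) (V : lmodType K).

Definition lspan (G : set V) : set V := [set v | exists s : seq (K * V),
  (forall a, a \in s -> G a.2) /\ v = \sum_(a <- s) a.1 *: a.2].

Definition lspanb (G : set V) : {pred V} := fun v => `[< lspan G v >].

Lemma lspanbP (G : set V) (v : V) : reflect (lspan G v) (v \in lspanb G).
Proof. exact: asboolP. Qed.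

Lemma lspan_gen (G : set V) : G `<=` lspan G.
Proof.
move=> v Gv; exists [:: (1, v)]; split; last by rewrite big_seq1 scale1r.
by move=> a; rewrite inE => /eqP ->.
Qed.

Lemma lspan_submod_closed (G : set V) : submod_closed (lspanb G).
Proof.
split.
  by apply/lspanbP; exists [::]; rewrite big_nil.
move=> c u v /lspanbP[s [Gs ->]] /lspanbP[t [Gt ->]]; apply/lspanbP.
exists ([seq (c * a.1, a.2) | a <- s] ++ t); split.
  move=> a; rewrite mem_cat => /orP[/mapP[b bs ->]|]; [exact: (Gs _ bs)|exact: Gt].
rewrite big_cat big_map scaler_sumr; congr (_ + _).
by apply: eq_bigr => a _; rewrite scalerA.
Qed.

HB.instance Definition _ (G : set V) :=
  GRing.isSubmodClosed.Build K V (lspanb G) (lspan_submod_closed G).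

Lemma lspan_min (G : set V) (S : submodClosed V) :
  (forall v, G v -> v \in S) -> forall v, lspan G v -> v \in S.
Proof.
move=> GS v [s [Gs ->]]; rewrite big_seq.
by apply: rpred_sum => a /Gs Ga; apply/rpredZ/GS.
Qed.

Record submod (G : set V) :=
  Submod { submod_val : V; _ : submod_val \in lspanb G }.

HB.instance Definition _ (G : set V) := [isSub for @submod_val G].
HB.instance Definition _ (G : set V) := [Choice of submod G by <:].
HB.instance Definition _ (G : set V) :=
  [SubChoice_isSubLmodule of submod G by <:].

(* V modulo the submodule spanned by G. *)
Definition quotmod (G : set V) : Type := Quotient.quot (lspanb G).

Section Quotmod.
Variable G : set V.

HB.instance Definition _ := GRing.Zmodule.on (quotmod G).

Definition qpi (v : V) : quotmod G := \pi_(Quotient.quot (lspanb G)) v.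

Lemma qpi_eq (u v : V) : (qpi u == qpi v) = (u - v \in lspanb G).
Proof. by rewrite /qpi -Quotient.idealrBE. Qed.

Lemma qpi_surj (x : quotmod G) : exists v, x = qpi v.
Proof. by exists (repr x); rewrite /qpi reprK. Qed.

Lemma qpiD : {morph qpi : u v / u + v}.
Proof. by move=> u v; rewrite /qpi !piE. Qed.

Definition qscale (c : K) (x : quotmod G) : quotmod G :=
  qpi (c *: repr (x : Quotient.quot (lspanb G))).

Lemma qscaleE c v : qscale c (qpi v) = qpi (c *: v).
Proof.
apply/eqP; rewrite qpi_eq -scalerBr rpredZ // -qpi_eq.
by rewrite /qpi reprK.
Qed.

Lemma qscaleA a b x : qscale a (qscale b x) = qscale (a * b) x.
Proof. by have [v ->] := qpi_surj x; rewrite !qscaleE scalerA. Qed.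

Lemma qscale1 : left_id 1 qscale.
Proof. by move=> x; have [v ->] := qpi_surj x; rewrite qscaleE scale1r. Qed.

Lemma qscaleDr : right_distributive qscale +%R.
Proof.
move=> a x y; have [u ->] := qpi_surj x; have [v ->] := qpi_surj y.
by rewrite -qpiD !qscaleE scalerDr qpiD.
Qed.

Lemma qscaleDl x : {morph qscale^~ x : a b / a + b}.
Proof.
by move=> a b; have [v ->] := qpi_surj x; rewrite !qscaleE scalerDl qpiD.
Qed.

HB.instance Definition _ := GRing.Zmodule_isLmodule.Build K (quotmod G)
  qscaleA qscale1 qscaleDr qscaleDl.

Lemma qpi_linear : linear qpi.
Proof. by move=> a u v; rewrite qpiD -qscaleE. Qed.

HB.instance Definition _ := GRing.isLinear.Build K V (quotmod G) *:%R qpi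
  qpi_linear.

End Quotmod.
End Span.

Section Vspan.
Variables (K : fieldType) (V : vectType K).

Definition vspan (A : set V) : {vspace V} :=
  xget 0%VS [set U : {vspace V} | [set` U] = lspan A].

Lemma vspanP (A : set V) (v : V) : reflect (lspan A v) (v \in vspan A).
Proof.
suff E : [set` vspan A] = lspan A.
  by apply: (iffP idP) => [vA|]; rewrite -E.
clear v; suff [U EU] : exists U : {vspace V}, [set` U] = lspan A.
  by rewrite /vspan; case: xgetP => [W -> //|/(_ U)].
pose P n := `[< exists U : {vspace V}, \dim U = n /\ [set` U] `<=` lspan A >].
have exP : exists n, P n.
  exists 0%N; apply/asboolP; exists 0%VS; rewrite dimv0; split=> // v /=.
  by rewrite memv0 => /eqP ->; apply/lspanbP; rewrite rpred0.
have ubP n : P n -> (n <= \dim {:V})%N.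
  by move=> /asboolP[U [<- _]]; rewrite dimvS // subvf.
case: (ex_maxnP exP ubP) => n /asboolP[U [dU UA]] maxn.
exists U; apply/seteqP; split=> // v Av /=.
have UvA : [set` (U + <[v]>)%VS] `<=` lspan A.
  move=> w /= /memv_addP[u /UA Au [_ /vlineP[c ->] ->]].
  by apply/lspanbP/rpredD; [apply/lspanbP | apply/rpredZ/lspanbP].
have /maxn : P (\dim (U + <[v]>)) by apply/asboolP; exists (U + <[v]>)%VS.
rewrite -dU => dle.
have /eqP -> : U == (U + <[v]>)%VS by rewrite eqEdim addvSl.
exact: subvP (addvSr U _) _ (memv_line v).
Qed.

Lemma mem_vspan (A : set V) (v : V) :
  A 0 -> (forall c x y, A x -> A y -> A (c *: x + y)) ->
  v \in vspan A <-> A v.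
Proof.
move=> A0 AZD; split=> [/vspanP[s [As ->]]|Av]; last exact/vspanP/lspan_gen.
elim: s As => [|a s IHs] As; first by rewrite big_nil.
rewrite big_cons; apply: AZD; first by apply: As; rewrite inE eqxx.
by apply: IHs => b bs; apply: As; rewrite inE bs orbT.
Qed.

End Vspan.

Section Tensor.
Variables (K : fieldType) (V W : lmodType K).

Definition bilinear_relations : set {freeg (V * W) / K} :=
  [set r | (exists a u v w,
              r = << (a *: u + v, w) >> - a *: << (u, w) >> - << (v, w) >>)
        \/ (exists a u v w,
              r = << (u, a *: v + w) >> - a *: << (u, v) >> - << (u, w) >>)].

Definition tensor := quotmod bilinear_relations.

HB.instance Definition _ := GRing.Lmodule.on tensor.

End Tensor.

(* The exterior algebra of Q^d: w S is the coefficient of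
   e_i1 /\ ... /\ e_ip, where S = {i1 < ... < ip}. *)

Notation ext d := {ffun {set 'I_d} -> rat^o}.

Definition pairing (K : pzRingType) d (m v : 'rV[K]_d) : K :=
  \sum_i m 0 i * v 0 i.

Section Exterior.
Variable d : nat.
Implicit Types (m e : 'rV[rat]_d) (w : ext d) (S : {set 'I_d}).

Definition ext_sign S (i : 'I_d) : rat :=
  (-1) ^+ #|[set j in S | (j < i)%N]|.

Definition ext1 : ext d := [ffun S : {set 'I_d} => (S == finset.set0)%:R].

Definition wedge1 m w : ext d :=
  [ffun S : {set 'I_d} => \sum_(i in S) ext_sign S i * m 0 i * w (S :\ i)%SET].

(* The contraction of w by e; see contract_wedge1. *)
Definition contract e w : ext d :=
  [ffun S : {set 'I_d} =>
     \sum_(i | i \notin S) ext_sign S i * e 0 i * w (i |: S)%SET].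

Definition wedge (s : seq 'rV[rat]_d) : ext d := foldr wedge1 ext1 s.

Definition extpow (p : int) (U : {vspace 'rV[rat]_d}) : {vspace ext d} :=
  if p is Posz q then
    vspan [set wedge s | s in [set s | size s = q /\ {subset s <= U}]]
  else 0%VS.

Lemma contract_is_linear e : linear (contract e).
Proof.
move=> a u v; apply/ffunP => S; rewrite !ffunE scaler_sumr -big_split /=.
by apply: eq_bigr => i _; rewrite !ffunE mulrDr !scalerAr.
Qed.

HB.instance Definition _ e :=
  GRing.isLinear.Build rat (ext d) (ext d) *:%R (contract e)
    (contract_is_linear e).

Lemma wedge1_is_linear m : linear (wedge1 m).
Proof.
move=> a u v; apply/ffunP => S; rewrite !ffunE scaler_sumr -big_split /=.
by apply: eq_bigr => i _; rewrite !ffunE mulrDr !scalerAr.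
Qed.

HB.instance Definition _ m :=
  GRing.isLinear.Build rat (ext d) (ext d) *:%R (wedge1 m)
    (wedge1_is_linear m).

Lemma contract_ext1 e : contract e ext1 = 0.
Proof.
apply/ffunP => S; rewrite !ffunE big1 // => i _.
rewrite ffunE (_ : (_ == _) = false) ?mulr0 //.
by apply/eqP => /setP/(_ i); rewrite !inE eqxx.
Qed.

Lemma ext_signD S i j : i != j ->
  ext_sign (S :\ i)%SET j = ext_sign S j * (-1) ^+ ((i \in S) && (i < j)%N).
Proof.
move=> ij; rewrite /ext_sign [X in _ = (-1) ^+ X * _](cardsD1 i) !inE.
rewrite addnC exprD -mulrA -expr2 sqrr_sign mulr1; congr (_ ^+ #|pred_of_set _|).
by apply/setP => k; rewrite !inE andbA.
Qed.

Lemma ext_signU S i j : i != j -> i \notin S ->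
  ext_sign (i |: S)%SET j = ext_sign S j * (-1) ^+ (i < j)%N.
Proof.
move=> ij iS; rewrite -[S in RHS](setU1K iS) ext_signD // !inE eqxx /=.
by rewrite -mulrA -expr2 sqrr_sign mulr1.
Qed.

Lemma ext_signDid S i : ext_sign (S :\ i)%SET i = ext_sign S i.
Proof.
rewrite /ext_sign; congr (_ ^+ #|pred_of_set _|); apply/setP => k.
by rewrite !inE; case: (eqVneq k i) => [->|//]; rewrite ltnn !andbF.
Qed.

Lemma ext_signUid S i : ext_sign (i |: S)%SET i = ext_sign S i.
Proof.
rewrite /ext_sign; congr (_ ^+ #|pred_of_set _|); apply/setP => k.
by rewrite !inE; case: (eqVneq k i) => [->|//]; rewrite ltnn !andbF.
Qed.

(* Contraction is the left antiderivation extending the pairing. *)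
Lemma contract_wedge1 e m w :
  contract e (wedge1 m w) = pairing m e *: w - wedge1 m (contract e w).
Proof.
apply/ffunP => S; rewrite !ffunE.
pose s := ext_sign S.
have sqr_s i : s i * s i = 1 by rewrite -expr2 sqrr_sign.
pose F i j := s i * s j * e 0 i * m 0 j * w ((i |: S) :\ j)%SET.
have E1 i : i \notin S ->
    s i * e 0 i * wedge1 m w (i |: S)%SET =
    m 0 i * e 0 i * w S + \sum_(j in S) (-1) ^+ (i < j)%N * F i j.
  move=> iS; rewrite ffunE big_setU1 //= mulrDr finset.setU1K //; congr (_ + _).
    rewrite ext_signUid -/(s i).
    by rewrite -[RHS]mul1r -(sqr_s i); ring.
  rewrite mulr_sumr; apply: eq_bigr => j jS.
  rewrite ext_signU //; last by apply: contraNneq iS => ->.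
  by rewrite /F /s; ring.
have E2 j : j \in S ->
    s j * m 0 j * contract e w (S :\ j)%SET =
    m 0 j * e 0 j * w S + \sum_(i | i \notin S) (-1) ^+ (j < i)%N * F i j.
  move=> jS; rewrite ffunE (bigD1 j) /= ?inE ?eqxx // mulrDr finset.setD1K //.
  congr (_ + _).
    rewrite ext_signDid -/(s j).
    by rewrite -[RHS]mul1r -(sqr_s j); ring.
  rewrite mulr_sumr; apply: eq_big => [i|i].
    by rewrite !inE; case: eqP => [->|_]; rewrite ?jS ?andbT.
  rewrite !inE => /andP[_ ij].
  rewrite ext_signD 1?eq_sym // jS /F /s.
  have -> : (i |: S :\ j = (i |: S) :\ j)%SET.
    by apply/setP => k; rewrite !inE; case: (eqVneq k i) => [->|//]; rewrite ij.
  by ring.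
rewrite (eq_bigr _ E1) (eq_bigr _ E2) !big_split /=.
have -> : pairing m e = \sum_(i in S) m 0 i * e 0 i
                      + \sum_(i | i \notin S) m 0 i * e 0 i.
  by rewrite /pairing (bigID (mem S)).
rewrite -[_ *: _]/(_ * _).
rewrite mulrDl !mulr_suml.
suff -> : \sum_(i | i \notin S) \sum_(j in S) (-1) ^+ (i < j)%N * F i j =
    - \sum_(j in S) \sum_(i | i \notin S) (-1) ^+ (j < i)%N * F i j.
  by ring.
rewrite [in RHS]exchange_big -sumrN; apply: eq_bigr => i iS.
rewrite -sumrN; apply: eq_bigr => j jS; rewrite -mulNr; congr (_ * _).
case: (ltngtP i j) => //= /val_inj E.
by rewrite E jS in iS.
Qed.

Lemma wedge1_wedge1 m w : wedge1 m (wedge1 m w) = 0.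
Proof.
apply/ffunP => S; rewrite !ffunE.
pose F i j := ext_sign S i * ext_sign S j * m 0 i * m 0 j
              * w ((S :\ i) :\ j)%SET.
pose G (i j : 'I_d) := (-1) ^+ (i < j)%N * F i j.
have E i : i \in S -> ext_sign S i * m 0 i * wedge1 m w (S :\ i)%SET =
    \sum_(j in S | i != j) G i j.
  move=> iS; rewrite ffunE mulr_sumr; apply: eq_big => [j|j].
    by rewrite !inE andbC eq_sym.
  by rewrite !inE => /andP[ji jS]; rewrite ext_signD 1?eq_sym // iS /G /F; ring.
rewrite (eq_bigr _ E).
have NG i j : i != j -> G j i = - G i j.
  move=> ij; rewrite /G -mulNr; congr (_ * _); last first.
    rewrite /F (_ : (S :\ j) :\ i = (S :\ i) :\ j)%SET; first by ring.
    by apply/setP => k; rewrite !inE andbCA.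
  by case: (ltngtP i j) ij => //= /val_inj ->; rewrite eqxx.
set X := LHS; suff : X = - X.
  by move/eqP; rewrite -addr_eq0 -mulr2n mulrn_eq0 => /eqP.
rewrite {1}/X (exchange_big_dep (mem S)) /=; last by move=> i j _ /andP[].
rewrite /X -sumrN; apply: eq_bigr => i iS; rewrite -sumrN.
apply: eq_big => [j|j /and3P[_ _ ji]]; first by rewrite iS /= eq_sym.
by rewrite NG // eq_sym.
Qed.

End Exterior.

(* The lattices are M = N = Z^d with the pairing above, so that
   M_Q = N_Q = Q^d and N_R = R^d; all vectors are rows. *)

Section Fans.
Variables (R : realType) (d : nat).
Local Notation NR := 'rV[R]_d.
Implicit Types (sigma tau gamma : set NR) (Sigma : {fset set NR}).

Definition intvec (v : 'rV[int]_d) : NR := map_mx intr v.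
Definition ratvec (v : 'rV[rat]_d) : NR := map_mx ratr v.

Definition cone_hull (s : seq NR) : set NR :=
  [set x | exists2 c : 'I_(size s) -> R,
     forall i, 0 <= c i & x = \sum_i c i *: s`_i].

Definition convex_cone tau :=
  [/\ tau 0, forall x y, tau x -> tau y -> tau (x + y)
    & forall (t : R) x, 0 <= t -> tau x -> tau (t *: x)].

Definition rational_cone sigma :=
  exists s : seq 'rV[int]_d, sigma = cone_hull (map intvec s).

Definition strongly_convex sigma := forall x, sigma x -> sigma (- x) -> x = 0.

Definition simplicial_cone sigma := exists s : seq 'rV[int]_d,
  free (map intvec s) /\ sigma = cone_hull (map intvec s).

Definition cdim sigma : nat := \dim (vspan sigma).

Definition face gamma sigma := exists2 m : NR,
  forall x, sigma x -> 0 <= pairing m x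
  & gamma = [set x | sigma x /\ pairing m x = 0].

Definition facet gamma sigma :=
  face gamma sigma /\ cdim sigma = (cdim gamma).+1.

Definition fan Sigma :=
  [/\ forall sigma, sigma \in Sigma -> rational_cone sigma,
      forall sigma, sigma \in Sigma -> strongly_convex sigma,
      forall sigma gamma, sigma \in Sigma -> face gamma sigma ->
        gamma \in Sigma
    & forall sigma gamma, sigma \in Sigma -> gamma \in Sigma ->
        face (sigma `&` gamma) sigma /\ face (sigma `&` gamma) gamma].

Definition support Sigma : set NR :=
  [set x | exists2 sigma, sigma \in Sigma & sigma x].

Definition simplicial_fan Sigma :=
  fan Sigma /\ forall sigma, sigma \in Sigma -> simplicial_cone sigma.

Definition simplicial_subdivision Sigma tau :=
  simplicial_fan Sigma /\ support Sigma = tau.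

Definition perp gamma : {vspace 'rV[rat]_d} :=
  vspan [set m | forall x, gamma x -> pairing (ratvec m) x = 0].

Lemma mem_perp gamma m :
  m \in perp gamma <-> forall x, gamma x -> pairing (ratvec m) x = 0.
Proof.
apply: mem_vspan => [x _|c u v u0 v0 x gx].
  by rewrite /pairing big1 // => i _; rewrite !mxE rmorph0 mul0r.
have <- : ratr c * pairing (ratvec u) x + pairing (ratvec v) x = 0.
  by rewrite u0 // v0 // mulr0 addr0.
rewrite /pairing mulr_sumr -big_split; apply: eq_bigr => i _.
by rewrite !mxE rmorphD rmorphM mulrDl -mulrA.
Qed.

(* The Ishida complex. The space of all families (x gamma) indexed by the
   cones of Sigma contains every C^j(Sigma, l) as a subspace, and delta is
   the restriction of one endomorphism of it. *)

Definition facet_vectors Sigma (e : set NR -> set NR -> 'rV[rat]_d) :=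
  forall gamma gamma', gamma \in Sigma -> gamma' \in Sigma ->
    facet gamma gamma' ->
    [set x - y | x in gamma' & y in gamma] =
    [set t *: ratvec (e gamma gamma') + z
       | t in [set t : R | 0 <= t] & z in [set` vspan gamma]].

Section Ishida.
Variables (Sigma : {fset set NR}) (e : set NR -> set NR -> 'rV[rat]_d).

Definition ishida_space (l j : nat) : {vspace {ffun Sigma -> ext d}} :=
  vspan [set x : {ffun Sigma -> ext d} | forall gamma : Sigma,
    x gamma \in if cdim (val gamma) == j
                then extpow (l%:Z - j%:Z) (perp (val gamma)) else 0%VS].

Lemma mem_ishida_space l j (x : {ffun Sigma -> ext d}) :
  x \in ishida_space l j <-> forall gamma : Sigma,
    x gamma \in if cdim (val gamma) == j
                then extpow (l%:Z - j%:Z) (perp (val gamma)) else 0%VS.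
Proof.
apply: mem_vspan => [g|c u v Cu Cv g]; rewrite !ffunE ?mem0v //.
by apply: rpredD; [apply: rpredZ | apply: Cv].
Qed.

Definition delta_fun (x : {ffun Sigma -> ext d}) : {ffun Sigma -> ext d} :=
  [ffun gamma' : Sigma =>
     \sum_(gamma : Sigma | `[< facet (val gamma) (val gamma') >])
        contract (e (val gamma) (val gamma')) (x gamma)].

Lemma delta_is_linear : linear delta_fun.
Proof.
move=> a u v; apply/ffunP => g; rewrite !ffunE scaler_sumr -big_split /=.
by apply: eq_bigr => h _; rewrite !ffunE linearP.
Qed.

HB.instance Definition _ := GRing.isLinear.Build rat {ffun Sigma -> ext d}
  {ffun Sigma -> ext d} *:%R delta_fun delta_is_linear.

Definition delta : 'End({ffun Sigma -> ext d}) := linfun delta_fun.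

(* facet_vectors fixes e gamma gamma' only up to a positive multiple and modulo
   the span of gamma, and delta \o delta = 0 is a condition on these multiples.
   For simplicial Sigma it holds if e gamma gamma' is the primitive generator
   of the ray of gamma' outside gamma: contractions anticommute. *)
Definition ishida_complex (l : nat) :=
  forall j x, x \in ishida_space l j -> delta (delta x) = 0.

Definition cocycles (l k : nat) : {vspace {ffun Sigma -> ext d}} :=
  (ishida_space l k :&: lker delta)%VS.

Definition coboundaries (l k : nat) : {vspace {ffun Sigma -> ext d}} :=
  if k is j.+1 then (delta @: ishida_space l j)%VS else 0%VS.

Definition ishida_cohomology (l k : nat) : lmodType rat :=
  quotmod [set z : subvs_of (cocycles l k) | vsval z \in coboundaries l k].

End Ishida.

Definition primitive (v : 'rV[int]_d) :=
  forall (c : int) (w : 'rV[int]_d), v = c *: w -> `|c| = 1.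

Definition ray_generators Sigma n (ray : 'I_n -> 'rV[int]_d) :=
  [/\ injective ray,
      forall i, primitive (ray i) /\ cone_hull [:: intvec (ray i)] \in Sigma
    & forall rho, rho \in Sigma -> cdim rho = 1%N ->
        exists i, rho = cone_hull [:: intvec (ray i)]].

Section Chow.
Variables (Sigma : {fset set NR}) (n : nat) (ray : 'I_n -> 'rV[int]_d).

Definition linear_relations : set {mpoly rat[n]} :=
  [set \sum_i (pairing m (ray i))%:~R *: 'X_i | m in [set: 'rV[int]_d]].

Definition stanley_reisner : set {mpoly rat[n]} :=
  [set \prod_(i in J) 'X_i | J in [set J : {set 'I_n} |
     ~ exists2 sigma, sigma \in Sigma
       & forall i, i \in J -> sigma (intvec (ray i))]].

(* The span of the multiples of all generators is the ideal
   P(Sigma) + SR(Sigma); only the Q-vector space structure of the Chow ring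
   is set up. *)
Definition chow : lmodType rat :=
  quotmod [set q * g | q in [set: {mpoly rat[n]}]
                     & g in linear_relations `|` stanley_reisner].

Definition chow_degree (k : nat) : lmodType rat :=
  submod [set x : chow |
    exists2 p : {mpoly rat[n]}, p \is k.-homog & x = qpi _ p].

End Chow.
End Fans.

(* Main.v *)
(* Both sides have finite dimension, so it suffices to compare dimensions. The
   multiples allowed in the coboundary form a multiplicative cocycle and can be
   normalised away; replacing a simplicial cone by the set of its rays, one gets
   complexes C(B, l) of forms that are moreover killed by a space B of additional
   vectors. If B is a complement of the span of tau, then H^k(B, l) = 0 for k < l.
   Indeed, let a double complex be indexed by the pairs of a cone and an interior
   cone containing it: its columns are Koszul complexes, and its rows are exact
   because the interior of the convex cone tau is contractible. The latter is
   proved modulo 2, by filling cycles of dual cells with cones in general position,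
   and lifted to the rationals by comparing ranks. Removing the vectors of B one at
   a time then gives dim H^k(l) = dim H^k(k) * dim wedge^(l - k) tau^perp. Finally
   H^k(k) is A_k: the squarefree monomials of the cones with k rays span A_k, and a
   linear functional on them that kills the coboundaries extends to all monomials,
   killing the ideal, by recursion on the support. *)
Require Import Defs.
From HB Require Import structures.
From mathcomp Require Import all_boot all_order all_algebra.
From mathcomp Require Import ring lra zify.
From mathcomp Require Import finmap freeg.
From mathcomp Require Import mpoly.
From mathcomp Require Import boolp classical_sets reals.

Set Implicit Arguments.
Unset Strict Implicit.
Unset Printing Implicit Defensive.

Import Order.TTheory GRing.Theory Num.Theory.
Local Open Scope ring_scope.

(** * Linear inequalities and general position *)

(** The cone [tau] may contain lines or be the whole space, so no hyperplane section is at hand; the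
    geometric input is that finitely many simplices near a cone have a common cone point in general
    position ([near_cone]), which rests on convexity alone. Counting intersections modulo 2 spares
    the orientation of the dual cells. Passing to the rationals works because the incidence matrices
    are integral: their ranks can only grow from F_2 to the rationals, while the vanishing of their
    product bounds them from above. The vectors of [B] are needed at the bottom of the Koszul
    columns. A form of degree [l] killed by [B] and by an interior cone with m rays lives on a space
    of dimension [d - \dim B - m], which is r - m if [B] is a complement, so it vanishes when r < l
    + m. The zigzag for k < l moves along a diagonal that ends inside this region; without [B] it
    would not. The condition that delta squares to zero can only be tested on forms, hence on cones
    with at most [l] rays. Compatibility of the multipliers is known for these alone, and this
    suffices because larger cones carry no forms. *)

Lemma pairing_is_linear (K : comPzRingType) d (m : 'rV[K]_d) :
  linear_for *%R (pairing m).
Proof.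
move=> c u v; rewrite /pairing mulr_sumr -big_split; apply: eq_bigr => i _.
by rewrite !mxE mulrDr mulrCA.
Qed.

HB.instance Definition _ (K : comPzRingType) d (m : 'rV[K]_d) :=
  GRing.isLinear.Build K 'rV[K]_d K *%R (pairing m) (pairing_is_linear m).

Lemma pairingC (K : comPzRingType) d (u v : 'rV[K]_d) :
  pairing u v = pairing v u.
Proof. by apply: eq_bigr => i _; rewrite mulrC. Qed.

Lemma pairing_self_gt0 (K : realFieldType) d (v : 'rV[K]_d) :
  v != 0 -> 0 < pairing v v.
Proof.
move=> v0; have ge i : 0 <= v 0 i * v 0 i by rewrite -expr2 sqr_ge0.
rewrite lt_def sumr_ge0 ?andbT //; apply: contra v0 => /eqP s0.
apply/eqP/rowP => i; rewrite mxE; apply/eqP.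
by rewrite -sqrf_eq0 expr2; apply/eqP/(psumr_eq0P _ s0).
Qed.

(** Stands in for topology in the general position arguments: finitely many strict inequalities
    survive a short move along a line. *)
Lemma small_perturbation (K : realFieldType) (T : eqType) (s : seq T)
    (f g : T -> K) : {in s, forall x, 0 < f x} ->
  exists2 e, 0 < e & {in s, forall x t, 0 <= t <= e -> 0 < f x + t * g x}.
Proof.
elim: s => [|x s IHs] fs; first by exists 1.
have [|e e0 es] := IHs; first by move=> y ys; apply: fs; rewrite inE ys orbT.
have fx : 0 < f x by apply: fs; rewrite inE eqxx.
(* The 1 avoids a zero denominator and leaves slack: [f x + t * g x >= t] for [0 <= t <= e']. *)
pose e' := f x / (1 + `|g x|).
have den : 0 < 1 + `|g x| by rewrite ltr_pwDl.
exists (Num.min e e'); first by rewrite lt_min e0 divr_gt0.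
move=> y ys t /andP[t0]; rewrite le_min => /andP[te te'].
move: ys; rewrite inE => /orP[/eqP ->|ys]; last by apply: es => //; rewrite t0.
have : t * (1 + `|g x|) <= f x by rewrite -ler_pdivlMr.
case: (leP 0 t) t0 => // t0 _.
have : t * - g x <= t * `|g x| by rewrite ler_wpM2l // -normrN ler_norm.
case: (eqVneq t 0) => [->|tn0]; first by rewrite !mul0r addr0.
have : 0 < t by rewrite lt_def tn0.
by nra.
Qed.

(** Gordan's alternative, by induction on the list. If the functional found for [s] is negative at
    [v], the vectors of [s] are projected along [v] to its kernel; the projection adds nonnegative
    multiples of [v], so a nonnegative relation of the projections is one of the original
    vectors. *)
Lemma gordan (K : realFieldType) r (s : seq 'rV[K]_r) :
  (forall c : nat -> K, (forall j, 0 <= c j) ->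
     \sum_(j < size s) c j *: s`_j = 0 -> forall j, (j < size s)%N -> c j = 0) ->
  exists h : 'rV[K]_r, {in s, forall v, 0 < pairing h v}.
Proof.
have [m] := ubnP (size s); elim: m s => // m IHm [|v s] /= sz_s free_s.
  by exists 0.
have rel0 (c : nat -> K) b : (forall j, 0 <= c j) -> 0 <= b ->
    b *: v + \sum_(j < size s) c j *: s`_j = 0 ->
    b = 0 /\ forall j, (j < size s)%N -> c j = 0.
  move=> c0 b0 E; pose c' j := if j is j'.+1 then c j' else b.
  have c'0 : forall j, (j < (size s).+1)%N -> c' j = 0.
    apply: free_s; last by rewrite big_ord_recl.
    by case=> [|j]; [exact: b0 | exact: c0].
  by split=> [|j js]; [apply: (c'0 0%N) | apply: (c'0 j.+1)].
have [c c0 E j js|h hs] := IHm s sz_s.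
  by have [] := rel0 c 0 c0 (lexx 0) => [|_]; [rewrite scale0r add0r | apply].
have [hv|hv|hv] := ltrgtP (pairing h v) 0; last 2 first.
- by exists h => w; rewrite inE => /orP[/eqP ->|/hs].
- have v0 : v != 0.
    apply/negP => /eqP v0; have [] := rel0 (fun=> 0) 1 => //.
      by rewrite v0 scaler0 add0r big1 // => i _; rewrite scale0r.
    by move/eqP; rewrite oner_eq0.
  have [e e0 es] := small_perturbation (fun w => pairing v w) hs.
  exists (h + e *: v) => w; rewrite inE pairingC linearD linearZ /=.
  rewrite ![pairing w _]pairingC => /orP[/eqP ->|/es]; last first.
    by apply; rewrite ltW /=.
  by rewrite hv add0r mulr_gt0 // pairing_self_gt0.
pose al w := - (pairing h w / pairing h v).
have al0 w : w \in s -> 0 <= al w.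
  move=> /hs hw; rewrite /al oppr_ge0 mulr_ge0_le0 ?ltW // invr_lt0 //.
have [||h' hs'] := IHm [seq w + al w *: v | w <- s]; first by rewrite size_map.
  move=> c c0; rewrite size_map => E j js.
  have [] := rel0 c (\sum_(j < size s) c j * al s`_j) => //.
  - by apply: sumr_ge0 => i _; rewrite mulr_ge0 // al0 // mem_nth.
  - rewrite scaler_suml -big_split -[RHS]E; apply: eq_bigr => i _ /=.
    by rewrite (nth_map 0) // scalerDr scalerA addrC.
  by move=> _; apply.
pose g := h' - (pairing h' v / pairing h v) *: h.
have hv0 : pairing h v != 0 by rewrite lt_eqF.
have gE w : pairing g w = pairing h' w - (pairing h' v / pairing h v) * pairing h w.
  by rewrite pairingC linearB linearZ /= ![pairing w _]pairingC.
have gv : pairing g v = 0 by rewrite gE divfK // subrr.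
have gs : {in s, forall w, 0 < pairing g w}.
  move=> w ws; have := hs' _ (map_f (fun w => w + al w *: v) ws).
  rewrite linearD linearZ /= gE /al; congr (_ < _); field; exact: hv0.
have [e e0 es] := small_perturbation (fun w => - pairing h w) gs.
exists (g - e *: h) => w; rewrite pairingC linearB linearZ /=.
rewrite ![pairing w _]pairingC inE => /orP[/eqP ->|/es].
  by rewrite gv sub0r -mulrN mulr_gt0 // oppr_gt0.
by move=> /(_ e); rewrite mulrN; apply; rewrite ltW /=.
Qed.

Lemma F2_addrr (x : 'F_2) : x + x = 0.
Proof. exact/addrr_pchar2/pchar_Fp. Qed.

Lemma F2_oppr (x : 'F_2) : - x = x.
Proof. by apply/eqP; rewrite eq_sym -addr_eq0 F2_addrr. Qed.

Lemma nontrivial_relation (K : fieldType) (U : finType) r (w : U -> 'rV[K]_r) u0 :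
  (r.+1 < #|U|)%N ->
  exists q : U -> K, [/\ \sum_x q x *: w x = 0, q u0 = 0 & exists x, q x != 0].
Proof.
(* The extra column reads off the coefficient of [u0], so a relation among the rows has coefficient
   0 there. *)
move=> rU; pose A : 'M[K]_(#|U|, r + 1) :=
  \matrix_(i < #|U|) row_mx (w (enum_val i)) ((enum_val i == u0)%:R%:M).
have: kermx A != 0.
  rewrite -mxrank_eq0 mxrank_ker subn_eq0 -ltnNge.
  by apply: leq_ltn_trans (rank_leq_col A) _; rewrite addn1.
case/rowV0Pn => v /sub_kermxP vA v0; exists (fun x => v 0 (enum_rank x)).
have E : \sum_x v 0 (enum_rank x) *: row_mx (w x) ((x == u0)%:R%:M) = 0 :> 'rV_(r + 1).
  rewrite (reindex (@enum_val U U)) /=; last exact/onW_bij/enum_val_bij.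
  rewrite -[RHS]vA mulmx_sum_row; apply: eq_bigr => i _.
  by rewrite enum_valK rowK.
have EL : \sum_x v 0 (enum_rank x) *: w x = 0.
  move/(congr1 (@lsubmx _ _ _ _)): E; rewrite linear_sum linear0 => /= E.
  by rewrite -[RHS]E; apply: eq_bigr => x _; rewrite linearZ /= row_mxKl.
have ER : v 0 (enum_rank u0) = 0.
  move/(congr1 (@rsubmx _ _ _ _)): E; rewrite linear_sum linear0 => /= E.
  move/rowP/(_ 0): E; rewrite summxE mxE (bigD1 u0) //= big1 => [|x xu].
    by rewrite linearZ /= row_mxKr eqxx !mxE eqxx mulr1 addr0.
  by rewrite linearZ /= row_mxKr (negbTE xu) !mxE mul0rn mulr0.
split=> //; case/rV0Pn: v0 => j vj; exists (enum_val j).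
by rewrite enum_valK.
Qed.

(* The relations among the vectors form a plane, and those that are
   nonnegative form a cone in it, which is 0 or has exactly two edges. *)
Lemma even_positive_relations (K : realFieldType) (U : finType) r
    (w : U -> 'rV[K]_r) : #|U| = r.+2 ->
  (forall p : U -> K, \sum_x p x *: w x = 0 ->
     forall x y, x != y -> p x = 0 -> p y = 0 -> forall z, p z = 0) ->
  \sum_u `[< exists p : U -> K, [/\ \sum_x p x *: w x = 0, p u = 0
               & forall x, x != u -> 0 < p x] >]%:R = 0 :> 'F_2.
Proof.
move=> cU gen; pose val u := `[< exists p : U -> K, [/\ \sum_x p x *: w x = 0,
  p u = 0 & forall x, x != u -> 0 < p x] >].
rewrite -[LHS]/(\sum_u (val u)%:R).
case: (pickP val) => [u|] /=; last first.
  by move=> v0; rewrite big1 // => u _; rewrite v0.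
move=> vu; have /asboolP[p [Ep pu p0]] := vu.
have [u' u'u] : exists u', u' != u.
  have : (0 < #|predC1 u|)%N by rewrite cardC1 cU.
  by case/card_gt0P => u'; exists u'.
have [|q [Eq qu' [x qx]]] := nontrivial_relation w u'; first by rewrite cU.
wlog qu : q Eq qu' qx / q u = 1.
  move=> W; have qu : q u != 0.
    by apply: contraNneq qx => qu; apply/eqP/(gen _ Eq u' u).
  apply: (W (fun x => (q u)^-1 * q x)); rewrite ?qu' ?mulr0 ?mulVf //.
    transitivity ((q u)^-1 *: \sum_x q x *: w x); last by rewrite Eq scaler0.
    by rewrite scaler_sumr; apply: eq_bigr => y _; rewrite scalerA.
  by rewrite mulf_neq0 ?invr_eq0.
have comb a b (f g : U -> K) : \sum_x f x *: w x = 0 -> \sum_x g x *: w x = 0 ->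
    \sum_x (a * f x + b * g x) *: w x = 0.
  move=> Ef Eg; transitivity (a *: \sum_x f x *: w x + b *: \sum_x g x *: w x).
    rewrite !scaler_sumr -big_split; apply: eq_bigr => y _ /=.
    by rewrite scalerDl !scalerA.
  by rewrite Ef Eg !scaler0 addr0.
(* The second edge is [q] plus the least multiple of [p] that makes all coefficients nonnegative;
   the maximum is attained where a coefficient becomes 0. *)
have [x0 x0u x0max] : exists2 x0, x0 != u &
    forall x, x != u -> - q x / p x <= - q x0 / p x0.
  by case: (@arg_maxP _ _ _ u' (fun x => x != u) (fun x => - q x / p x) u'u)
    => x0; exists x0.
pose q' x := 1 * q x + (- q x0 / p x0) * p x.
have Eq' : \sum_x q' x *: w x = 0 by apply: comb.
have q'u : q' u = 1 by rewrite /q' pu qu; ring.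
have px0 : p x0 != 0 by rewrite gt_eqF ?p0.
have q'x0 : q' x0 = 0 by rewrite /q' divfK //; ring.
have q'0 y : y != x0 -> 0 < q' y.
  move=> yx0; case: (eqVneq y u) => [->|yu]; first by rewrite q'u.
  rewrite lt_def; apply/andP; split.
    apply/negP => /eqP q'y; have := gen _ Eq' y x0 yx0 q'y q'x0 u.
    by rewrite q'u => /eqP; rewrite oner_eq0.
  have := x0max _ yu; rewrite ler_pdivrMr ?p0 // /q'; lra.
have vx0 : val x0 by apply/asboolP; exists q'.
have only y : val y -> y = u \/ y = x0.
  case/asboolP=> f [Ef fy f0]; case: (eqVneq y u) => [|yu]; first by left.
  case: (eqVneq y x0) => [|yx0]; [by right | exfalso].
  have fu : 0 < f u by rewrite f0 // eq_sym.
  pose g x := (f u)^-1 * f x + (-1) * q' x.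
  have Eg : \sum_x g x *: w x = 0 by apply: comb.
  pose c := g x0 / p x0.
  pose h x := 1 * g x + (- c) * p x.
  have h0 : h y = 0.
    apply: (gen h _ u x0); rewrite 1?eq_sym //; first exact: comb.
      by rewrite /h /g pu q'u mulVf ?gt_eqF //; ring.
    by rewrite /h /c mulNr divfK //; ring.
  have c0 : 0 <= c.
    rewrite /c /g q'x0 mulr0 addr0 divr_ge0 ?ltW ?p0 //.
    by rewrite mulr_gt0 ?invr_gt0 // f0 // eq_sym.
  have := q'0 _ yx0; have := p0 _ yu; move: h0; rewrite /h /g fy mulr0.
  by nra.
rewrite (bigD1 u) //= (bigD1 x0) //= big1 => [|y /andP[yu yx0]].
  by rewrite vu vx0 addr0 F2_addrr.
suff /negbTE -> : ~~ val y by [].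
by apply/negP => /only[]/eqP; rewrite ?(negbTE yu) ?(negbTE yx0).
Qed.

(** * Chains modulo 2 *)

Section Chains.
Variable V : Type.
Implicit Types (f : seq V -> 'F_2) (s : seq V) (c : seq (seq V)).

(* Chains modulo 2 are lists of simplices, simplices are lists of vertices;
   a chain is only seen through the sums of functionals over it, so that the
   boundary operator appears as its transpose. *)
Definition face_sum f s : 'F_2 :=
  \sum_(j < size s) f (take j s ++ drop j.+1 s).

Definition chain_sum f c : 'F_2 := \sum_(s <- c) f s.

Lemma face_sum_cons f v s :
  face_sum f (v :: s) = f s + face_sum (f \o cons v) s.
Proof. by rewrite /face_sum big_ord_recl /= drop0. Qed.

(** The cone formula in transposed form: the boundary of the cone over [c] is [c] plus the cone over
    the boundary of [c]. *)
Lemma chain_sum_cone f v c :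
  chain_sum (face_sum f) (map (cons v) c) =
  chain_sum f c + chain_sum (face_sum (f \o cons v)) c.
Proof.
rewrite /chain_sum big_map -big_split; apply: eq_bigr => s _.
exact: face_sum_cons.
Qed.

Lemma chain_sum_flatten f (I : finType) (P : pred I) (F : I -> seq (seq V)) :
  chain_sum f (flatten [seq F i | i <- enum P]) = \sum_(i | P i) chain_sum f (F i).
Proof. by rewrite /chain_sum big_flatten big_map big_enum. Qed.

End Chains.

(** Square-zero identities are reduced to this sum. The diagonal is a hypothesis of its own because
    antisymmetry does not give it in characteristic 2. *)
Lemma sum_antisym (W : zmodType) (I : finType) (F : I -> I -> W) :
  (forall i j, F i j = - F j i) -> (forall i, F i i = 0) ->
  \sum_i \sum_j F i j = 0.
Proof.
move=> FC F0; pose lt (i j : I) := (enum_rank i < enum_rank j)%N.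
have E : \sum_i \sum_j F i j =
    \sum_i \sum_(j | lt i j) F i j + \sum_i \sum_(j | lt j i) F i j.
  rewrite -big_split; apply: eq_bigr => i _ /=.
  rewrite (bigID (lt i)) /=; congr (_ + _).
  rewrite (bigD1 i) /lt ?ltnn //= F0 add0r; apply: eq_bigl => j.
  by rewrite -leqNgt ltn_neqAle andbC (inj_eq val_inj) (inj_eq enum_rank_inj).
rewrite E [X in _ + X](exchange_big_dep xpredT) //=.
rewrite -big_split big1 // => i _ /=; rewrite -big_split big1 // => j _ /=.
by rewrite FC addNr.
Qed.

Lemma exists_normal (K : fieldType) r (s : seq 'rV[K]_r) :
  (size s < r)%N -> exists2 g : 'rV[K]_r, g != 0 & {in s, forall v, pairing g v = 0}.
Proof.
move=> sr; pose A : 'M[K]_(r, size s) := \matrix_(i, j) s`_j 0 i.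
have: kermx A != 0.
  rewrite -mxrank_eq0 mxrank_ker subn_eq0 -ltnNge.
  exact: leq_ltn_trans (rank_leq_col A) sr.
case/rowV0Pn => g /sub_kermxP gA g0; exists g => // v vs.
have js : (index v s < size s)%N by rewrite index_mem.
move/rowP/(_ (Ordinal js)): gA; rewrite !mxE => gA; rewrite -[RHS]gA.
by apply: eq_bigr => i _; rewrite mxE /= nth_index.
Qed.

Lemma gordan_fin (K : realFieldType) (U : finType) r (w : U -> 'rV[K]_r) :
  (forall p : U -> K, (forall x, 0 <= p x) -> \sum_x p x *: w x = 0 ->
     forall x, p x = 0) ->
  exists h : 'rV[K]_r, forall x, 0 < pairing h (w x).
Proof.
move=> free_w; have [|h hw] := @gordan K r [seq w x | x <- enum U].
  move=> c c0; rewrite size_map -cardE => E j jU.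
  rewrite -[j]/(nat_of_ord (Ordinal jU)) -[Ordinal _]enum_valK.
  apply: (free_w (fun x => c (enum_rank x))) => [x|]; first exact: c0.
  rewrite -[RHS]E (reindex (@enum_val U U)) /=; last exact/onW_bij/enum_val_bij.
  apply: eq_bigr => i _; rewrite enum_valK (nth_map (enum_val i)) -?cardE //.
  by rewrite -enum_val_nth.
by exists h => x; apply: hw; rewrite map_f // mem_enum.
Qed.

(** Openness along half-lines is enough, since a point is moved in one direction at a time: off the
    hyperplane of [g] in the direction [g] itself. The complement of that hyperplane in [O] is open
    in the same sense, which drives the induction. *)
Lemma avoid_hyperplanes (K : realFieldType) r (gs : seq 'rV[K]_r)
    (O : 'rV[K]_r -> Prop) :
  (forall b v, O b -> exists2 e, 0 < e & forall t, 0 <= t <= e -> O (b + t *: v)) ->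
  (exists b, O b) -> all (fun g => g != 0) gs ->
  exists2 b, O b & {in gs, forall g, pairing g b != 0}.
Proof.
elim: gs O => [|g gs IH] O open_O [b Ob] /=; first by exists b.
case/andP=> g0 gs0; pose O' b := O b /\ pairing g b != 0.
have [||b' [Ob' gb'] gsb'] := IH O' _ _ gs0; last first.
- by exists b' => // h; rewrite inE => /orP[/eqP ->|/gsb'].
- have [gb|gb] := eqVneq (pairing g b) 0; last by exists b.
  have [e e0 eO] := open_O b g Ob; exists (b + e *: g); split.
    by apply: eO; rewrite lexx ltW.
  by rewrite linearD linearZ /= gb add0r mulf_neq0 ?gt_eqF // pairing_self_gt0.
move=> {}b v [{}Ob gb].
have [e e0 eO] := open_O b v Ob.
have pos : {in [:: Num.sg (pairing g b)], forall x, 0 < x * pairing g b}.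
  by move=> x; rewrite inE => /eqP ->; rewrite -normrEsg normr_gt0.
have [e' e'0 e'P] := small_perturbation (fun x => x * pairing g v) pos.
exists (Num.min e e'); first by rewrite lt_min e0.
move=> t /andP[t0]; rewrite le_min => /andP[te te']; split.
  by apply: eO; rewrite t0.
have := e'P _ (mem_head _ _) t; rewrite t0 te' => /(_ isT).
rewrite linearD linearZ /=; apply: contraTneq => E.
by rewrite mulrCA -mulrDr E mulr0 ltxx.
Qed.

(** * Comparison of ranks over F_2 and over the rationals *)

Lemma unit_minor (F : fieldType) m n (A : 'M[F]_(m, n)) :
  exists (f : 'I_(\rank A) -> 'I_m) (g : 'I_(\rank A) -> 'I_n),
    mxsub f g A \in unitmx.
Proof.
have fA := maxrowsub_free A.
have fullT : row_full (rowsub (maxrankfun A) A)^T.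
  by rewrite /row_full mxrank_tr; exact: fA.
exists (maxrankfun A), (fullrankfun fullT).
have := fullrowsub_unit fullT; rewrite -unitmx_tr; congr (_ \in unitmx).
by apply/matrixP => i j; rewrite !mxE.
Qed.

Lemma leq_rank_mxsub (F : fieldType) m n p q (A : 'M[F]_(m, n))
    (f : 'I_p -> 'I_m) (g : 'I_q -> 'I_n) :
  (\rank (mxsub f g A) <= \rank A)%N.
Proof.
have rowS p' n' (B : 'M[F]_(m, n')) (f' : 'I_p' -> 'I_m) :
    (\rank (rowsub f' B) <= \rank B)%N.
  by apply/mxrankS/row_subP => i; rewrite row_rowsub row_sub.
rewrite mxsubrc; apply: leq_trans (rowS _ _ _ _) _.
rewrite -mxrank_tr -[leqRHS]mxrank_tr.
rewrite (_ : _^T = rowsub g A^T); last by apply/matrixP => i j; rewrite !mxE.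
by apply/mxrankS/row_subP => i; rewrite row_rowsub row_sub.
Qed.

(* A minor that is nonzero modulo 2 is nonzero. *)
Lemma leq_rank_F2 m n (A : 'M[int]_(m, n)) :
  (\rank (map_mx (fun z : int => z%:~R : 'F_2) A) <=
   \rank (map_mx (fun z : int => z%:~R : rat) A))%N.
Proof.
set A2 := map_mx _ A; set AQ := map_mx _ A.
have [f [g fg]] := unit_minor A2.
have : mxsub f g AQ \in unitmx.
  move: fg; rewrite -!map_mxsub !unitmxE !det_map_mx !unitfE.
  by apply: contraNneq => /eqP; rewrite intr_eq0 => /eqP ->.
by rewrite -row_free_unit => /eqP {1}<-; apply: leq_rank_mxsub.
Qed.

(** Exactness modulo 2 says that n is at most the sum of the two ranks. Ranks do not drop over the
    rationals, and there [A *m B = 0] gives the opposite inequality. The equality of ranks is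
    symmetric under transposition; the transposed complex is the one needed later. *)
Lemma exact_F2_rat m n p (A : 'M[int]_(m, n)) (B : 'M[int]_(n, p)) :
  A *m B = 0 ->
  (kermx (map_mx (fun z : int => z%:~R : 'F_2) B) <=
   map_mx (fun z : int => z%:~R : 'F_2) A)%MS ->
  (kermx (map_mx (fun z : int => z%:~R : rat) A)^T <=
   (map_mx (fun z : int => z%:~R : rat) B)^T)%MS.
Proof.
set A2 := map_mx _ A; set B2 := map_mx _ B; set AQ := map_mx _ A; set BQ := map_mx _ B.
move=> AB0 exact2; have ABQ : AQ *m BQ = 0.
  by rewrite /AQ /BQ -map_mxM AB0 map_mx0.
have le2 := mxrankS exact2; rewrite mxrank_ker in le2.
have rA := leq_rank_F2 A; have rB := leq_rank_F2 B.
have BA : (BQ^T <= kermx AQ^T)%MS by apply/sub_kermxP; rewrite -trmx_mul ABQ trmx0.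
have := mxrank_leqif_sup BA => /leqifP; case: ifP => // _.
rewrite mxrank_ker !mxrank_tr; have := rank_leq_row BQ; have := rank_leq_col AQ.
move: le2 rA rB; rewrite -/A2 -/B2 -/AQ -/BQ; lia.
Qed.

(** The preimage comes from one matrix [h], independent of [w]. Applied to families of forms
    coordinate by coordinate, it therefore takes linear combinations of forms and stays in their
    space. *)
Lemma exact_F2_homotopy (T1 T2 T3 : finType) (A : T1 -> T2 -> int)
    (B : T2 -> T3 -> int) :
  (forall x z, \sum_y A x y * B y z = 0) ->
  (forall z : T2 -> 'F_2, (forall t, \sum_y z y * (B y t)%:~R = 0) ->
     exists y : T1 -> 'F_2, forall u, z u = \sum_x y x * (A x u)%:~R) ->
  exists h : T2 -> T3 -> rat, forall w : T2 -> rat,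
    (forall x, \sum_y (A x y)%:~R * w y = 0) ->
    forall y, w y = \sum_t (B y t)%:~R * \sum_u h u t * w u.
Proof.
move=> AB0 exact2; pose mx (U1 U2 : finType) (f : U1 -> U2 -> int) : 'M_(#|U1|, #|U2|) :=
  \matrix_(i, j) f (enum_val i) (enum_val j).
have sumE (W : nmodType) (U : finType) (F : U -> W) :
    \sum_x F x = \sum_(i < #|U|) F (enum_val i).
  by rewrite (reindex (@enum_val U U)) //=; exact/onW_bij/enum_val_bij.
have le : (kermx (map_mx (fun z : int => z%:~R : 'F_2) (mx _ _ B)) <=
    map_mx (fun z : int => z%:~R : 'F_2) (mx _ _ A))%MS.
  apply/rV_subP => v /sub_kermxP vB.
  have [t|y yP] := exact2 (fun u => v 0 (enum_rank u)).
    move/rowP/(_ (enum_rank t)): vB; rewrite !mxE => vB; apply: etrans vB; rewrite sumE.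
    by apply: eq_bigr => i _; rewrite !mxE enum_valK enum_rankK.
  apply/submxP; exists (\row_i y (enum_val i)); apply/rowP => j.
  have := yP (enum_val j); rewrite enum_valK => ->; rewrite mxE sumE.
  by apply: eq_bigr => i _; rewrite !mxE.
have AB : mx _ _ A *m mx _ _ B = 0.
  apply/matrixP => i j; rewrite !mxE; apply: etrans (AB0 (enum_val i) (enum_val j)); rewrite [RHS]sumE.
  by apply: eq_bigr => k _; rewrite !mxE.
have {le} := exact_F2_rat AB le.
set BT := (map_mx _ (mx _ _ B))^T => le.
exists (fun u t => pinvmx BT (enum_rank u) (enum_rank t)) => w wA y.
pose v : 'rV_#|T2| := \row_i w (enum_val i).
have vB : (v <= BT)%MS.
  apply: submx_trans le; apply/sub_kermxP/rowP => i; rewrite !mxE.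
  apply: etrans (wA (enum_val i)); rewrite [RHS]sumE; apply: eq_bigr => j _.
  by rewrite !mxE mulrC.
have -> : w y = v 0 (enum_rank y) by rewrite mxE enum_rankK.
rewrite -{1}(mulmxKpV vB) mxE [RHS]sumE; apply: eq_bigr => t _.
rewrite !mxE enum_rankK mulrC; congr (_ * _); rewrite [RHS]sumE.
by apply: eq_bigr => u _; rewrite mxE !enum_valK mulrC.
Qed.

(** * Exactness of the complex of interior cones *)

Lemma sum_sig (W : nmodType) (T : finType) (P : pred T) (F : T -> W) :
  \sum_(y : {x | P x}) F (val y) = \sum_(x | P x) F x.
Proof.
rewrite [RHS](reindex_omap (val : {x | P x} -> T) insub) => [|x Px]; last by rewrite insubT.
by apply: eq_bigl => y; rewrite (valP y) valK eqxx.
Qed.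

(** The insertion position is the exponent in [incidence]; this ties that sign to the position of a
    row in a determinant. *)
Lemma enum_setU1 n (A : {set 'I_n}) k : k \notin A ->
  let p := #|[set j in A | (j < k)%N]%SET| in
  enum (k |: A)%SET = take p (enum A) ++ k :: drop p (enum A).
Proof.
move=> kA p; have kn : (k < size (enum 'I_n))%N by rewrite size_enum_ord.
have EE : enum 'I_n = take k (enum 'I_n) ++ k :: drop k.+1 (enum 'I_n).
  by rewrite -{2}(nth_ord_enum k k) -drop_nth // cat_take_drop.
have enumE (B : {set 'I_n}) : enum B = [seq i <- enum 'I_n | i \in B].
  by rewrite !enumT.
set L := take k _ in EE; set M := drop k.+1 _ in EE.
have memL j : (j \in L) = (j < k)%N.
  by rewrite in_take ?mem_enum // index_enum_ord.
have : uniq (enum 'I_n) by apply: enum_uniq.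
rewrite {1}EE cat_uniq /= => /and4P[uL hLM kM uM].
have kL : k \notin L by rewrite memL ltnn.
have EA : enum A = [seq i <- L | i \in A] ++ [seq i <- M | i \in A].
  by rewrite enumE EE filter_cat /= (negbTE kA).
have sL : size [seq i <- L | i \in A] = p.
  rewrite -(card_uniqP (filter_uniq _ uL)); apply: eq_card => j.
  by rewrite !inE mem_filter memL.
rewrite EA -sL take_size_cat // drop_size_cat // enumE EE filter_cat /= !inE eqxx /=.
by congr (_ ++ _ :: _); apply: eq_in_filter => i iX; rewrite !inE;
   case: eqP => // E; move: iX; rewrite E ?(negbTE kL) ?(negbTE kM).
Qed.

Lemma sum_add_remove (W : nmodType) (T : finType) (G : {set T} -> T -> W) :
  \sum_(L : {set T}) \sum_(k | k \notin L) G L k =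
  \sum_(L : {set T}) \sum_(k in L) G (L :\ k)%SET k.
Proof.
rewrite (exchange_big_dep xpredT) //= [RHS](exchange_big_dep xpredT) //=.
apply: eq_bigr => k _.
rewrite [RHS](reindex_onto (fun L => k |: L)%SET (fun L => L :\ k)%SET) /=; last first.
  by move=> L kL; rewrite finset.setD1K.
apply: eq_big => [L|L kL]; last by rewrite finset.setU1K.
rewrite !inE eqxx /=; apply/idP/eqP => [kL|<-]; first by rewrite finset.setU1K.
by rewrite !inE eqxx.
Qed.

Lemma card_ord_recl m (P : nat -> bool) :
  (#|[set j : 'I_m.+1 | P j]%SET| = P 0 + #|[set j : 'I_m | P j.+1]%SET|)%N.
Proof.
rewrite -!sum1dep_card big_mkcond big_ord_recl /= -big_mkcond /=.
by congr (_ + _)%N; case: (P 0%N).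
Qed.

Lemma sum_option (W : zmodType) (T : finType) (F : option T -> W) :
  \sum_x F x = F None + \sum_x F (Some x).
Proof.
rewrite (bigD1 None) //=; congr (_ + _).
rewrite (reindex_omap Some id) => [|[x|]] //=.
by apply: eq_bigl => x; rewrite eqxx.
Qed.

(** * Simplicial fans with convex support, in full dimension *)

Section Fan.
Variables (R : realFieldType) (r n : nat) (a : 'I_n -> 'rV[R]_r).
Variable Delta : {set {set 'I_n}}.
Local Notation V := 'rV[R]_r.
Implicit Types (J : {set 'I_n}) (c : 'I_n -> R) (x v : V) (s : seq V).

Definition comb c : V := \sum_i c i *: a i.

Definition carried J c :=
  (forall i, 0 <= c i) /\ (forall i, i \notin J -> c i = 0).

Definition in_cone J x := exists2 c, carried J c & x = comb c.

Definition in_fan x := exists2 J, J \in Delta & in_cone J x.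

Lemma combD c c' : comb c + comb c' = comb (fun i => c i + c' i).
Proof.
by rewrite /comb -big_split; apply: eq_bigr => i _; rewrite scalerDl.
Qed.

Lemma combZ t c : t *: comb c = comb (fun i => t * c i).
Proof. by rewrite /comb scaler_sumr; apply: eq_bigr => i _; rewrite scalerA. Qed.

Lemma eq_comb c c' : c =1 c' -> comb c = comb c'.
Proof. by move=> E; apply: eq_bigr => i _; rewrite E. Qed.

Lemma comb_on J c : (forall i, i \notin J -> c i = 0) ->
  comb c = \sum_(i in J) c i *: a i.
Proof.
move=> cJ; rewrite /comb (bigID (mem J)) /= [X in _ + X]big1 ?addr0 // => i iJ.
by rewrite cJ // scale0r.
Qed.

Lemma carriedD J c c' : carried J c -> carried J c' ->
  carried J (fun i => c i + c' i).
Proof.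
move=> [c0 cJ] [c'0 c'J]; split=> i; first by rewrite addr_ge0.
by move=> iJ; rewrite cJ // c'J // addr0.
Qed.

Lemma carriedZ J t c : 0 <= t -> carried J c -> carried J (fun i => t * c i).
Proof.
move=> t0 [c0 cJ]; split=> i; first by rewrite mulr_ge0.
by move=> iJ; rewrite cJ // mulr0.
Qed.

Lemma carried0 J : carried J (fun=> 0).
Proof. by []. Qed.

Lemma comb0 : comb (fun=> 0) = 0.
Proof. by rewrite /comb big1 // => i _; rewrite scale0r. Qed.

Lemma carried_sub J J' c : J \subset J' -> carried J c -> carried J' c.
Proof.
by move=> sJ [c0 cJ]; split=> // i iJ'; apply: cJ; apply: contra iJ' => /(fintype.subsetP sJ).
Qed.

Definition ind J (i : 'I_n) : R := (i \in J)%:R.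

Definition center J : V := comb (ind J).

Lemma carried_ind J : carried J (ind J).
Proof. by rewrite /ind; split=> i; [rewrite ler0n | move/negbTE->]. Qed.

Hypothesis DeltaS : forall J J', J \in Delta -> J' \subset J -> J' \in Delta.
(** Uniqueness of coefficients contains both fan properties: the rays of a cone are independent
    ([face_free]), and two cones meet only in the cone on their common rays. *)
Hypothesis carried_inj : forall J J' c c', J \in Delta -> J' \in Delta ->
  carried J c -> carried J' c' -> comb c = comb c' -> c =1 c'.
Hypothesis fanD : forall x y, in_fan x -> in_fan y -> in_fan (x + y).
Hypothesis chamber : exists2 J, J \in Delta & #|J| = r.

Lemma face_free J c : J \in Delta -> (forall i, i \notin J -> c i = 0) ->
  comb c = 0 -> c =1 (fun=> 0).
Proof.
move=> JD cJ c0; pose cp i := Num.max (c i) 0; pose cn i := Num.max (- c i) 0.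
have E i : cp i - cn i = c i.
  by rewrite /cp /cn; have [] := lerP (c i) 0; have [] := lerP (- c i) 0; lra.
have carp : carried J cp.
  by split=> i; [rewrite /cp le_max lexx orbT | rewrite /cp => /cJ ->; rewrite maxxx].
have carn : carried J cn.
  by split=> i; [rewrite /cn le_max lexx orbT | rewrite /cn => /cJ ->; rewrite oppr0 maxxx].
have Ecomb : comb cp = comb cn.
  apply/eqP; rewrite -subr_eq0 -scaleN1r combZ combD -[X in _ == X]c0.
  by apply/eqP/eq_comb => i; rewrite mulN1r E.
by move=> i; rewrite -E (carried_inj JD JD carp carn Ecomb) subrr.
Qed.

Lemma card_face J : J \in Delta -> (#|J| <= r)%N.
Proof.
move=> JD; rewrite leqNgt; apply/negP => rJ.
pose w (x : option 'I_#|J|) := if x is Some j then a (enum_val j) else 0.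
have [|q [Eq q0 [x qx]]] := @nontrivial_relation _ _ _ w None.
  by rewrite card_option card_ord.
move: Eq; rewrite sum_option /= q0 scaler0 add0r => Eq.
case: x qx => [x qx|]; last by rewrite q0 eqxx.
pose c i := \sum_(j | enum_val j == i) q (Some j).
have cJ i : i \notin J -> c i = 0.
  move=> iJ; rewrite /c big1 // => j /eqP ji.
  by rewrite -ji enum_valP in iJ.
have cE j : c (enum_val j) = q (Some j).
  by rewrite /c (big_pred1 j) // => k; rewrite (inj_eq enum_val_inj).
move: qx; rewrite -cE (face_free JD cJ) ?eqxx // (comb_on cJ) big_enum_val -[RHS]Eq.
by apply: eq_bigr => j _; rewrite cE.
Qed.

Lemma chamber_span J v : J \in Delta -> #|J| = r ->
  exists2 c, (forall i, i \notin J -> c i = 0) & v = comb c.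
Proof.
move=> JD Jr.
pose w (x : option (option 'I_#|J|)) :=
  match x with Some (Some j) => a (enum_val j) | Some None => v | None => 0 end.
have [|q [Eq q0 [x qx]]] := @nontrivial_relation _ _ _ w None.
  by rewrite !card_option card_ord Jr.
move: Eq; rewrite !sum_option /= q0 scaler0 add0r => Eq.
pose c i := \sum_(j | enum_val j == i) q (Some (Some j)).
have cJ i : i \notin J -> c i = 0.
  move=> iJ; rewrite /c big1 // => j /eqP ji.
  by rewrite -ji enum_valP in iJ.
have cE j : c (enum_val j) = q (Some (Some j)).
  by rewrite /c (big_pred1 j) // => k; rewrite (inj_eq enum_val_inj).
have Ec : comb c = - (q (Some None) *: v).
  apply/eqP; rewrite -addr_eq0 addrC -[X in _ == X]Eq (comb_on cJ) big_enum_val.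
  by apply/eqP; congr (_ + _); apply: eq_bigr => j _; rewrite cE.
have qv : q (Some None) != 0.
  apply: contraNneq qx => qv; move: Ec; rewrite qv scale0r oppr0 => Ec.
  by case: x => [[j|]|]; rewrite ?qv ?q0 // -cE (face_free JD cJ Ec).
exists (fun i => - (q (Some None))^-1 * c i).
  by move=> i iJ; rewrite cJ // mulr0.
by rewrite -combZ Ec scalerN scaleNr opprK scalerA mulVf // scale1r.
Qed.

Lemma in_fan0 : in_fan 0.
Proof.
have [J JD _] := chamber; exists J => //.
by exists (fun=> 0); [exact: carried0 | rewrite comb0].
Qed.

Lemma in_fanZ t x : 0 <= t -> in_fan x -> in_fan (t *: x).
Proof.
move=> t0 [J JD [c cJ ->]]; exists J => //.
by exists (fun i => t * c i); [exact: carriedZ | rewrite combZ].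
Qed.

Lemma center_in J : J \in Delta -> in_fan (center J).
Proof. by move=> JD; exists J => //; exists (ind J) => //; exact: carried_ind. Qed.

(** The algebraic interior of the support; it is the notion of openness asked for by
    [avoid_hyperplanes]. *)
Definition interior x := forall v, exists2 e, 0 < e & in_fan (x + e *: v).

Lemma interior_in x : interior x -> in_fan x.
Proof. by case/(_ 0) => e _; rewrite scaler0 addr0. Qed.

Lemma interiorD x y : interior x -> in_fan y -> interior (x + y).
Proof.
move=> ix fy v; have [e e0 fe] := ix v; exists e => //.
by rewrite addrAC; apply: fanD.
Qed.

Lemma interiorZ t x : 0 < t -> interior x -> interior (t *: x).
Proof.
move=> t0 ix v; have [e e0 fe] := ix v; exists (t * e); first exact: mulr_gt0.
by rewrite -scalerA -scalerDr; apply: in_fanZ => //; exact: ltW.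
Qed.

Lemma interior_open x v : interior x ->
  exists2 e, 0 < e & forall t, 0 <= t <= e -> interior (x + t *: v).
Proof.
move=> ix; have [e e0 fe] := ix v; exists (e / 2); first by rewrite divr_gt0.
move=> t /andP[t0 te].
have -> : x + t *: v = (1 - t / e) *: x + (t / e) *: (x + e *: v).
  rewrite scalerDr scalerA divfK ?gt_eqF // addrA -scalerDl subrK.
  by rewrite scale1r.
have te' : t / e <= 2^-1 by rewrite ler_pdivrMr // mulrC.
apply: interiorD; last by apply: in_fanZ => //; rewrite divr_ge0 // ltW.
by apply: interiorZ => //; lra.
Qed.

Lemma interior_nonempty : exists x, interior x.
Proof.
have [J JD Jr] := chamber; exists (center J) => v.
have [c cJ ->] := chamber_span v JD Jr.
have pos : {in enum 'I_n, forall i : 'I_n, 0 < (fun=> 1 : R) i} by move=> i _; exact: ltr01.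
have [e e0 eP] := small_perturbation c pos.
exists e => //; exists J => //; exists (fun i => ind J i + e * c i); last first.
  by rewrite combZ combD.
split=> i; last by move=> iJ; rewrite cJ // mulr0 addr0; case: (carried_ind J) => _ ->.
case: (boolP (i \in J)) => iJ; last first.
  by rewrite cJ // mulr0 addr0; case: (carried_ind J).
by rewrite /ind iJ ltW // eP ?mem_enum // lexx ltW.
Qed.

(** A large multiple of the center is [x] plus a point of the cone, and interior points stay
    interior when points of the support are added. *)
Lemma interior_center J x : J \in Delta -> in_cone J x -> interior x ->
  interior (center J).
Proof.
move=> JD [c [c0 cJ] ->] ic; pose t := 1 + \sum_i c i.
have t0 : 0 < t by rewrite ltr_pwDl // sumr_ge0.
have ct i : c i <= t.
  by rewrite /t (bigD1 i) //= addrCA lerDl addr_ge0 // sumr_ge0.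
have -> : center J = t^-1 *: (comb c + comb (fun i => t * ind J i - c i)).
  rewrite combD (@eq_comb _ (fun i => t * ind J i)) => [|i]; last by rewrite addrC subrK.
  by rewrite -combZ scalerA mulVf ?gt_eqF // scale1r.
apply: interiorZ; rewrite ?invr_gt0 //; apply: interiorD => //.
exists J => //; exists (fun i => t * ind J i - c i) => //; rewrite /ind; split=> i.
  by case: (boolP (i \in J)) => [_|/cJ ->]; rewrite ?mulr1 ?mulr0 subr_ge0.
by move=> iJ; rewrite cJ // (negbTE iJ) mulr0 subr0.
Qed.

Lemma interior_centerS J J' : J' \in Delta -> J \subset J' ->
  interior (center J) -> interior (center J').
Proof.
move=> JD sJ iJ; apply: (interior_center JD _ iJ).
by exists (ind J) => //; apply: carried_sub (carried_ind J).
Qed.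

(** * Intersection of simplices and cones modulo 2 *)

Definition pt (t : nat -> R) s : V := \sum_(j < size s) t j *: s`_j.

Lemma pt_cons t v s : pt t (v :: s) = t 0%N *: v + pt (t \o S) s.
Proof. by rewrite /pt big_ord_recl. Qed.

Lemma size_face s j : (j < size s)%N ->
  size (take j s ++ drop j.+1 s) = (size s).-1.
Proof. by move=> js; rewrite size_cat size_drop size_takel ?(ltnW js) //; lia. Qed.

Lemma pt_face t s j : (j < size s)%N ->
  pt t s = t j *: s`_j + pt (t \o bump j) (take j s ++ drop j.+1 s).
Proof.
move=> js; rewrite /pt size_cat size_drop size_takel; last exact: ltnW.
move: js (js); case Es: (size s) => [//|m] js; rewrite subSS => jm.
rewrite subnKC // (bigD1_ord (Ordinal js)) //=; congr (_ + _).
apply: eq_bigr => i _ /=; congr (_ *: _).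
have sz : size (take j s) = j by rewrite size_takel ?Es // ltnW.
rewrite nth_cat sz /bump [(i < j)%N]ltnNge.
have [ij|ij] := leqP j i; last by rewrite /= nth_take.
by rewrite /= nth_drop; congr (_`__); lia.
Qed.

(** The relative interiors of the cone over the simplex [s] and of the cone [J] meet. In general
    position with [size s + #|J| = r + 1] this is their intersection number modulo 2. *)
Definition pos J s : bool := `[< exists t c,
  [/\ forall j, (j < size s)%N -> 0 < t j, forall i, i \in J -> 0 < c i,
      forall i, i \notin J -> c i = 0 & pt t s = comb c] >].

(** General position: at most [r] vectors, taken from the vertices of [s] and the rays of one cone,
    are independent. The bound counts only the vertices with nonzero coefficient. *)
Definition generic s := forall J t c, J \in Delta ->
  (forall i, i \notin J -> c i = 0) -> pt t s = comb c ->
  (#|[set j : 'I_(size s) | t j != 0%R]%SET| + #|J| <= r)%N ->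
  forall j, (j < size s)%N -> t j = 0.

Section Relations.
Variables (J : {set 'I_n}) (s : seq V).

Let U := ('I_(size s) + 'I_#|J|)%type.
Let w (x : U) : V :=
  match x with inl j => s`_j | inr i => - a (enum_val i) end.

Lemma relation_comb (p : U -> R) (t : nat -> R) c : (forall i, i \notin J -> c i = 0) ->
  (forall j, p (inl j) = t j) -> (forall i, p (inr i) = c (enum_val i)) ->
  \sum_x p x *: w x = pt t s - comb c.
Proof.
move=> cJ pt_ pc; rewrite big_sumType /=; congr (_ + _).
  by apply: eq_bigr => j _; rewrite pt_.
rewrite (comb_on cJ) [in RHS]big_enum_val -sumrN; apply: eq_bigr => i _.
by rewrite pc scalerN.
Qed.

Lemma relation_coef (p : U -> R) : exists t c,
  [/\ forall j, p (inl j) = t (nat_of_ord j), forall i, p (inr i) = c (enum_val i)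
    & forall i, i \notin J -> c i = 0].
Proof.
exists (fun j => oapp (p \o inl) 0 (insub j)).
exists (fun i => \sum_(k | enum_val k == i) p (inr k)); split=> [j|i|i iJ].
- by rewrite valK.
- by rewrite (big_pred1 i) // => k; rewrite (inj_eq enum_val_inj).
- by rewrite big1 // => k /eqP ki; rewrite -ki enum_valP in iJ.
Qed.

(** Intersection numbers are compatible with boundaries. The vertices of [s] and the negatives of
    the rays of [J] are [r + 2] vectors; a relation positive except for one zero is an intersection
    with a face of [s] or of [J], according to where the zero is, and [even_positive_relations]
    counts these. *)
Lemma pos_parity : generic s -> J \in Delta -> (#|J| + size s = r.+2)%N ->
  face_sum (fun s' => (pos J s')%:R) s = \sum_(k in J) (pos (J :\ k)%SET s)%:R.
Proof.
move=> gs JD sz; apply/eqP; rewrite -[X in _ == X]F2_oppr -addr_eq0; apply/eqP.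
have cU : #|{: U}| = r.+2 by rewrite card_sum !card_ord addnC.
rewrite -[RHS](even_positive_relations (w := w) cU); last first.
  move=> p; have [t [c [pt_ pc cJ]]] := relation_coef p.
  rewrite (relation_comb cJ pt_ pc) => /eqP; rewrite subr_eq0 => /eqP E x y xy px py.
  (* Passing to the rays with nonzero coefficient makes the bound in [generic] available: two zero
     coefficients leave at most [r] vectors. *)
  pose J' := [set i in J | c i != 0]%SET.
  have J'D : J' \in Delta.
    by apply: DeltaS JD _; apply/fintype.subsetP => i; rewrite inE => /andP[].
  have cJ' i : i \notin J' -> c i = 0.
    by rewrite inE negb_and negbK => /orP[/cJ|/eqP].
  have card_le : (#|[set j : 'I_(size s) | t j != 0%R]%SET| + #|J'| <= r)%N.
    have -> : #|J'| = #|[set i | p (inr i) != 0%R]%SET|.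
      rewrite -(card_imset _ enum_val_inj); apply: eq_card => i.
      apply/idP/imsetP => [|[k]]; last first.
        by rewrite !inE pc => ck ->; rewrite enum_valP.
      rewrite inE => /andP[iJ ci]; exists (enum_rank_in iJ i).
        by rewrite inE pc enum_rankK_in.
      by rewrite enum_rankK_in.
    have -> : (#|[set j : 'I_(size s) | t j != 0%R]%SET| +
        #|[set i | p (inr i) != 0%R]%SET| = #|[set z | p z != 0%R]%SET|)%N.
      rewrite -!sum1dep_card ![in RHS]big_mkcond big_sumType /=.
      by rewrite -!big_mkcond; congr (_ + _)%N; apply: eq_bigl => k; rewrite pt_.
    have /subset_leq_card : [set z | p z != 0%R]%SET \subset ~: [set x; y]%SET.
      apply/fintype.subsetP => z; rewrite !inE negb_or.
      by apply: contraR; rewrite negb_and !negbK => /orP[]/eqP ->; rewrite ?px ?py.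
    move/leq_trans; apply; rewrite -(leq_add2l 2) -{1}[2%N]/(true.+1) -xy.
    by rewrite -cards2 cardsC cU.
  have t0 := gs J' t c J'D cJ' E card_le.
  have c0 : c =1 (fun=> 0).
    apply: (face_free J'D cJ'); rewrite -E /pt big1 // => j _.
    by rewrite t0 // scale0r.
  by case=> [j|i]; [rewrite pt_ t0 | rewrite pc c0].
rewrite big_sumType /=; congr (_ + _).
  apply: eq_bigr => j _; congr (nat_of_bool _)%:R; apply/asbool_equiv_eq.
  split=> [[t [c [t0 c0 cJ E]]]|[p [Ep pj p0]]].
    pose t' m := if m == j :> nat then 0 else t (unbump j m).
    exists (fun x : U => match x with inl m => t' m | inr i => c (enum_val i) end).
    split; first 1 last.
    - by rewrite /t' eqxx.
    - case=> [m|i] xj; last by rewrite c0 ?enum_valP.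
      have mj : m != j by apply: contraNneq xj => ->.
      rewrite /t' val_eqE (negbTE mj) t0 // size_face //.
      have := ltn_ord m; have := ltn_ord j; move: mj; rewrite -val_eqE /= /unbump.
      by case: (ltnP j m); lia.
    rewrite (@relation_comb _ t' c) // (pt_face _ (ltn_ord j)) {1}/t' eqxx scale0r add0r.
    apply/eqP; rewrite subr_eq0 -E; apply/eqP/eq_bigr => m _ /=.
    by rewrite /t' eq_sym (negbTE (neq_bump _ _)) bumpK.
  have [t [c [pt_ pc cJ]]] := relation_coef p.
  exists (t \o bump j), c; split=> //.
  - move=> m; rewrite size_face // => ms.
    have bs : (bump j m < size s)%N by have := ltn_ord j; rewrite /bump; lia.
    rewrite /= -[bump j m]/(nat_of_ord (Ordinal bs)) -pt_ p0 //.
    by rewrite -[_ == _]/(Ordinal bs == j) -val_eqE /= eq_sym neq_bump.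
  - by move=> i iJ; rewrite -(enum_rankK_in iJ iJ) -pc p0.
  move: Ep; rewrite (relation_comb cJ pt_ pc) (pt_face _ (ltn_ord j)) -pt_ pj.
  by rewrite scale0r add0r => /eqP; rewrite subr_eq0 => /eqP.
rewrite big_enum_val; apply: eq_bigr => i _; congr (nat_of_bool _)%:R.
apply/asbool_equiv_eq; split=> [[t [c [t0 c0 cJ E]]]|[p [Ep pj p0]]].
  exists (fun x : U => match x with inl m => t m | inr k => c (enum_val k) end).
  have cJ' k : k \notin J -> c k = 0 by move=> kJ; rewrite cJ // !inE (negbTE kJ) andbF.
  split.
  - by rewrite (@relation_comb _ t c) // E subrr.
  - by rewrite cJ // !inE eqxx.
  case=> [m|k] xj; first by rewrite t0.
  by rewrite c0 // !inE enum_valP andbT (inj_eq enum_val_inj).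
have [t [c [pt_ pc cJ]]] := relation_coef p.
exists t, c; split=> [m ms|k|k|].
- by rewrite -[m]/(nat_of_ord (Ordinal ms)) -pt_ p0.
- rewrite !inE => /andP[ki kJ]; rewrite -(enum_rankK_in kJ kJ) -pc p0 //.
  by apply: contraNneq ki => -[<-]; rewrite enum_rankK_in.
- by rewrite !inE negb_and negbK => /orP[/eqP ->|/cJ //]; rewrite -pc.
by move: Ep; rewrite (relation_comb cJ pt_ pc) => /eqP; rewrite subr_eq0 => /eqP.
Qed.
End Relations.

(** * Open stars and common cone points *)

Definition star J x := forall J', J' \in Delta -> in_cone J' x -> J \subset J'.

Lemma starS J J' x : J \subset J' -> star J' x -> star J x.
Proof. by move=> sJ st J1 J1D /(st _ J1D); apply: fintype.subset_trans. Qed.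

(** The whole cone over [s], except the origin, lies in the interior of the support and in the open
    star of [J]. *)
Definition near J s := generic s /\ forall t,
  (forall j, (j < size s)%N -> 0 <= t j) ->
  (exists2 j, (j < size s)%N & t j != 0) ->
  interior (pt t s) /\ star J (pt t s).

Lemma nearS J J' s : J \subset J' -> near J' s -> near J s.
Proof.
move=> sJ [gs H]; split=> // t t0 tn0; have [it st] := H t t0 tn0.
by split=> //; apply: starS st.
Qed.

Lemma near_nil J : near J [::].
Proof. by split=> [? ? ? _ _ _ _ []|t _ []]. Qed.

Lemma pt_in_fan J s t : near J s -> (forall j, (j < size s)%N -> 0 <= t j) ->
  in_fan (pt t s).
Proof.
move=> [_ H] t0; have [/existsP[j tj]|] := boolP [exists j : 'I_(size s), t j != 0].
  by apply/interior_in; have [] := H t t0; first by exists j.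
rewrite negb_exists => /forallP tz; rewrite /pt big1; first exact: in_fan0.
by move=> j _; have := tz j; rewrite negbK => /eqP ->; rewrite scale0r.
Qed.

(** By Gordan: a nonnegative relation would place a combination of [center J] and a point of the
    cone over [s] in the cone [J'], and uniqueness of coefficients would give [J \subset J']. Such
    functionals turn the star condition on cones over [b :: s] into finitely many open conditions on
    [b], satisfied at [center J]. *)
Lemma star_separation J J' s : J \in Delta -> J' \in Delta ->
  ~~ (J \subset J') -> near J s ->
  exists h, [/\ 0 < pairing h (center J), {in s, forall v, 0 < pairing h v}
              & forall i, i \in J' -> pairing h (a i) < 0].
Proof.
move=> JD J'D nJ nears; pose U := ('I_(size (center J :: s)) + 'I_#|J'|)%type.
pose w (x : U) : V := match x with
  inl j => (center J :: s)`_j | inr i => - a (enum_val i) end.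
have [p p0|h hw] := @gordan_fin _ _ _ w; last first.
  exists h; split.
  - exact: (hw (inl ord0)).
  - move=> v vs; have js : (index v s < size s)%N by rewrite index_mem.
    by have := hw (inl (@Ordinal (size s).+1 (index v s).+1 js)); rewrite /= nth_index.
  - move=> i iJ; have := hw (inr (enum_rank_in iJ i)).
    by rewrite /= enum_rankK_in // linearN oppr_gt0.
have [t [c [pt_ pc cJ]]] := relation_coef p.
rewrite (relation_comb cJ pt_ pc) pt_cons => /eqP; rewrite subr_eq0 => /eqP E.
have t00 : 0 <= t 0%N by have := p0 (inl ord0); rewrite pt_.
have tS0 j : (j < size s)%N -> 0 <= (t \o S) j.
  by move=> js; have := p0 (inl (@Ordinal (size s).+1 j.+1 js)); rewrite pt_.
have cc : carried J' c.
  split=> // i; have [iJ|/cJ ->//] := boolP (i \in J').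
  by rewrite -(enum_rankK_in iJ iJ) -pc p0.
have sub_of c1 : carried J' c1 -> (forall i, i \in J -> 0 < c1 i) -> False.
  move=> [_ c1J] c1p; move/negP: nJ; apply; apply/fintype.subsetP => i iJ.
  by apply/negPn/negP => /c1J c1i; have := c1p i iJ; rewrite c1i ltxx.
have [/existsP[j tj]|] := boolP [exists j : 'I_(size s), (t \o S) j != 0].
  exfalso; have [||ix st] := nears.2 (t \o S) => //; first by exists j.
  have [J1 J1D [c1 c1J x1]] := interior_in ix.
  have JJ1 : J \subset J1 by apply: st => //; exists c1.
  have c2J : carried J1 (fun i => t 0%N * ind J i + c1 i).
    by apply: carriedD => //; apply: carriedZ => //; apply: carried_sub (carried_ind J).
  have cE : c =1 (fun i => t 0%N * ind J i + c1 i).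
    by apply: (carried_inj J'D J1D) => //; rewrite -E x1 -combD -combZ.
  move/negP: nJ; apply; apply: st => //; exists c1 => //; split; first by case: c1J.
  move=> i iJ'; have := cJ i iJ'; rewrite cE => /eqP; case: c1J => c10 _.
  by rewrite paddr_eq0 ?mulr_ge0 // ?ler0n // => /andP[_ /eqP].
rewrite negb_exists => /forallP tz.
have {}tz j : (j < size s)%N -> t j.+1 = 0.
  by move=> js; have := tz (Ordinal js); rewrite negbK => /eqP.
move: E; rewrite /pt big1 ?addr0 => [E|j _]; last by rewrite /= tz ?scale0r.
have cE : c =1 (fun i => t 0%N * ind J i).
  apply: (carried_inj J'D JD) => //; last by rewrite -combZ -E.
  by apply: carriedZ => //; apply: carried_ind.
have tz0 : t 0%N = 0.
  apply/eqP/negPn/negP => tn0; apply: (sub_of c) => // i iJ.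
  by rewrite cE /ind iJ mulr1 lt_def tn0.
case=> [j|i]; last by rewrite pc cE tz0 mul0r.
by rewrite pt_; case: j => -[|j] js /=; rewrite ?tz0 ?tz.
Qed.

Lemma star_open J (C : seq (seq V)) : J \in Delta -> {in C, forall s, near J s} ->
  exists2 hs : seq V, {in hs, forall h, 0 < pairing h (center J)} &
    forall b, {in hs, forall h, 0 < pairing h b} ->
    {in C, forall s t, (forall j, (j < size (b :: s))%N -> 0 <= t j) ->
      (exists2 j, (j < size (b :: s))%N & t j != 0) -> star J (pt t (b :: s))}.
Proof.
move=> JD nearC; pose ok (x : seq V * {set 'I_n}) :=
  [&& x.1 \in C, x.2 \in Delta & ~~ (J \subset x.2)].
have [x|h hP] := @choice _ _ (fun (x : seq V * {set 'I_n}) (h : V) => ok x -> [/\ 0 < pairing h (center J),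
    {in x.1, forall v, 0 < pairing h v}
    & forall i, i \in x.2 -> pairing h (a i) < 0]).
  have [/and3P[sC J'D nJ]|_] := boolP (ok x); last by exists 0.
  by have [h hP] := star_separation JD J'D nJ (nearC _ sC); exists h.
exists [seq h z | z <- [seq z <- [seq (s, J') | s <- C, J' <- enum Delta] | ok z]].
  by move=> _ /mapP[x + ->]; rewrite mem_filter => /andP[/hP[]].
move=> b hb s sC t t0 [j js tj] J' J'D [c [c0 cJ] E].
apply/negPn/negP => nJ; have okx : ok (s, J') by apply/and3P.
have [_ hs ha] := hP _ okx.
have hb' : 0 < pairing (h (s, J')) b.
  apply/hb/map_f; rewrite mem_filter okx /=.
  by apply/allpairsP; exists (s, J'); rewrite mem_enum.
have hbs k : (k < size (b :: s))%N -> 0 < pairing (h (s, J')) (b :: s)`_k.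
  by case: k => [//|k] ks /=; apply/hs/mem_nth.
have : 0 < pairing (h (s, J')) (pt t (b :: s)).
  rewrite /pt linear_sum (bigD1 (Ordinal js)) //= linearZ /= ltr_pwDl //.
    by rewrite mulr_gt0 ?hbs // lt_def tj t0.
  by apply: sumr_ge0 => i _; rewrite linearZ mulr_ge0 ?t0 // ltW // hbs.
rewrite E ltNge => /negP; apply; rewrite linear_sum sumr_le0 // => i _.
rewrite linearZ /=; have [/ha hi|/cJ ->] := boolP (i \in J'); last by rewrite mul0r.
by rewrite mulr_ge0_le0 // ltW.
Qed.

(** The point [b] starts at [center J], is pushed into the interior by a small multiple of an
    interior point, and is then moved off finitely many hyperplanes. Adding a point of the support
    keeps it interior, which is where convexity enters. *)
Lemma near_cone J (C : seq (seq V)) : J \in Delta -> {in C, forall s, near J s} ->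
  exists b, {in C, forall s, near J (b :: s)}.
Proof.
move=> JD nearC; have [hs hsJ hsP] := star_open JD nearC.
pose O b := interior b /\ {in hs, forall h, 0 < pairing h b}.
have openO b v : O b -> exists2 e, 0 < e & forall t, 0 <= t <= e -> O (b + t *: v).
  move=> [ib hb]; have [e e0 eP] := interior_open v ib.
  have [e' e'0 e'P] := small_perturbation (fun h => pairing h v) hb.
  exists (Num.min e e'); first by rewrite lt_min e0.
  move=> t /andP[t0]; rewrite le_min => /andP[te te'].
  split=> [|h hhs]; first by apply: eP; rewrite t0.
  by rewrite linearD linearZ; apply: e'P => //; rewrite t0.
have exO : exists b, O b.
  have [u iu] := interior_nonempty.
  have [e e0 eP] := small_perturbation (fun h => pairing h u) hsJ.
  exists (center J + e *: u); split=> [|h hhs].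
    by rewrite addrC; apply: interiorD (center_in JD); apply: interiorZ.
  by rewrite linearD linearZ; apply: eP; rewrite // lexx ltW.
(* Each set of fewer than [r] vectors, rays of one cone and vertices of one simplex, is put in a
   hyperplane; [generic] for [b :: s] fails at [b] only on these hyperplanes. *)
pose bad (x : {set 'I_n} * seq V) := [seq a i | i <- enum x.1] ++ x.2.
have [x|g gP] := @choice _ _ (fun (x : {set 'I_n} * seq V) (g : V) => (size (bad x) < r)%N ->
    g != 0 /\ {in bad x, forall v, pairing g v = 0}).
  case: (ltnP (size (bad x)) r) => [/exists_normal[g g0 gx]|_]; last by exists 0.
  by exists g.
pose subs (s : seq V) := [seq [seq s`_j | j : 'I_(size s) in T] | T : {set 'I_(size s)}].
pose gs := [seq g z | z <- [seq z <- [seq (J', t) | J' <- enum Delta,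
  t <- flatten [seq subs s | s <- C]] | (size (bad z) < r)%N]].
have [|b [ib hb] gb] := avoid_hyperplanes openO exO (gs := gs).
  by apply/allP => _ /mapP[x + ->]; rewrite mem_filter => /andP[/gP[]].
exists b => s sC; split.
  move=> J' t c J'D cJ' E card_le.
  have t0 : t 0%N = 0.
    pose T := [set j : 'I_(size s) | t j.+1 != 0]%SET.
    pose x := (J', [seq s`_j | j : 'I_(size s) in T] : seq V).
    apply/eqP/negPn/negP => tn0.
    have sx : (size (bad x) < r)%N.
      apply: leq_trans card_le; rewrite /bad size_cat size_map -cardE size_image.
      by rewrite addnC -addSn leq_add2r (@card_ord_recl _ (fun j => t j != 0)) tn0.
    have [_ gx] := gP x sx.
    have : pairing (g x) b != 0.
      apply/gb/map_f; rewrite mem_filter sx /=.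
      apply/allpairsP; exists x; rewrite mem_enum; split=> //.
      apply/flattenP; exists (subs s); first exact: map_f.
      by apply/mapP; exists T; rewrite ?mem_enum.
    have := congr1 (pairing (g x)) E; rewrite pt_cons linearD linearZ /=.
    rewrite /pt /comb !linear_sum /= big1 => [|j _]; last first.
      rewrite linearZ /=; have [->|tj] := eqVneq (t j.+1) 0; first by rewrite mul0r.
      rewrite gx ?mulr0 // mem_cat; apply/orP; right.
      by apply/mapP; exists j; rewrite // mem_enum inE.
    rewrite addr0 big1 => [/eqP|i _]; first by rewrite mulf_eq0 (negbTE tn0) => /= /eqP ->; rewrite eqxx.
    rewrite linearZ /=; have [iJ|/cJ' ->] := boolP (i \in J'); last by rewrite mul0r.
    by rewrite gx ?mulr0 // mem_cat map_f // mem_enum.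
  have [gens _] := nearC s sC.
  case=> [//|j] js; apply: (gens J' (t \o S) c J'D cJ') => //.
    by rewrite -E pt_cons t0 scale0r add0r.
  by apply: leq_trans card_le; rewrite (@card_ord_recl _ (fun j => t j != 0)) t0 eqxx.
move=> t t0 tn0; split; last exact: hsP.
rewrite pt_cons; have tS j : (j < size s)%N -> 0 <= (t \o S) j by move=> js; apply: t0.
have [tz|tz] := eqVneq (t 0%N) 0.
  rewrite tz scale0r add0r; case: (nearC s sC) => _ /(_ _ tS)[] //.
  by case: tn0 => -[|j] js tj; [rewrite tz eqxx in tj | exists j].
apply: interiorD; last exact: (pt_in_fan (nearC s sC)).
by apply: interiorZ => //; rewrite lt_def tz t0.
Qed.

Lemma pt1 t v : pt t [:: v] = t 0%N *: v.
Proof. by rewrite pt_cons /pt big_ord0 addr0. Qed.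

Lemma near1 J b : near J [:: b] -> interior b /\ star J b.
Proof.
case=> _ /(_ (fun=> 1)); rewrite pt1 scale1r; apply; first by rewrite ler01.
by exists 0%N; rewrite ?oner_eq0.
Qed.

Lemma near1_cone J J' b : near J [:: b] -> J' \in Delta -> in_cone J' b ->
  #|J'| = r.
Proof.
move=> [gb _] J'D [c [_ cJ] E]; apply/eqP; rewrite eqn_leq card_face //=.
rewrite leqNgt; apply/negP => lt; move/eqP: (oner_neq0 R); apply.
apply: (gb J' (fun=> 1) c J'D cJ _ _ 0%N) => //; first by rewrite pt1 scale1r.
by apply: leq_trans lt; rewrite -[in leqRHS]add1n leq_add2r;
  apply: leq_trans (max_card _) _; rewrite card_ord.
Qed.

Lemma exists_near1 J : J \in Delta -> exists b, near J [:: b].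
Proof.
move=> JD; have [|b bP] := @near_cone J [:: [::]] JD.
  by move=> s; rewrite inE => /eqP ->; apply: near_nil.
by exists b; apply: bP; rewrite inE.
Qed.

(** The fan is pure: a generic point in the open star of [J] lies only in cones with [r] rays, and
    these contain [J]. *)
Lemma chamber_above J : J \in Delta ->
  exists J', [/\ J' \in Delta, J \subset J' & #|J'| = r].
Proof.
move=> JD; have [b nb] := exists_near1 JD; have [ib sb] := near1 nb.
have [J' J'D bJ'] := interior_in ib; exists J'.
by split=> //; [apply: sb | apply: (near1_cone nb)].
Qed.

(** * Walls and chambers *)

Definition addable J k := (k \notin J) && ((k |: J)%SET \in Delta).

Lemma exists_addable J : J \in Delta -> (#|J| < r)%N -> exists k, addable J k.
Proof.
move=> JD lt; have [J' [J'D sJ rJ']] := chamber_above JD.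
have /properP[_ [k kJ' kJ]] : J \proper J' by rewrite properEcard sJ rJ'.
exists k; rewrite /addable kJ /=; apply: DeltaS J'D _.
by rewrite finset.subUset finset.sub1set kJ'.
Qed.

Lemma near1_pos J b : J \in Delta -> #|J| = r -> near J [:: b] -> pos J [:: b].
Proof.
move=> JD rJ nb; have [ib sb] := near1 nb; have [J' J'D bJ'] := interior_in ib.
have JJ' : J = J'.
  by apply/eqP; rewrite eqEcard sb //= rJ (near1_cone nb J'D bJ').
rewrite -{}JJ' in bJ' *; case: bJ' => c [c0 cJ] bE.
apply/asboolP; exists (fun=> 1), c; split=> // [i iJ|]; last by rewrite pt1 scale1r.
rewrite lt_def c0 andbT; apply/negP => /eqP ci.
have JiD : (J :\ i)%SET \in Delta by apply: DeltaS JD _; rewrite finset.subD1set.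
have : #|(J :\ i)%SET| = r.
  apply: (near1_cone nb JiD); exists c => //; split=> // j.
  by rewrite !inE negb_and negbK => /orP[/eqP ->|/cJ].
by have := cardsD1 i J; rewrite iJ rJ; lia.
Qed.

(** A short step from [center J] in the direction [g] stays in the support and in the open star of
    [J]. The cone reached contains [J], and one of its rays must pair positively with [g]. *)
Lemma wall_side J g : J \in Delta -> interior (center J) -> g != 0 ->
  (forall i, i \in J -> pairing g (a i) = 0) ->
  exists2 k, addable J k & 0 < pairing g (a k).
Proof.
move=> JD iJ g0 gJ; have [|hs hsJ hsP] := @star_open J [:: [::]] JD.
  by move=> s; rewrite inE => /eqP ->; apply: near_nil.
have [e e0 eP] := small_perturbation (fun h => pairing h g) hsJ.
have [e' e'0 e'P] := interior_open g iJ.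
pose t := Num.min e e'.
have t0 : 0 < t by rewrite lt_min e0.
have te : t <= e by rewrite /t ge_min lexx.
have te' : t <= e' by rewrite /t ge_min lexx orbT.
pose b := center J + t *: g.
have sb : star J b.
  have -> : b = pt (fun=> 1) [:: b] by rewrite pt1 scale1r.
  apply: hsP; rewrite ?inE //; last by exists 0%N; rewrite ?oner_eq0.
  by move=> h hhs; rewrite linearD linearZ; apply: eP; rewrite // te ltW.
have [J' J'D [c [c0 cJ] bE]] : in_fan b.
  by apply/interior_in/e'P; rewrite te' ltW.
have sJ : J \subset J' by apply: sb => //; exists c.
have gb : 0 < pairing g b.
  rewrite linearD linearZ /= /center /comb linear_sum big1 => [|i _].
    by rewrite add0r mulr_gt0 // pairing_self_gt0.
  by rewrite linearZ /ind /=; case: (boolP (i \in J)) => [/gJ ->|_]; rewrite ?mulr0 ?mul0r.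
have [k kJ' gk] : exists2 k, k \in J' & 0 < pairing g (a k).
  have [/existsP[k /andP[? ?]]|] := boolP [exists k, (k \in J') && (0 < pairing g (a k))].
    by exists k.
  rewrite negb_exists => /forallP H; move: gb; rewrite bE (comb_on cJ) linear_sum.
  rewrite ltNge => /negP[]; apply: sumr_le0 => i iJ'; rewrite linearZ /=.
  by have := H i; rewrite iJ' -leNgt => ?; rewrite mulr_ge0_le0.
exists k => //; have kJ : k \notin J by apply/negP => /gJ E; rewrite E ltxx in gk.
rewrite /addable kJ; apply: DeltaS J'D _; by rewrite finset.subUset finset.sub1set kJ'.
Qed.

(** In the basis of the chamber [k |: J], the ray [a k'] has a positive coefficient at [k]. Adding a
    large multiple of [center J] gives a point of both chambers, against uniqueness of
    coefficients. *)
Lemma wall_side_inj J g k k' : J \in Delta -> #|J|.+1 = r ->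
  (forall i, i \in J -> pairing g (a i) = 0) -> addable J k -> addable J k' ->
  0 < pairing g (a k) -> 0 < pairing g (a k') -> k = k'.
Proof.
move=> JD rJ gJ /andP[kJ kD] /andP[k'J k'D] gk gk'; apply/eqP/negPn/negP => kk'.
have [|c cJ E] := chamber_span (a k') kD; first by rewrite cardsU1 kJ add1n.
have ck : 0 < c k.
  have : pairing g (a k') = c k * pairing g (a k).
    rewrite E linear_sum (bigD1 k) //= linearZ big1 ?addr0 // => i ik.
    rewrite linearZ /=; have [iJ|iJ] := boolP (i \in J); first by rewrite gJ ?mulr0.
    by rewrite cJ ?mul0r // !inE negb_or ik.
  by move=> E'; move: gk'; rewrite E' pmulr_lgt0.
pose t := \sum_i `|c i|.
have ct i : - c i <= t.
  rewrite /t (bigD1 i) //= -normrN; apply: le_trans (ler_norm _) _.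
  by rewrite lerDl sumr_ge0.
have t0 : 0 <= t by rewrite sumr_ge0.
have := @carried_inj _ _ (fun i => c i + t * ind J i) (fun i => (i == k')%:R + t * ind J i)
  kD k'D.
move=> inj; have {inj} : (fun i => c i + t * ind J i) =1 (fun i => (i == k')%:R + t * ind J i).
apply: inj.
- split=> i; rewrite /ind.
    have [iJ|iJ] := boolP (i \in J); first by rewrite mulr1 addrC -[c i]opprK subr_ge0.
    rewrite mulr0 addr0; have [->|ik] := eqVneq i k; first exact: ltW.
    by rewrite cJ // !inE negb_or ik.
  by move=> iJ; rewrite cJ //; move: iJ; rewrite !inE negb_or => /andP[_ /negbTE ->];
     rewrite mulr0 addr0.
- split=> i; rewrite /ind; first by rewrite addr_ge0 ?mulr_ge0 ?ler0n.
  by rewrite !inE negb_or => /andP[/negbTE -> /negbTE ->]; rewrite mulr0 addr0.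
- rewrite -!combD -E; congr (_ + _); rewrite /comb (bigD1 k') //= eqxx scale1r.
  by rewrite big1 ?addr0 // => i /negbTE ->; rewrite scale0r.
by move/(_ k); rewrite /ind (negbTE kJ) mulr0 !addr0 (negbTE kk') => E'; rewrite E' ltxx in ck.
Qed.

Lemma wall_sides J g : J \in Delta -> interior (center J) -> #|J|.+1 = r ->
  g != 0 -> (forall i, i \in J -> pairing g (a i) = 0) ->
  exists k1 k2, [/\ addable J k1, addable J k2,
    0 < pairing g (a k1), pairing g (a k2) < 0
    & forall k, addable J k -> k = k1 \/ k = k2].
Proof.
move=> JD iJ rJ g0 gJ.
have ng (v : V) : pairing (- g) v = - pairing g v.
  by rewrite pairingC linearN pairingC.
have ngJ i : i \in J -> pairing (- g) (a i) = 0 by move/gJ; rewrite ng => ->; rewrite oppr0.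
have gK k : addable J k -> pairing g (a k) != 0.
  move=> /andP[kJ kD]; apply: contraTneq (pairing_self_gt0 g0) => gk.
  have [|c cJ E] := chamber_span g kD; first by rewrite cardsU1 kJ.
  rewrite {2}E (comb_on cJ) linear_sum big1 ?ltxx // => i.
  by rewrite !inE linearZ /= => /orP[/eqP ->|/gJ ->]; rewrite ?gk mulr0.
have [k1 K1 gk1] := wall_side JD iJ g0 gJ.
have [|k2 K2 gk2] := wall_side JD iJ _ ngJ; first by rewrite oppr_eq0.
exists k1, k2; split=> //; first by rewrite -oppr_gt0 -ng.
move=> k Kk; have := gK k Kk; case: ltrgt0P => // gk _.
  by left; apply: (wall_side_inj JD rJ gJ).
by right; apply: (wall_side_inj JD rJ ngJ) => //; rewrite ng oppr_gt0.
Qed.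

Lemma wall_sum (W : zmodType) J g (F : 'I_n -> W) :
  J \in Delta -> interior (center J) -> #|J|.+1 = r ->
  g != 0 -> (forall i, i \in J -> pairing g (a i) = 0) ->
  (forall k k', 0 < pairing g (a k) -> pairing g (a k') < 0 -> F k + F k' = 0) ->
  \sum_(k | addable J k) F k = 0.
Proof.
move=> JD iJ rJ g0 gJ Fg.
have [k1 [k2 [K1 K2 g1 g2 K12]]] := wall_sides JD iJ rJ g0 gJ.
have k21 : k2 != k1 by apply: contraTneq g1 => <-; rewrite -leNgt ltW.
rewrite (bigD1 k1) // (bigD1 k2) /= ?K2 // big1 ?addr0 => [|k /andP[/andP[Kk n1 n2]]].
  exact: Fg.
by have [E|E] := K12 k Kk; [rewrite E eqxx in n1 | rewrite E eqxx in n2].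
Qed.

Lemma wall_parity J : J \in Delta -> interior (center J) -> #|J|.+1 = r ->
  \sum_(k | addable J k) 1 = 0 :> 'F_2.
Proof.
move=> JD iJ rJ.
have [|g g0 gJ] := @exists_normal R r [seq a i | i <- enum J].
  by rewrite size_map -cardE rJ.
apply: (wall_sum JD iJ rJ g0) => [i iJ'|*]; last exact: F2_addrr.
by apply/gJ/map_f; rewrite mem_enum.
Qed.

Lemma card_addable J k : addable J k -> #|(k |: J)%SET| = #|J|.+1.
Proof. by case/andP=> kJ _; rewrite cardsU1 kJ. Qed.

(** * Incidence numbers and dual cells *)

Definition incidence (K : {set 'I_n}) k : int :=
  (-1) ^+ #|[set j in K | (j < k)%N]%SET|.

Lemma incidence_anticomm (L : {set 'I_n}) k k' : k != k' -> k \notin L -> k' \notin L ->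
  incidence L k * incidence (k |: L)%SET k' =
  - (incidence L k' * incidence (k' |: L)%SET k).
Proof.
have cardU (i j : 'I_n) : i != j -> i \notin L ->
    incidence (i |: L)%SET j = incidence L j * (-1) ^+ (i < j)%N.
  move=> ij iL; rewrite /incidence -exprD; congr (_ ^+ _).
  rewrite addnC (cardsD1 i) !inE eqxx; congr (_ + _)%N; apply: eq_card => x.
  rewrite !inE; case: (eqVneq x i) => [->|xi] //=.
  by rewrite (negbTE iL).
move=> kk' kL k'L; rewrite !cardU //; last by rewrite eq_sym.
case: (ltngtP k k') => [lt|lt|/val_inj E]; last by rewrite E eqxx in kk'.
  by rewrite expr1 expr0 mulr1 mulrN1 mulrN mulrC.
by rewrite expr1 expr0 mulr1 mulrN1 mulrN opprK mulrC.
Qed.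

Lemma F2_incidence L k (x : 'F_2) : x *~ incidence L k = x.
Proof.
by rewrite /incidence -signr_odd; case: (odd _); rewrite ?expr1 ?expr0 ?mulrNz ?F2_oppr.
Qed.

Lemma sum_addable2 (W : zmodType) J (F : {set 'I_n} -> W) :
  \sum_(k | addable J k) \sum_(k' | addable (k |: J) k')
    F (k' |: (k |: J))%SET *~ (incidence J k * incidence (k |: J)%SET k') = 0.
Proof.
pose G k k' := if addable J k && addable (k |: J) k'
  then F (k' |: (k |: J))%SET *~ (incidence J k * incidence (k |: J)%SET k') else 0.
apply: etrans (@sum_antisym _ _ G _ _); last 2 first.
- move=> k k'; rewrite /G [(k |: (k' |: J))%SET]finset.setUCA.
  have -> : addable J k && addable (k |: J) k' = addable J k' && addable (k' |: J) k.
    rewrite /addable !inE finset.setUCA !negb_or [k' == k]eq_sym.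
    case: (eqVneq k k') => [->//|_] /=; case D: ((k |: (k' |: J))%SET \in Delta);
      rewrite ?andbF //=.
    have kD : (k |: J)%SET \in Delta by apply: DeltaS D _; rewrite finset.setUCA finset.subsetUr.
    have k'D : (k' |: J)%SET \in Delta by apply: DeltaS D _; rewrite finset.subsetUr.
    by rewrite kD k'D !andbT andbC.
  case: ifP => [/andP[/andP[k'J _] /andP[kk' _]]|_]; last by rewrite oppr0.
  move: kk'; rewrite !inE negb_or => /andP[kk' kJ].
  by rewrite incidence_anticomm // mulrNz.
- by move=> k; rewrite /G /addable !inE eqxx /= andbF.
rewrite big_mkcond; apply: eq_bigr => k _; rewrite /G.
case: (addable J k) => /=; last by rewrite big1.
by rewrite -big_mkcond.
Qed.

(* dual J is a triangulation of the cell dual to the cone J, moved into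
   general position. *)
Definition dual_spec (dual : {set 'I_n} -> seq (seq V)) J :=
  [/\ {in dual J, forall s, (size s + #|J| = r.+1)%N /\ near J s},
      #|J| = r -> exists b, dual J = [:: [:: b]]
    & (#|J| < r)%N -> forall f, chain_sum (face_sum f) (dual J) =
        \sum_(k | addable J k) chain_sum f (dual (k |: J)%SET)].

(** Descending induction on [#|J|]. A chamber gets one generic point; otherwise the dual cells of
    the cones [k |: J] form a cycle [C0 J] near [J], and the dual cell of [J] is the cone over it
    with vertex [b J]. *)
Lemma dual_exists : exists dual, forall J, J \in Delta -> interior (center J) ->
  dual_spec dual J.
Proof.
suff H m : exists dual, forall J, J \in Delta -> interior (center J) ->
    (r <= #|J| + m)%N -> dual_spec dual J.
  by have [dual dualP] := H r; exists dual => J JD iJ; apply: dualP; rewrite ?leq_addl.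
elim: m => [|m [D DP]].
  have [J|b bP] := @choice _ _ (fun (J : {set 'I_n}) (b : V) => J \in Delta -> near J [:: b]).
    by case: (boolP (J \in Delta)) => [/exists_near1[b nb]|_]; [exists b | exists 0].
  exists (fun J => [:: [:: b J]]) => J JD iJ; rewrite addn0 => rJ.
  have cJ : #|J| = r by apply/eqP; rewrite eqn_leq rJ card_face.
  split; last by rewrite cJ ltnn.
    by move=> s; rewrite inE => /eqP ->; rewrite cJ; split=> //; apply: bP.
  by exists (b J).
pose C0 J := flatten [seq D (k |: J)%SET | k <- enum (addable J)].
have step J : J \in Delta -> interior (center J) -> (#|J| + m.+1 = r)%N ->
    forall k, addable J k -> dual_spec D (k |: J)%SET.
  move=> JD iJ rJ k kJ; have [kJ' kD] := andP kJ; apply: DP => //.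
    by apply: interior_centerS iJ; rewrite ?finset.subsetUr.
  by rewrite card_addable // addSnnS rJ.
have C0P J : J \in Delta -> interior (center J) -> (#|J| + m.+1 = r)%N ->
    {in C0 J, forall s, (size s + #|J| = r)%N /\ near J s}.
  move=> JD iJ rJ s /flattenP[_ /mapP[k + ->] sD].
  rewrite mem_enum => kJ; have [/(_ s sD)[sz ns] _ _] := step J JD iJ rJ k kJ.
  split; last by apply: nearS ns; rewrite finset.subsetUr.
  by move: sz; rewrite card_addable // addnS => -[].
have [J|b bP] := @choice _ _ (fun (J : {set 'I_n}) (b : V) => J \in Delta ->
    interior (center J) -> (#|J| + m.+1 = r)%N -> {in C0 J, forall s, near J (b :: s)}).
  have [JD|] := boolP (J \in Delta); last by exists 0.
  case: (pselect (interior (center J))) => iJ; last by exists 0.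
  have [rJ|] := eqVneq (#|J| + m.+1)%N r; last by move=> /eqP ne; exists 0 => _ _ /ne.
  have [|b bP] := @near_cone J (C0 J) JD; last by exists b.
  by move=> s /(C0P J JD iJ rJ)[].
exists (fun J => if (#|J| + m.+1 == r)%N then map (cons (b J)) (C0 J) else D J).
move=> J JD iJ rJ; have [cJ|cJ] := eqVneq (#|J| + m.+1)%N r; last first.
  have rJ' : (r <= #|J| + m)%N.
    by rewrite -ltnS -addnS ltn_neqAle eq_sym cJ.
  have [P1 P2 P3] := DP J JD iJ rJ'; rewrite /dual_spec (negbTE cJ); split=> // lt f.
  rewrite P3 //; apply: eq_bigr => k kJ; rewrite card_addable //.
  by case: eqP => // E; exfalso; lia.
rewrite /dual_spec cJ eqxx; split.
- move=> _ /mapP[s sC ->]; have [sz _] := C0P J JD iJ cJ s sC.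
  by split; [rewrite /= addSn sz | apply: bP].
- by move=> E; exfalso; lia.
move=> lt f; rewrite chain_sum_cone.
have -> : chain_sum f (C0 J) = \sum_(k | addable J k) chain_sum f
    (if (#|(k |: J)%SET| + m.+1 == r)%N
     then [seq b (k |: J)%SET :: i | i <- C0 (k |: J)%SET] else D (k |: J)%SET).
  rewrite chain_sum_flatten; apply: eq_bigr => k kJ; rewrite card_addable //.
  by case: eqP => // E; exfalso; lia.
rewrite [X in _ + X](_ : _ = 0) ?addr0 // chain_sum_flatten.
(* For a wall, [C0 J] consists of points. Their boundary is the empty simplex, so being a cycle
   means that their number is even. *)
have [rJ1|rJ1] := eqVneq #|J|.+1 r.
  transitivity (\sum_(k | addable J k) f [:: b J] * 1); last first.
    by rewrite -mulr_sumr wall_parity // mulr0.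
  apply: eq_bigr => k kJ; have [_ P2 _] := step J JD iJ cJ k kJ.
  have [|b' ->] := P2; first by rewrite card_addable.
  by rewrite /chain_sum big_seq1 face_sum_cons /face_sum big_ord0 addr0 mulr1.
apply: etrans (@sum_addable2 _ J (fun J' => chain_sum (f \o cons (b J)) (D J'))).
apply: eq_bigr => k kJ; have [_ _ P3] := step J JD iJ cJ k kJ.
rewrite P3; last by rewrite card_addable // ltn_neqAle rJ1.
by apply: eq_bigr => k' _; rewrite /incidence -exprD -signr_odd; case: (odd _);
   rewrite ?expr1 ?expr0 ?mulrNz ?F2_oppr.
Qed.

Section Duality.
Variable dual : {set 'I_n} -> seq (seq V).
Hypothesis dualP : forall J, J \in Delta -> interior (center J) ->
  dual_spec dual J.

Definition pos_ind J s : 'F_2 := (pos J s)%:R.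

(** The dual cell lies in the open star of [J], so a cone that meets it contains [J], and with as
    many rays equals [J]. *)
Lemma chain_sum_pos_neq J J' : J \in Delta -> interior (center J) ->
  J' \in Delta -> #|J'| = #|J| -> J' != J ->
  chain_sum (pos_ind J') (dual J) = 0.
Proof.
move=> JD iJ J'D cJ' nE; rewrite /chain_sum big_seq big1 // => s sD.
rewrite /pos_ind; suff /negbTE -> : ~~ pos J' s by [].
have [/(_ s sD)[sz [_ nP]] _ _] := dualP JD iJ.
have [s0|s0] := eqVneq (size s) 0%N.
  by have := card_face JD; move: sz; rewrite s0 add0n => ->; rewrite ltnn.
apply: contra nE => /asboolP[t [c [t0 c0 cJ'0 E]]].
have [|| _ st] := nP t; first by move=> j /t0 /ltW.
  by exists 0%N; rewrite ?gt_eqF ?t0 ?lt0n.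
rewrite eq_sym eqEcard cJ' leqnn andbT; apply: st => //; exists c => //.
by split=> // i; have [/c0/ltW|/cJ'0 ->] := boolP (i \in J').
Qed.

(** Descending induction: [pos_parity] is applied to the dual cell of [J] and a larger cone
    [k |: J]. On one side only the dual cell of [k |: J] in the boundary counts, on the other only
    the face [J]. *)
Lemma chain_sum_pos J : J \in Delta -> interior (center J) ->
  chain_sum (pos_ind J) (dual J) = 1.
Proof.
have [m] := ubnP (r - #|J|); elim: m J => // m IHm J leJ JD iJ.
have [P1 P2 P3] := dualP JD iJ.
have [rJ|rJ] := eqVneq #|J| r.
  have [b Db] := P2 rJ; rewrite Db /chain_sum big_seq1 /pos_ind near1_pos //.
  by have [] := P1 [:: b]; rewrite // Db inE.
have {}rJ : (#|J| < r)%N by rewrite ltn_neqAle rJ card_face.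
have [k kJ] := exists_addable JD rJ; have [kJ' kD] := andP kJ.
have kJD : interior (center (k |: J)%SET).
  by apply: interior_centerS iJ; rewrite ?finset.subsetUr.
have : chain_sum (face_sum (pos_ind (k |: J)%SET)) (dual J) =
    \sum_(i in (k |: J)%SET) chain_sum (pos_ind ((k |: J) :\ i)%SET) (dual J).
  rewrite /chain_sum exchange_big big_seq [RHS]big_seq; apply: eq_bigr => s sD.
  have [sz [gs _]] := P1 s sD; apply: pos_parity => //.
  by rewrite card_addable // addSn addnC sz.
rewrite P3 // (bigD1 k) //= IHm ?card_addable //; last by lia.
rewrite big1 ?addr0 => [|k' /andP[k'J k'k]]; last first.
  have [k'J' k'D] := andP k'J.
  apply: chain_sum_pos_neq => //; rewrite ?card_addable //.
    by apply: interior_centerS iJ; rewrite ?finset.subsetUr.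
  apply/eqP => /setP/(_ k'); rewrite !inE eqxx (negbTE k'k) /= => E.
  by rewrite E in k'J'.
rewrite (bigD1 k) ?inE ?eqxx //= finset.setU1K // big1 ?addr0 => [//|i].
rewrite !inE => /andP[/orP[/eqP ->|iJ' ik]]; first by rewrite eqxx.
apply: chain_sum_pos_neq => //.
- by apply: DeltaS kD _; rewrite finset.subD1set.
- by have := cardsD1 i (k |: J)%SET; rewrite !inE iJ' orbT card_addable // add1n => -[].
by apply/eqP => /setP/(_ i); rewrite !inE eqxx iJ'.
Qed.

End Duality.

(* Over the field with two elements, the complex of the interior cones that
   contain J is exact: a cycle z gives the cycle of the dual cells, which
   bounds its cone over a vertex b; the cones met by the latter form a chain
   with boundary z. *)
Lemma interior_exact_F2 J m (z : {set 'I_n} -> 'F_2) : J \in Delta -> (m <= r)%N ->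
  (forall K, z K != 0 ->
     [/\ K \in Delta, interior (center K), J \subset K & #|K| = m]) ->
  (if m == r then \sum_K z K = 0 else
     forall K, K \in Delta -> #|K| = m.+1 -> \sum_(k in K) z (K :\ k)%SET = 0) ->
  exists2 y : {set 'I_n} -> 'F_2,
    forall K, y K != 0 ->
      [/\ K \in Delta, interior (center K), J \subset K & #|K|.+1 = m] &
    forall K, K \in Delta -> #|K| = m -> \sum_(k in K) y (K :\ k)%SET = z K.
Proof.
move=> JD mr zP cyc; have [dual dualP] := dual_exists.
have zdual K : z K != 0 -> dual_spec dual K by case/zP=> KD iK _ _; apply: dualP.
have [|b bP] := @near_cone J (flatten [seq dual K | K <- enum [pred K | z K != 0]]) JD.
  move=> s /flattenP[_ /mapP[K + ->] sK]; rewrite mem_enum => zK.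
  have [/(_ s sK)[_ ns] _ _] := zdual K zK; have [_ _ sJ _] := zP K zK.
  exact: nearS ns.
have {}bP K s : z K != 0 -> s \in dual K -> near J (b :: s) /\ (size s + m = r.+1)%N.
  move=> zK sK; have [/(_ s sK)[sz _] _ _] := zdual K zK.
  have [_ _ _ cK] := zP K zK; rewrite -cK; split=> //.
  by apply: bP; apply/flattenP; exists (dual K) => //; apply: map_f; rewrite mem_enum.
(* The cone [K] is counted as often, modulo 2, as it meets the cone over [b] of the chain of dual
   cells given by [z]. *)
pose y K : 'F_2 := if (K \in Delta) && (#|K|.+1 == m)
  then \sum_L z L * chain_sum (pos_ind K) (map (cons b) (dual L)) else 0.
have zsum (F G : {set 'I_n} -> 'F_2) : (forall L, z L != 0 -> F L = G L) ->
    \sum_L z L * F L = \sum_L z L * G L.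
  by move=> FG; apply: eq_bigr => L _; have [->|/FG->//] := eqVneq (z L) 0; rewrite !mul0r.
exists y => K.
  rewrite /y; case: ifP => [/andP[KD /eqP cK] nz|]; last by rewrite eqxx.
  have /existsP[L /andP[zL /hasP[s sL pKs]]] : [exists L, (z L != 0) &&
      has (fun s => pos K (b :: s)) (dual L)].
    apply: contraNT nz; rewrite negb_exists => /forallP H; apply/eqP.
    rewrite big1 // => L _; have := H L; have [->|_] /= := eqVneq (z L) 0.
      by rewrite mul0r.
    move/hasPn => nL; rewrite /chain_sum big_map big_seq big1 ?mulr0 // => s /nL.
    by rewrite /pos_ind => /negbTE ->.
  have [[_ nP] _] := bP L s zL sL; have [t [c [t0 c0 cK0 E]]] := asboolW pKs.
  have inK : in_cone K (pt t (b :: s)).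
    exists c => //; split=> // i.
    by have [/c0/ltW|/cK0 ->] := boolP (i \in K).
  have [||ix sx] := nP t; first by move=> j /t0/ltW.
    by exists 0%N; rewrite // gt_eqF ?t0.
  by split=> //; [apply: interior_center ix | apply: sx].
move=> KD cK; transitivity (\sum_L z L * \sum_(k in K)
    chain_sum (pos_ind (K :\ k)%SET) (map (cons b) (dual L))).
  rewrite (eq_bigr (fun k => \sum_L z L * chain_sum (pos_ind (K :\ k)%SET)
    (map (cons b) (dual L)))) => [|k kK].
    by rewrite exchange_big; apply: eq_bigr => L _; rewrite mulr_sumr.
  rewrite /y; have := cardsD1 k K; rewrite kK cK add1n => ->; rewrite eqxx.
  by rewrite (DeltaS KD) ?finset.subD1set.
transitivity (\sum_L z L * chain_sum (face_sum (pos_ind K)) (map (cons b) (dual L))).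
  apply: zsum => L zL; rewrite /chain_sum big_map exchange_big big_map /=.
  rewrite big_seq [RHS]big_seq; apply: eq_bigr => s sL.
  have [[gs _] sz] := bP L s zL sL; apply/esym/pos_parity => //.
  by rewrite cK /= addnS addnC sz.
(* The base of the cone over [b] meets [K] in [z K] by duality. What remains is the cone over the
   boundary of the dual chain, and this boundary vanishes because [z] is a cycle; for [m = r] it is
   the number of points. *)
under eq_bigr do rewrite chain_sum_cone mulrDr.
rewrite big_split /= [X in _ + X](_ : _ = 0) ?addr0; last first.
  move: cyc; case: eqP => [mr' cyc|/eqP mr' cyc].
    transitivity (\sum_L z L * pos_ind K [:: b]); last by rewrite -mulr_suml cyc mul0r.
    apply: zsum => L zL; have [_ P2 _] := zdual L zL; have [_ _ _ cL] := zP L zL.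
    have [|b' ->] := P2; first by rewrite cL.
    by rewrite /chain_sum big_seq1 face_sum_cons /face_sum big_ord0 addr0.
  have {}mr' : (m < r)%N by rewrite ltn_neqAle mr'.
  pose f := pos_ind K \o cons b.
  transitivity (\sum_L z L * \sum_(k | addable L k) chain_sum f (dual (k |: L)%SET)).
    apply: zsum => L zL; have [_ _ P3] := zdual L zL; have [_ _ _ cL] := zP L zL.
    by rewrite P3 // cL.
  transitivity (\sum_(L' | (L' \in Delta) && (#|L'| == m.+1))
      (\sum_(k in L') z (L' :\ k)%SET) * chain_sum f (dual L')); last first.
    by rewrite big1 // => L' /andP[L'D /eqP cL']; rewrite cyc // mul0r.
  transitivity (\sum_(L : {set 'I_n}) \sum_(k | k \notin L)
      if addable L k then z L * chain_sum f (dual (k |: L)%SET) else 0).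
    apply: eq_bigr => L _; rewrite mulr_sumr big_mkcond [RHS]big_mkcond.
    by apply: eq_bigr => k _; rewrite /addable; case: (k \in L).
  rewrite sum_add_remove [RHS]big_mkcond; apply: eq_bigr => L _; rewrite mulr_suml.
  transitivity (\sum_(k in L) if (L \in Delta) && (#|L| == m.+1) then
      z (L :\ k)%SET * chain_sum f (dual L) else 0); last first.
    by case: ifP => // _; rewrite big1.
  apply: eq_bigr => k kL; rewrite /addable !inE eqxx /= finset.setD1K //.
  have [->|/zP[_ _ _ cL]] := eqVneq (z (L :\ k)%SET) 0.
    by rewrite mul0r !if_same.
  by rewrite (cardsD1 k) kL cL eqxx andbT.
rewrite (bigD1 K) //= big1 ?addr0 => [|L LK]; last first.
  have [->|zL] := eqVneq (z L) 0; first by rewrite mul0r.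
  have [LD iL _ cL] := zP L zL.
  by rewrite (chain_sum_pos_neq dualP) ?mulr0 ?cK ?cL // eq_sym.
have [->|zK] := eqVneq (z K) 0; first by rewrite mul0r.
by have [_ iK _ _] := zP K zK; rewrite (chain_sum_pos dualP) ?mulr1.
Qed.

(** * Orientations and the integral complex of interior cones *)

Definition vol s : R := \det (\matrix_(i < r) s`_i).

(** Expansion along the inserted row: [g] is the vector of cofactors, which do not see the
    placeholder row 0. *)
Lemma vol_insert s : (size s).+1 = r -> exists g : V, forall p v,
  (p <= size s)%N -> vol (take p s ++ v :: drop p s) = (-1) ^+ p * pairing g v.
Proof.
move=> sr; have r0 : (0 < r)%N by rewrite -sr.
exists (\row_j cofactor (\matrix_(i < r) (0 :: s)`_i) (Ordinal r0) j) => p v ps.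
have pr : (p < r)%N by rewrite -sr.
rewrite /vol (expand_det_row _ (Ordinal pr)) /pairing mulr_sumr.
apply: eq_bigr => j _; rewrite !mxE nth_cat size_takel // ltnn subnn /=.
rewrite [RHS]mulrA [LHS]mulrC; congr (_ * _).
rewrite /cofactor /= add0n exprD -mulrA; congr (_ * (_ * _)); congr (\det _).
apply/matrixP => i k; rewrite !mxE nth_cat size_takel //= /bump.
have [pi|pi] /= := leqP p i; last by rewrite add0n pi nth_take.
by rewrite add1n ltnNge leqW //= subSn //= nth_drop subnKC.
Qed.

Lemma vol_chamber_neq0 J : J \in Delta -> #|J| = r ->
  vol [seq a i | i <- enum J] != 0.
Proof.
move=> JD Jr; apply/det0P => -[v v0 vA].
have sz : size (enum J) = r by rewrite -cardE.
pose c i := \sum_(j < r | nth i (enum J) j == i) v 0 j.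
have cJ i : i \notin J -> c i = 0.
  move=> iJ; rewrite /c big1 // => j /eqP ji.
  by move: iJ; rewrite -ji -mem_enum mem_nth // sz.
have cE (j : 'I_r) i : c (nth i (enum J) j) = v 0 j.
  rewrite /c (big_pred1 j) // => k /=; rewrite (set_nth_default i) ?sz //.
  by rewrite [X in _ == X](set_nth_default i) ?sz // nth_uniq ?enum_uniq ?sz.
have c0 : comb c = 0.
  rewrite -vA mulmx_sum_row (comb_on cJ) -big_enum /=.
  have [i0 _|J0] := pickP (mem J).
   rewrite (big_nth i0) big_mkord sz; apply: eq_bigr => j _.
    by rewrite cE rowK (nth_map i0) // sz.
  have J0' : J = finset.set0 by apply/setP => i; rewrite inE; apply: J0.
  rewrite J0' enum_set0 big_nil; move: Jr; rewrite J0' cards0 => r0.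
  by rewrite big1 // => j; have := ltn_ord j; rewrite -{2}r0.
case/rV0Pn: v0 => j; have [i0 i0J] : exists i0, i0 \in J.
  by apply/card_gt0P; rewrite Jr (leq_ltn_trans _ (ltn_ord j)).
by rewrite -(cE j i0) (face_free JD cJ c0) eqxx.
Qed.

Definition orientation (K : {set 'I_n}) : int := sgz (vol [seq a i | i <- enum K]).

(** [incidence] compensates the position of the new ray in the determinant, so each term is the side
    of the wall on which its chamber lies; the two chambers lie on opposite sides. *)
Lemma orientation_wall K : K \in Delta -> interior (center K) -> #|K|.+1 = r ->
  \sum_(k | addable K k) incidence K k * orientation (k |: K)%SET = 0.
Proof.
move=> KD iK rK; pose s := [seq a i | i <- enum K].
have sz : size s = #|K| by rewrite size_map -cardE.
have [|g gP] := @vol_insert s; first by rewrite sz.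
have gE k : addable K k -> incidence K k * orientation (k |: K)%SET = sgz (pairing g (a k)).
  move=> /andP[kK _]; rewrite /orientation enum_setU1 // map_cat /= map_take map_drop.
  rewrite gP; last first.
    by rewrite sz subset_leq_card //; apply/fintype.subsetP => j; rewrite inE => /andP[].
  rewrite sgzM; set p := #|_|.
  have -> : sgz ((-1) ^+ p : R) = (-1) ^+ p by rewrite sgzX sgzN1.
  by rewrite mulrA -expr2 sqrr_sign mul1r.
rewrite (eq_bigr _ gE); have [|k kK] := exists_addable KD; first by rewrite rK.
have [kK' kD] := andP kK.
apply: (wall_sum KD iK rK (g := g)).
- have := vol_chamber_neq0 kD; rewrite card_addable // => /(_ rK).
  rewrite enum_setU1 // map_cat /= map_take map_drop gP; last first.
    by rewrite sz subset_leq_card //; apply/fintype.subsetP => j; rewrite inE => /andP[].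
  apply: contraNneq => ->; rewrite /pairing big1 ?mulr0 // => j _.
  by rewrite mxE mul0r.
- move=> i iK'; have /(nthP 0)[j js E] : a i \in s by rewrite map_f // mem_enum.
  have := gP 0%N (a i) (leq0n _); rewrite take0 drop0 /= mul1r => <-.
  have r0 : (0 < r)%N by rewrite -rK.
  have j1r : (j.+1 < r)%N by rewrite -rK ltnS -sz.
  rewrite /vol (@determinant_alternate _ _ _ (Ordinal r0) (Ordinal j1r)) // => l.
  by rewrite !mxE /= E.
by move=> k1 k2 g1 g2; rewrite gtr0_sgz // ltr0_sgz // subrr.
Qed.

Definition inter J K := [&& K \in Delta, `[< interior (center K) >] & J \subset K].

Lemma interP J K : reflect [/\ K \in Delta, interior (center K) & J \subset K] (inter J K).
Proof. by apply: (iffP and3P) => -[? /asboolP ? ?]. Qed.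

Lemma inter_add J L k : inter J L -> k \notin L ->
  inter J (k |: L)%SET = ((k |: L)%SET \in Delta).
Proof.
move=> /interP[LD iL sL] kL; apply/interP/idP => [[]//|kD]; split=> //.
  by apply: interior_centerS iL; rewrite ?finset.subsetUr.
by apply: fintype.subset_trans sL _; rewrite finset.subsetUr.
Qed.

(** At most one term occurs; as a matrix over all pairs of sets it is what [exact_F2_homotopy]
    expects. *)
Definition coef (L K : {set 'I_n}) : int :=
  \sum_(k in K | (K :\ k)%SET == L) incidence L k.

Lemma sum_coef_up (W : zmodType) J m L (w : {set 'I_n} -> W) :
  inter J L -> #|L|.+1 = m ->
  \sum_(K | inter J K && (#|K| == m)) w K *~ coef L K =
  \sum_(k | addable L k) w (k |: L)%SET *~ incidence L k.
Proof.
move=> LJ cL.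
pose G (L' : {set 'I_n}) k := if (L' == L) && addable L k
  then w (k |: L)%SET *~ incidence L k else 0.
have LD : L \in Delta by case/interP: LJ.
transitivity (\sum_(L' : {set 'I_n}) \sum_(k | k \notin L') G L' k); last first.
  rewrite (bigD1 L) //= [X in _ + X]big1 ?addr0 => [|L' /negbTE nL]; last first.
    by apply: big1 => k _; rewrite /G nL.
  rewrite /G eqxx /= -big_mkcondr; apply: eq_bigl => k.
  by rewrite /addable; case: (k \in L).
rewrite sum_add_remove big_mkcond; apply: eq_bigr => K _.
case: ifP => [/andP[/interP[KD _ _] _]|/negP nK]; last first.
  apply/esym/big1 => k kK; rewrite /G; case: eqP => //= E.
  have kL : k \notin L by rewrite -E !inE eqxx.
  have KE : (k |: L)%SET = K by rewrite -E finset.setD1K.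
  rewrite /addable kL KE /=; case: ifP => // KD; case: nK.
  by rewrite -{1}KE (inter_add LJ kL) KE KD (cardsD1 k) kK E add1n cL eqxx.
rewrite /coef mulrz_sumr big_mkcondr; apply: eq_bigr => k kK; rewrite /G.
case: eqP => //= E; have kL : k \notin L by rewrite -E !inE eqxx.
by rewrite /addable kL -E finset.setD1K // KD.
Qed.

Lemma sum_coef_down (W : zmodType) (P : pred {set 'I_n}) K (z : {set 'I_n} -> W) :
  (forall L, z L != 0 -> P L) ->
  \sum_(L | P L) z L *~ coef L K =
  \sum_(k in K) z (K :\ k)%SET *~ incidence (K :\ k)%SET k.
Proof.
move=> zP; rewrite (eq_bigr (fun L => \sum_(k in K)
    if (K :\ k)%SET == L then z L *~ incidence L k else 0)) => [|L _]; last first.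
  by rewrite /coef mulrz_sumr -big_mkcondr.
rewrite exchange_big; apply: eq_bigr => k _ /=.
rewrite -big_mkcondr /=; have [zK|zK] := eqVneq (z (K :\ k)%SET) 0.
  by rewrite zK mul0rz big1 // => L /andP[_ /eqP <-]; rewrite zK mul0rz.
rewrite (big_pred1 (K :\ k)%SET) // => L /=.
by apply/andP/eqP => [[_ /eqP]//|->]; rewrite zP.
Qed.

Lemma coef_coef J m L K : inter J L -> #|L|.+1 = m -> K \in Delta ->
  \sum_(K' | inter J K' && (#|K'| == m)) coef L K' * coef K' K = 0.
Proof.
move=> LJ cL KD.
rewrite (eq_bigr (fun K' => coef K' K *~ coef L K')) => [|K' _]; last first.
  by rewrite mulrzz mulrC.
rewrite sum_coef_up //.
pose F k k' := if [&& k != k', k \notin L, k' \notin L & K == (k |: (k' |: L))%SET]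
  then incidence L k * incidence (k |: L)%SET k' else 0.
apply: etrans (@sum_antisym _ _ F _ _); last 2 first.
- move=> k k'; rewrite /F finset.setUCA [k' == k]eq_sym.
  have [kL|kL] := boolP (k \in L); have [k'L|k'L] := boolP (k' \in L);
    rewrite ?andbF ?oppr0 //=.
  case: ifP => [/andP[kk' _]|_]; last by rewrite oppr0.
  exact: incidence_anticomm.
- by move=> k; rewrite /F eqxx.
rewrite big_mkcond; apply: eq_bigr => k _; case: ifP => [/andP[kL kD]|nk]; last first.
  apply/esym/big1 => k' _; rewrite /F; case: ifP => // /and4P[kk' kL k'L /eqP E].
  move/negP: nk; case; rewrite /addable kL; apply: DeltaS KD _.
  by rewrite E finset.setUS // finset.subsetUr.
rewrite mulrzz mulrC /coef mulr_sumr big_mkcond; apply: eq_bigr => k' _.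
rewrite /F kL /=; have [<-|kk'] := eqVneq k k'.
  case: ifP => // /andP[kK /eqP E].
  by have := finset.setU11 k L; rewrite -E !inE eqxx.
rewrite /= finset.setUCA; congr (if _ then _ else _).
apply/andP/andP => -[H1 /eqP H2].
  split; last by rewrite -H2 finset.setD1K.
  by apply/negP => k'L; have := finset.setU1r k k'L; rewrite -H2 !inE eqxx.
split; first by rewrite H2 !inE eqxx.
by rewrite H2 finset.setU1K // !inE negb_or eq_sym kk'.
Qed.

(* The complex of the interior cones that contain J, in the direction of the
   boundary, is exact over the rationals, with contraction h. *)
Lemma interior_exact_rat J m : J \in Delta -> (m < r)%N ->
  exists h : {set 'I_n} -> {set 'I_n} -> rat, forall w : {set 'I_n} -> rat,
    (forall L, inter J L -> #|L|.+1 = m ->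
       \sum_(k | addable L k) w (k |: L)%SET *~ incidence L k = 0) ->
    forall K, inter J K -> #|K| = m -> w K = \sum_(k | addable K k)
      (\sum_(L | inter J L && (#|L| == m)) h L (k |: K)%SET * w L) *~ incidence K k.
Proof.
move=> JD mr; pose P p K := inter J K && (#|K| == p).
pose P1 L := inter J L && (#|L|.+1 == m).
have [||h hP] := @exact_F2_homotopy {L | P1 L} {K | P m K} {K | P m.+1 K}
  (fun L K => coef (val L) (val K)) (fun K M => coef (val K) (val M)).
- case=> L PL [M PM] /=; have [LJ /eqP cL] := andP PL.
  have [/interP[MD _ _] _] := andP PM.
  by rewrite (sum_sig _ (fun K => coef L K * coef K M)) (coef_coef LJ).
- move=> z zP; pose z' K := oapp z 0 (insub K).
  have z'E K : z' (val K) = z K by rewrite /z' valK.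
  have z'0 K : z' K != 0 -> P m K by rewrite /z'; case: insubP => //=; rewrite eqxx.
  have [K||y yP yz] := @interior_exact_F2 J m z' JD (ltnW mr).
  + by case/z'0/andP=> /interP[? ? ?] /eqP.
  + rewrite ltn_eqF // => K KD cK; have [KJ|KJ] := boolP (inter J K); last first.
      apply: big1 => k kK; apply/eqP; apply: contraNT KJ => /z'0/andP[KkJ _].
      by rewrite -(finset.setD1K kK) inter_add ?finset.setD1K // !inE eqxx.
    have PK : P m.+1 K by rewrite /P KJ cK eqxx.
    rewrite -[RHS](zP (exist _ K PK)).
    rewrite (eq_bigr (fun u => z' (val u) *~ coef (val u) K)) => [|u _]; last first.
      by rewrite z'E mulrzr.
    rewrite (sum_sig _ (fun u => z' u *~ coef u K)) sum_coef_down //.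
    by apply: eq_bigr => k _; rewrite F2_incidence.
  + exists (y \o val) => -[K PK] /=; have [KJ /eqP cK] := andP PK.
  have [KD _ _] := interP _ _ KJ.
  rewrite -[LHS](z'E (exist _ K PK)) /= -yz //.
  rewrite (eq_bigr (fun u => y (val u) *~ coef (val u) K)) => [|u _]; last first.
    by rewrite mulrzr.
  rewrite (sum_sig _ (fun u => y u *~ coef u K)).
  rewrite sum_coef_down => [|L /yP[LD iL sL cL]].
    by apply: eq_bigr => k _; rewrite F2_incidence.
  by rewrite /P1 cL eqxx andbT; apply/interP.
exists (fun L M => if (insub L, insub M) is (Some L', Some M') then h L' M' else 0) => w wP K KJ cK.
have PK : P m K by rewrite /P KJ cK eqxx.
have := hP (fun K => w (val K)) _ (exist _ K PK) => /= ->; last first.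
  case=> L PL /=; have [LJ /eqP cL] := andP PL; rewrite -[RHS](wP L LJ cL) -(sum_coef_up w LJ cL).
  rewrite -(sum_sig _ (fun K => w K *~ coef L K)); apply: eq_bigr => u _.
  by rewrite mulrzl.
pose g M := \sum_(L | inter J L && (#|L| == m))
  (if (insub L : option {K | P m K}, insub M : option {K | P m.+1 K}) is (Some L', Some M') then h L' M' else 0) * w L.
rewrite -[RHS](@sum_coef_up _ J m.+1 K g) ?cK // -(sum_sig _ (fun M => g M *~ coef K M)).
apply: eq_bigr => M _; rewrite mulrzl; congr (_ *~ _).
rewrite /g; apply/esym; apply: etrans (esym (sum_sig (P m) _)) _; apply: eq_bigr => L _.
by rewrite !valK.
Qed.

(** Above the chambers there are no cones; the complex is closed off by a one-dimensional space,
    with the orientations as incidence numbers. Modulo 2 they are all 1, which gives the sum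
    condition of [interior_exact_F2] for [m = r]. *)
Lemma interior_exact_top J : J \in Delta ->
  exists h : {set 'I_n} -> rat, forall w : {set 'I_n} -> rat,
    (forall L, inter J L -> #|L|.+1 = r ->
       \sum_(k | addable L k) w (k |: L)%SET *~ incidence L k = 0) ->
    forall K, inter J K -> #|K| = r -> w K =
      (\sum_(L | inter J L && (#|L| == r)) h L * w L) *~ orientation K.
Proof.
move=> JD; pose P K := inter J K && (#|K| == r).
pose P1 L := inter J L && (#|L|.+1 == r).
have [||h hP] := @exact_F2_homotopy {L | P1 L} {K | P K} unit
  (fun L K => coef (val L) (val K)) (fun K _ => orientation (val K)).
- case=> L PL [] /=; have [LJ /eqP cL] := andP PL; have [LD iL _] := interP _ _ LJ.
  rewrite (sum_sig _ (fun K => coef L K * orientation K)).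
  rewrite (eq_bigr (fun K => orientation K *~ coef L K)) => [|K _]; last first.
    by rewrite mulrzz mulrC.
  rewrite sum_coef_up // -[RHS](orientation_wall LD iL cL).
  by apply: eq_bigr => k _; rewrite mulrzz mulrC.
- move=> z zP; pose z' K := oapp z 0 (insub K).
  have z'E K : z' (val K) = z K by rewrite /z' valK.
  have z'0 K : z' K != 0 -> P K by rewrite /z'; case: insubP => //=; rewrite eqxx.
  have [K||y yP yz] := @interior_exact_F2 J r z' JD (leqnn r).
  + by case/z'0/andP=> /interP[? ? ?] /eqP.
  + rewrite eqxx -[RHS](zP tt) (bigID P) /= [X in _ + X]big1 ?addr0.
      rewrite -sum_sig; apply: eq_bigr => K _; rewrite z'E.
      have /andP[/interP[KD _ _] /eqP cK] := valP K.
      have := vol_chamber_neq0 KD cK; rewrite -sgz_eq0 -/(orientation _) /orientation.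
      by case: sgzP => // _ _; rewrite ?mulr1 // mulrN1 F2_oppr.
    by move=> K; apply: contraNeq => /z'0.
  + exists (y \o val) => -[K PK] /=; have [KJ /eqP cK] := andP PK.
  have [KD _ _] := interP _ _ KJ.
  rewrite -[LHS](z'E (exist _ K PK)) /= -yz //.
  rewrite (eq_bigr (fun u => y (val u) *~ coef (val u) K)) => [|u _]; last first.
    by rewrite mulrzr.
  rewrite (sum_sig _ (fun u => y u *~ coef u K)).
  rewrite sum_coef_down => [|L /yP[LD iL sL cL]].
    by apply: eq_bigr => k _; rewrite F2_incidence.
  by rewrite /P1 cL eqxx andbT; apply/interP.
exists (fun L => if insub L is Some L' then h L' tt else 0) => w wP K KJ cK.
have PK : P K by rewrite /P KJ cK eqxx.
have := hP (fun K => w (val K)) _ (exist _ K PK) => /= ->; last first.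
  case=> L PL /=; have [LJ /eqP cL] := andP PL; rewrite -[RHS](wP L LJ cL) -(sum_coef_up w LJ cL).
  rewrite -(sum_sig _ (fun K => w K *~ coef L K)); apply: eq_bigr => u _.
  by rewrite mulrzl.
rewrite (big_pred1 tt) => [|[]//]; rewrite mulrzl; congr (_ *~ _).
apply/esym; apply: etrans (esym (sum_sig P _)) _; apply: eq_bigr => L _.
by rewrite valK.
Qed.

End Fan.

(** * Forms killed by a subspace *)

Section Contraction.
Variable d : nat.
Implicit Types (e f m t : 'rV[rat]_d) (w : ext d) (U B : {vspace 'rV[rat]_d}).

Lemma contractDl c e f w : contract (c *: e + f) w = c *: contract e w + contract f w.
Proof.
apply/ffunP => S; rewrite !ffunE.
rewrite scaler_sumr -big_split; apply: eq_bigr => i _ /=.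
by rewrite !mxE -[c *: _]/(c * _); ring.
Qed.

(** Contraction is the transpose of [wedge1] in the coordinates [S]; its square vanishes because
    that of [wedge1] does. *)
Lemma contract_adjoint e w (v : ext d) :
  \sum_S contract e w S * v S = \sum_S w S * wedge1 e v S :> rat.
Proof.
pose G (S : {set 'I_d}) i := ext_sign S i * e 0 i * w (i |: S)%SET * v S.
transitivity (\sum_(S : {set 'I_d}) \sum_(i | i \notin S) G S i).
  by apply: eq_bigr => S _; rewrite ffunE mulr_suml.
rewrite sum_add_remove; apply: eq_bigr => S _; rewrite ffunE mulr_sumr.
by apply: eq_bigr => i iS; rewrite /G ext_signDid finset.setD1K //; ring.
Qed.

Lemma contract_contract e w : contract e (contract e w) = 0.
Proof.
apply/ffunP => S; rewrite [RHS]ffunE.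
pose v : ext d := [ffun T => (T == S)%:R].
transitivity (\sum_T contract e (contract e w) T * v T).
  rewrite (bigD1 S) //= [v S]ffunE eqxx mulr1 big1 ?addr0 // => T /negbTE TS.
  by rewrite [v T]ffunE TS mulr0.
rewrite !contract_adjoint wedge1_wedge1 big1 // => T _.
by rewrite ffunE mulr0.
Qed.

Lemma contractC e f w : contract e (contract f w) = - contract f (contract e w).
Proof.
have := contract_contract (1 *: e + f) w.
rewrite !contractDl !scale1r !linearD /= !contract_contract add0r addr0 => /eqP.
by rewrite addr_eq0 => /eqP.
Qed.

(* The forms of degree l - j; only 0 is one if l < j. *)
Definition ext_deg (l j : nat) w := forall S : {set 'I_d}, (#|S| + j != l)%N -> w S = 0.

Lemma ext_deg0 l j : ext_deg l j 0.
Proof. by move=> S _; rewrite ffunE. Qed.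

Lemma ext_degP l j c u w : ext_deg l j u -> ext_deg l j w -> ext_deg l j (c *: u + w).
Proof. by move=> du dw S nS; rewrite !ffunE du // dw // addr0; apply: mulr0. Qed.

Lemma ext_deg_contract l j e w : ext_deg l j w -> ext_deg l j.+1 (contract e w).
Proof.
move=> dw S nS; rewrite ffunE big1 // => i iS; rewrite dw ?mulr0 //.
by rewrite cardsU1 iS add1n addSn -addnS.
Qed.

Lemma ext_deg_wedge1 l j m w : ext_deg l j.+1 w -> ext_deg l j (wedge1 m w).
Proof.
move=> dw S nS; rewrite ffunE big1 // => i iS; rewrite dw ?mulr0 //.
by move: nS; rewrite (cardsD1 i) iS add1n addSn -addnS.
Qed.

Lemma ext_deg_wedge1l l j m w : ext_deg l j w -> ext_deg l.+1 j (wedge1 m w).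
Proof.
move=> dw S nS; rewrite ffunE big1 // => i iS; rewrite dw ?mulr0 //.
by move: nS; rewrite (cardsD1 i) iS add1n addSn eqSS.
Qed.

Lemma ext_deg_eq0 l j w : (l < j)%N -> ext_deg l j w -> w = 0.
Proof.
move=> lj dw; apply/ffunP => S; rewrite ffunE dw //.
by rewrite neq_ltn (leq_trans lj) ?orbT // leq_addl.
Qed.

(** This is the exterior power of degree [l - j] of the annihilator of [U] ([killed_extpow]), given
    by equations instead of generators, so that stability under contraction is immediate. *)
Definition killed U l j : {vspace ext d} :=
  vspan [set w | ext_deg l j w /\ forall x, x \in U -> contract x w = 0]%classic.

Lemma killedP U l j w : w \in killed U l j <->
  ext_deg l j w /\ forall x, x \in U -> contract x w = 0.
Proof.
apply: mem_vspan => [|c u v [du ku] [dv kv]].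
  by split; [apply: ext_deg0 | move=> x _; rewrite linear0].
split; first exact: ext_degP.
by move=> x xU; rewrite linearD linearZ /= ku // kv // addr0; apply: scaler0.
Qed.

Lemma killed_add U f l j w : w \in killed (U + <[f]>)%VS l j <->
  w \in killed U l j /\ contract f w = 0.
Proof.
split=> [/killedP[dw kw]|[/killedP[dw kw] fw]].
  split; last by apply/kw/(subvP (addvSr _ _))/memv_line.
  by apply/killedP; split=> // x xU; apply/kw/(subvP (addvSl _ _)).
apply/killedP; split=> // _ /memv_addP[x xU [_ /vlineP[c ->] ->]].
by rewrite addrC contractDl fw kw // scaler0 addr0.
Qed.

Lemma contract_span (X : seq 'rV[rat]_d) w :
  (forall x, x \in X -> contract x w = 0) ->
  forall x, x \in <<X>>%VS -> contract x w = 0.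
Proof.
move=> Xw x /(@coord_span _ _ _ (in_tuple X)) ->; elim/big_rec: _ => [|i y _ Ey].
  have := contractDl 1 0 0 w; rewrite scaler0 add0r scale1r.
  by rewrite -[LHS]addr0 => /addrI <-.
by rewrite contractDl Ey Xw ?scaler0 ?addr0 // mem_nth.
Qed.

Lemma exists_dual U : (\dim U < d)%N -> exists t f,
  (forall x, x \in U -> pairing t x = 0) /\ pairing t f = 1.
Proof.
move=> dU; have [|t t0 tU] := @exists_normal rat d (vbasis U); first by rewrite size_tuple.
exists t, ((pairing t t)^-1 *: t); split.
  move=> x /coord_vbasis ->; rewrite linear_sum big1 // => i _.
  by rewrite linearZ /= tU ?mulr0 // mem_nth // size_tuple.
by rewrite linearZ /= mulVf // gt_eqF // pairing_self_gt0.
Qed.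

Section Descent.
Variables (U : {vspace 'rV[rat]_d}) (t f : 'rV[rat]_d).
Hypotheses (tU : forall x, x \in U -> pairing t x = 0) (tf : pairing t f = 1).

Lemma contract_wedge_dual x w : x \in U ->
  contract x (wedge1 t w) = - wedge1 t (contract x w).
Proof. by move=> xU; rewrite contract_wedge1 tU // scale0r add0r. Qed.

Lemma wedge_contract_split w : w = contract f (wedge1 t w) + wedge1 t (contract f w).
Proof. by rewrite contract_wedge1 tf scale1r subrK. Qed.

Lemma killed_wedge1 l j w : w \in killed U l j.+1 -> wedge1 t w \in killed U l j.
Proof.
move=> /killedP[dw kw]; apply/killedP; split; first exact: ext_deg_wedge1.
by move=> x xU; rewrite contract_wedge_dual // kw // linear0 oppr0.
Qed.

Lemma killed_contract e l j w : w \in killed U l j -> contract e w \in killed U l j.+1.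
Proof.
move=> /killedP[dw kw]; apply/killedP; split; first exact: ext_deg_contract.
by move=> x xU; rewrite contractC kw // linear0 oppr0.
Qed.

Lemma contract_killed l j w : w \in killed U l j ->
  contract f w \in killed (U + <[f]>)%VS l j.+1.
Proof.
move=> kw; apply/killed_add; split; first exact: killed_contract.
exact: contract_contract.
Qed.

Lemma contract_wedge_killed l j w : w \in killed U l j ->
  contract f (wedge1 t w) \in killed (U + <[f]>)%VS l j.
Proof.
move=> /killedP[dw kw]; apply/killed_add; split; last exact: contract_contract.
have -> : contract f (wedge1 t w) = w - wedge1 t (contract f w).
  by rewrite {2}(wedge_contract_split w) addrK.
apply: rpredB; first exact/killedP.
by apply/killed_wedge1/killed_contract/killedP.
Qed.

Lemma dual_notin : f \notin U.
Proof. by apply/negP => /tU; rewrite tf => /eqP; rewrite oner_eq0. Qed.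

Lemma dim_add_dual : \dim (U + <[f]>) = (\dim U).+1.
Proof.
rewrite dimv_disjoint_sum ?dim_vline.
  have -> : f != 0 by apply: contraNneq dual_notin => ->; rewrite mem0v.
  by rewrite addn1.
apply/eqP; rewrite -subv0; apply/subvP => x; rewrite memv_cap memv0.
case/andP=> xU /vlineP[c xE]; move: xU; rewrite xE.
have [->|c0] := eqVneq c 0; first by rewrite scale0r.
move=> /(memvZ c^-1); rewrite scalerA mulVf // scale1r => fU.
by have := dual_notin; rewrite fU.
Qed.

(** Pascal's rule: contraction by [f] maps onto the forms of one degree less that [f] kills too,
    with kernel the forms already killed by [f]; [wedge1 t] provides preimages. *)
Lemma dim_killed_add l j : \dim (killed U l j) =
  (\dim (killed (U + <[f]>)%VS l j) + \dim (killed (U + <[f]>)%VS l j.+1))%N.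
Proof.
rewrite -(limg_ker_dim (linfun (contract f)) (killed U l j)).
congr (_ + _)%N; congr (\dim _).
  apply/vspaceP => w; rewrite memv_cap memv_ker lfunE /=.
  apply/andP/idP => [[kw /eqP fw]|/killed_add[kw ->] //]; exact/killed_add.
apply/vspaceP => w; apply/memv_imgP/idP => [[u ku ->]|/killed_add[kw fw]].
  by rewrite lfunE /=; apply: contract_killed.
exists (wedge1 t w); first exact: killed_wedge1.
by rewrite lfunE /= {1}(wedge_contract_split w) fw linear0 addr0.
Qed.

End Descent.
(** Induction on the codimension, in which each new vector comes with a form that is dual to it and
    vanishes on [U]. *)
Lemma dual_induction (P : {vspace 'rV[rat]_d} -> Prop) :
  (forall U, \dim U = d -> P U) ->
  (forall U t f, (forall x, x \in U -> pairing t x = 0) -> pairing t f = 1 ->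
     P (U + <[f]>)%VS -> P U) ->
  forall U, P U.
Proof.
move=> P1 P2 U; have dU : (\dim U <= d)%N.
  by rewrite (leq_trans (dimvS (subvf U))) // dimvf /dim /= mul1n.
have [m] := ubnP (d - \dim U); elim: m U dU => // m IHm U dU; rewrite ltnS => leU.
have [E|ne] := eqVneq (\dim U) d; first exact: P1.
have lt : (\dim U < d)%N by rewrite ltn_neqAle ne.
have [t [f [tU tf]]] := exists_dual lt.
by apply: (P2 U t f tU tf); apply: IHm; rewrite (dim_add_dual tU tf) //; lia.
Qed.

Lemma killed_full U l j w : \dim U = d -> w \in killed U l j ->
  w = w finset.set0 *: ext1 d.
Proof.
move=> dU /killedP[dw kw]; apply/ffunP => S; rewrite !ffunE -[_ *: _]/(_ * _).
have [->|/set0Pn[i iS]] := eqVneq S finset.set0; first by rewrite mulr1.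
rewrite mulr0; have : contract (delta_mx 0 i) w = 0.
  apply: kw; have -> : U = fullv by apply/eqP; rewrite eqEdim subvf dU dimvf /dim /= mul1n leqnn.
  exact: memvf.
move/ffunP/(_ (S :\ i)%SET); rewrite !ffunE (bigD1 i) ?inE ?eqxx //= big1 => [|k /andP[_ ki]].
  rewrite addr0 finset.setD1K // mxE !eqxx mulr1 => /eqP.
  by rewrite mulf_eq0 signr_eq0 => /eqP.
by rewrite mxE (negbTE ki) andbF mulr0 mul0r.
Qed.

Lemma ext1_killed U l : ext1 d \in killed U l l.
Proof.
apply/killedP; split=> [S nS|x _]; last exact: contract_ext1.
rewrite ffunE; case: eqP => // E; move: nS; rewrite E cards0 add0n eqxx; by [].
Qed.

Lemma ext1_neq0 : ext1 d != 0.
Proof.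
by apply/eqP => /ffunP/(_ finset.set0); rewrite !ffunE eqxx => /eqP; rewrite oner_eq0.
Qed.

Lemma dim_killed_full U l j : \dim U = d -> \dim (killed U l j) = (l == j).
Proof.
move=> dU; case: eqVneq => [->|lj].
  have -> : killed U j j = <[ext1 d]>%VS; last by rewrite dim_vline ext1_neq0.
  apply/eqP; rewrite eqEsubv -memvE ext1_killed andbT; apply/subvP => w kw.
  by rewrite (killed_full dU kw) memvZ // memv_line.
apply/eqP; rewrite dimv_eq0 -subv0; apply/subvP => w kw; rewrite memv0.
rewrite (killed_full dU kw); have /killedP[dw _] := kw.
by rewrite dw ?scale0r // cards0 add0n eq_sym.
Qed.

(** Forms killed by [U] live on a space of dimension [d - \dim U], which is less than their degree
    [l - j]. *)
Lemma killed_eq0 U l j : (d + j < l + \dim U)%N -> killed U l j = 0%VS.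
Proof.
move: U j; suff H U j : (d + j < l + \dim U)%N -> \dim (killed U l j) = 0%N.
  by move=> U j /H/eqP; rewrite dimv_eq0 => /eqP.
move: U j; apply: (dual_induction (P := fun U => forall j, _ -> _)) => [U dU j|].
  by rewrite dim_killed_full // dU addnC ltn_add2r; case: ltngtP.
move=> U t f tU tf IH j lt; rewrite (dim_killed_add tU tf) !IH //;
  by rewrite (dim_add_dual tU tf) !addnS ltnS // ltnW.
Qed.

Lemma killed_neq0 U l j : (j <= l)%N -> (l + \dim U <= d + j)%N ->
  exists2 w, w \in killed U l j & w != 0.
Proof.
move=> jl le; have : killed U l j != 0%VS.
  rewrite -dimv_eq0 -lt0n; move: U j jl le.
  apply: (dual_induction (P := fun U => forall j, _ -> _ -> _)) => [U dU j jl|].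
    rewrite dim_killed_full // dU addnC leq_add2l => lj.
    by have -> : l = j by [apply/eqP; rewrite eqn_leq lj]; rewrite eqxx.
  move=> U t f tU tf IH j jl le; rewrite (dim_killed_add tU tf).
  have dUf := dim_add_dual tU tf.
  have [lt|ge] := leqP (l + (\dim U).+1) (d + j).
    by rewrite addn_gt0 IH // dUf.
  have dU : (\dim U < d)%N.
    by rewrite -dUf (leq_trans (dimvS (subvf _))) // dimvf /dim /= mul1n.
  by rewrite addn_gt0 orbC IH // ?dUf; lia.
by move=> nz; exists (vpick (killed U l j)); rewrite ?memv_pick ?vpick0.
Qed.

Definition ann U : {vspace 'rV[rat]_d} :=
  vspan [set m | forall x, x \in U -> pairing m x = 0]%classic.

Lemma annP U m : m \in ann U <-> forall x, x \in U -> pairing m x = 0.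
Proof.
apply: mem_vspan => [x _|c u v u0 v0 x xU].
  by rewrite pairingC linear0.
by rewrite pairingC linearD linearZ /= ![pairing x _]pairingC u0 // v0 // mulr0 addr0.
Qed.

Lemma wedge_deg (s : seq 'rV[rat]_d) : ext_deg (size s) 0 (wedge s).
Proof.
elim: s => [|m s IHs] /=; last exact: ext_deg_wedge1l.
by move=> S; rewrite ffunE addn0 cards_eq0 => /negbTE ->.
Qed.

Lemma mem_extpow (q : nat) U (s : seq 'rV[rat]_d) : size s = q ->
  {subset s <= U} -> wedge s \in extpow q U.
Proof. by move=> sq sW; apply/vspanP/lspan_gen; exists s. Qed.

Lemma extpow_ind (q : nat) U (P : {vspace ext d}) :
  (forall s, size s = q -> {subset s <= U} -> wedge s \in P) ->
  (extpow q U <= P)%VS.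
Proof.
move=> HP; apply/subvP => w /vspanP; apply: lspan_min => _ [s [sq sW] <-].
exact: HP.
Qed.

(** Wedges of forms vanishing on [U] are killed because contraction is an antiderivation.
    Conversely, [wedge_contract_split] writes a killed form as one killed by [f] too plus [t] wedged
    with such a form, both known by induction. *)
Lemma killed_extpow U l j : (j <= l)%N -> killed U l j = extpow (l - j)%N (ann U).
Proof.
move=> jl; apply/eqP; rewrite eqEsubv; apply/andP; split; last first.
  apply: extpow_ind => s sq sU; apply/killedP; split.
    move=> S nS; apply: wedge_deg.
    by apply: contra nS; rewrite sq; lia.
  move=> x xU; elim: s sU {sq} => [|m s IHs] sU /=; first exact: contract_ext1.
  rewrite contract_wedge1 IHs => [|y ys]; last by apply: sU; rewrite inE ys orbT.
  have /annP/(_ x xU) -> : m \in ann U by apply: sU; rewrite inE eqxx.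
  by rewrite linear0 scale0r subr0.
move: U j jl; apply: (dual_induction (P := fun U => forall j, _ -> _)) => [U dU j jl|].
  apply/subvP => w kw; rewrite (killed_full dU kw).
  have [lj|lj] := eqVneq l j.
    by rewrite memvZ // -[ext1 d]/(wedge [::]) mem_extpow // lj subnn.
  have /killedP[dw _] := kw.
  by rewrite dw ?scale0r ?mem0v // cards0 add0n eq_sym.
move=> U t f tU tf IH j jl; apply/subvP => w kw.
have extS q : (extpow (Posz q) (ann (U + <[f]>)) <= extpow (Posz q) (ann U))%VS.
  apply: extpow_ind => s sq sU; apply: mem_extpow => // m /sU/annP mU.
  by apply/annP => x xU; apply: mU; apply: subvP xU; apply: addvSl.
rewrite (wedge_contract_split tf w); apply: rpredD.
  apply: (subvP (extS _)); apply: (subvP (IH j jl)).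
  exact: (contract_wedge_killed tU tf).
have [lt|ge] := ltnP j l; last first.
  have -> : contract f w = 0; last by rewrite linear0 mem0v.
  by apply: (@ext_deg_eq0 l j.+1) => //; have /killedP[] := contract_killed f kw.
have /(subvP (extS _)) := subvP (IH j.+1 lt) _ (contract_killed f kw).
set q := (l - j.+1)%N; have -> : (l - j)%N = q.+1 by rewrite /q; lia.
suff : (extpow q (ann U) <= linfun (wedge1 t) @^-1: extpow q.+1 (ann U))%VS.
  by move/subvP => H /H; rewrite -memv_preim lfunE.
apply: extpow_ind => s sq sU; rewrite -memv_preim lfunE /=.
apply: (mem_extpow (s := t :: s)); first by rewrite /= sq.
by move=> m; rewrite inE => /orP[/eqP ->|/sU//]; apply/annP.
Qed.

End Contraction.

(** * Ishida complexes of a simplicial complex *)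

Lemma pairingZl (K : comPzRingType) d c (u v : 'rV[K]_d) :
  pairing (c *: u) v = c * pairing u v.
Proof. by rewrite pairingC linearZ /= pairingC. Qed.

Lemma exists_separating d (U : {vspace 'rV[rat]_d}) v : v \notin U ->
  exists2 t, forall x, x \in U -> pairing t x = 0 & pairing t v = 1.
Proof.
move: U; apply: dual_induction => [U dU|U t f tU tf IH] vU.
  have UE : U = fullv.
    by apply/eqP; rewrite eqEdim subvf dU dimvf /dim /= mul1n leqnn.
  by rewrite UE memvf in vU.
have [tv|tv] := eqVneq (pairing t v) 0; last first.
  exists ((pairing t v)^-1 *: t) => [x xU|].
    by rewrite pairingZl (tU x) // mulr0.
  by rewrite pairingZl mulVf.
have [|t' t'U t'v] := IH; last first.
  by exists t' => // x xU; apply/t'U/(subvP (addvSl _ _)).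
apply: contra vU => /memv_addP[x xU [_ /vlineP[c ->] vE]].
by move: tv; rewrite vE linearD linearZ /= tU // tf mulr1 add0r => ->; rewrite scale0r addr0.
Qed.

Section IshidaComplex.
Variables (d n : nat) (ray : 'I_n -> 'rV[rat]_d).
Implicit Types (J K : {set 'I_n}) (Gamma : {set {set 'I_n}}) (B : {vspace 'rV[rat]_d}).
Implicit Types w : ext d.
Local Notation families := {ffun {set 'I_n} -> ext d}.

Definition span_face B J := (B + <<[seq ray i | i <- enum J]>>)%VS.

Definition face_forms B l J : {vspace ext d} := killed (span_face B J) l #|J|.

Lemma face_formsP B l J w : w \in face_forms B l J <->
  [/\ ext_deg l #|J| w, forall x, x \in B -> contract x w = 0
    & forall i, i \in J -> contract (ray i) w = 0].
Proof.
split=> [/killedP[dw kw]|[dw Bw Jw]].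
  split=> // [x xB|i iJ]; apply: kw; first exact: subvP (addvSl _ _) _ xB.
  by apply/(subvP (addvSr _ _))/memv_span/map_f; rewrite mem_enum.
apply/killedP; split=> // _ /memv_addP[x xB [y yJ ->]].
rewrite -[x]scale1r contractDl Bw // scaler0 add0r.
apply: contract_span yJ => _ /mapP[i + ->]; rewrite mem_enum; exact: Jw.
Qed.

Lemma face_forms_contract B l J k w : k \notin J -> w \in face_forms B l J ->
  contract (ray k) w \in face_forms B l (k |: J)%SET.
Proof.
move=> kJ /face_formsP[dw Bw Jw]; apply/face_formsP; split.
- by rewrite cardsU1 kJ add1n; apply: ext_deg_contract.
- by move=> x xB; rewrite contractC Bw // linear0 oppr0.
- move=> i; rewrite !inE => /orP[/eqP ->|iJ]; first exact: contract_contract.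
  by rewrite contractC Jw // linear0 oppr0.
Qed.

(* Ishida cochains supported on the simplicial complex Gamma, with the
   additional condition that their values are killed by the vectors of B. *)
Definition cochains Gamma B l j : {vspace families} :=
  vspan [set x : families | forall J, if (J \in Gamma) && (#|J| == j)
    then is_true (x J \in face_forms B l J) else x J = 0]%classic.

Lemma cochainsP Gamma B l j (x : families) : x \in cochains Gamma B l j <->
  forall J, if (J \in Gamma) && (#|J| == j)
    then is_true (x J \in face_forms B l J) else x J = 0.
Proof.
apply: mem_vspan => [J|c u v uP vP J]; rewrite !ffunE.
  by case: ifP => // _; rewrite mem0v.
have := uP J; have := vP J; case: ifP => _; last by move=> -> ->; rewrite addr0 scaler0.
by move=> vJ uJ; apply: rpredD => //; apply: rpredZ.
Qed.

(** All multipliers are 1 and no incidence signs appear, since contractions by distinct rays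
    anticommute. *)
Definition coboundary_fun Gamma (x : families) : families :=
  [ffun J => if J \in Gamma then \sum_(i in J) contract (ray i) (x (J :\ i)%SET) else 0].

Lemma coboundary_fun_is_linear Gamma : linear (coboundary_fun Gamma).
Proof.
move=> c x y; apply/ffunP => J; rewrite !ffunE.
case: ifP => _; last by rewrite scaler0 addr0.
rewrite scaler_sumr -big_split; apply: eq_bigr => i _ /=.
by rewrite !ffunE linearP.
Qed.

HB.instance Definition _ Gamma :=
  GRing.isLinear.Build rat families families *:%R (coboundary_fun Gamma)
    (coboundary_fun_is_linear Gamma).

Definition coboundary Gamma : 'End(families) := linfun (coboundary_fun Gamma).

Lemma coboundaryE Gamma (x : families) J : coboundary Gamma x J =
  if J \in Gamma then \sum_(i in J) contract (ray i) (x (J :\ i)%SET) else 0.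
Proof. by rewrite lfunE ffunE. Qed.

Section Downclosed.
Variable Gamma : {set {set 'I_n}}.
Hypothesis GammaS : forall J J', J \in Gamma -> J' \subset J -> J' \in Gamma.

Lemma coboundary_coboundary (x : families) : coboundary Gamma (coboundary Gamma x) = 0.
Proof.
apply/ffunP => J; rewrite coboundaryE [RHS]ffunE; case: ifP => // JG.
pose F i k := if [&& i \in J, k \in J & i != k]
  then contract (ray i) (contract (ray k) (x (J :\ i :\ k)%SET)) else 0.
apply: etrans (@sum_antisym _ _ F _ _); last 2 first.
- move=> i k; rewrite /F andbCA [k == i]eq_sym; case: ifP => _; last by rewrite oppr0.
  rewrite contractC (_ : J :\ i :\ k = J :\ k :\ i)%SET //.
  by apply/setP => h; rewrite !inE andbCA.
- by move=> i; rewrite /F eqxx !andbF.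
rewrite big_mkcond; apply: eq_bigr => i _; case: ifP => iJ; last first.
  by rewrite big1 // => k _; rewrite /F iJ.
rewrite coboundaryE (GammaS JG) ?finset.subD1set // linear_sum big_mkcond.
by apply: eq_bigr => k _; rewrite /F iJ !inE eq_sym andbC.
Qed.

Lemma coboundary_cochains B l j (x : families) : x \in cochains Gamma B l j ->
  coboundary Gamma x \in cochains Gamma B l j.+1.
Proof.
move=> /cochainsP xP; apply/cochainsP => J; rewrite coboundaryE.
case: ifP => [/andP[JG /eqP cJ]|nJ].
  rewrite JG; apply: rpred_sum => i iJ; rewrite -{2}(finset.setD1K iJ).
  apply: face_forms_contract; first by rewrite !inE eqxx.
  have := xP (J :\ i)%SET; rewrite (GammaS JG) ?finset.subD1set //.
  by move: cJ; rewrite (cardsD1 i) iJ add1n => -[->]; rewrite eqxx.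
case: ifP => // JG; move: nJ; rewrite JG /= => nJ; apply: big1 => i iJ.
have := xP (J :\ i)%SET; rewrite (cardsD1 i) iJ add1n eqSS in nJ.
by rewrite nJ andbF => ->; rewrite linear0.
Qed.

End Downclosed.

(** * The Koszul complex of one simplex *)

Section Simplex.
Variables (B : {vspace 'rV[rat]_d}) (K : {set 'I_n}).
Hypothesis indepK : \dim (span_face B K) = (\dim B + #|K|)%N.
Local Notation P := (powerset K).

Let PS J J' : J \in P -> J' \subset J -> J' \in P.
Proof. by rewrite !powersetE => JK /fintype.subset_trans; apply. Qed.

Lemma exists_dual_form i : i \in K -> exists m,
  [/\ forall x, x \in B -> pairing m x = 0, pairing m (ray i) = 1
    & forall k, k \in K -> k != i -> pairing m (ray k) = 0].
Proof.
move=> iK; have iU : ray i \notin span_face B (K :\ i)%SET.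
  apply/negP => iU.
  have : (span_face B K <= span_face B (K :\ i)%SET)%VS.
    rewrite subv_add addvSl /=.
    apply/span_subvP => _ /mapP[k + ->]; rewrite mem_enum => kK.
    have [->//|ki] := eqVneq k i.
    by apply/(subvP (addvSr _ _))/memv_span/map_f; rewrite mem_enum !inE ki.
  move/dimvS; rewrite indepK leqNgt => /negP; apply.
  rewrite (cardsD1 i) iK addnS ltnS; apply: leq_trans (dimv_add_leqif _ _) _.
  by rewrite leq_add2l (leq_trans (dim_span _)) // size_map -cardE.
have [m mU mi] := exists_separating iU; exists m; split=> // [x xB|k kK ki].
  exact/mU/(subvP (addvSl _ _)).
by apply/mU/(subvP (addvSr _ _))/memv_span/map_f; rewrite mem_enum !inE ki.
Qed.

(** Koszul homotopy, one vertex at a time. With [m] dual to the vertex [i], subtracting the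
    coboundary of [hy] makes [y] vanish on the faces containing [i], and elsewhere changes it by
    [wedge1 m] of its own contraction, so zeros obtained before are kept. Faces with [j + 1] rays
    are nonempty, hence all are reached. *)
Lemma simplex_exact l j (x : families) : x \in cochains P B l j.+1 -> coboundary P x = 0 ->
  exists2 z, z \in cochains P B l j & x = coboundary P z.
Proof.
move=> xC dx0.
suff H s : {subset s <= K} -> exists2 z, z \in cochains P B l j &
    forall J, has (fun i => i \in J) s -> (x - coboundary P z) J = 0.
  have [i|z zC zP] := H (enum K); first by rewrite mem_enum.
  exists z => //; apply/eqP; rewrite -subr_eq0; apply/eqP/ffunP => J; rewrite [RHS]ffunE.
  have : x - coboundary P z \in cochains P B l j.+1.
    by apply: rpredB => //; apply: coboundary_cochains.
  move/cochainsP/(_ J); case: ifP => // /andP[JK /eqP cJ] _; apply: zP.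
  have [i iJ] : exists i, i \in J by apply/card_gt0P; rewrite cJ.
  apply/hasP; exists i => //; rewrite mem_enum.
  by move: JK; rewrite powersetE => /fintype.subsetP; apply.
elim: s => [|i s IHs] sK; first by exists 0; rewrite ?mem0v.
have [|z zC zs] := IHs; first by move=> k ks; apply: sK; rewrite inE ks orbT.
have iK : i \in K by apply: sK; rewrite inE eqxx.
have [m [mB mi mK]] := exists_dual_form iK.
set y := x - coboundary P z in zs.
have yC : y \in cochains P B l j.+1 by apply: rpredB => //; apply: coboundary_cochains.
have dy : coboundary P y = 0.
  by rewrite linearB /= dx0 coboundary_coboundary // subr0.
have Ey : x - coboundary P z = y by [].
clearbody y; pose hy : families := [ffun J => if (J \in P) && (i \notin J)
  then wedge1 m (y (i |: J)%SET) else 0].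
have hyC : hy \in cochains P B l j.
  apply/cochainsP => J; rewrite ffunE.
  have := (cochainsP _ _ _ _ _).1 yC (i |: J)%SET.
  rewrite !powersetE finset.subUset finset.sub1set iK /=.
  have [JK|_] /= := boolP (J \subset K); last by [].
  have [iJ|iJ] := boolP (i \in J) => /=; first by move=> _; case: ifP => // _; apply: mem0v.
  rewrite cardsU1 iJ add1n eqSS; case: ifP => [_|_ ->]; last by rewrite linear0.
  move/face_formsP => -[dyJ By Jy]; apply/face_formsP; split.
  - by apply: ext_deg_wedge1; move: dyJ; rewrite cardsU1 iJ.
  - by move=> b bB; rewrite contract_wedge1 mB // scale0r By // linear0 subr0.
  - move=> k kJ; have kK := fintype.subsetP JK k kJ.
    rewrite contract_wedge1 mK //; last by apply: contraNneq iJ => <-.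
    have kiJ : k \in (i |: J)%SET by rewrite !inE kJ orbT.
    by rewrite scale0r Jy // linear0 subr0.
exists (z + hy); first exact: rpredD.
move=> J iJs.
have -> : (x - coboundary P (z + hy)) J = y J - coboundary P hy J.
  by rewrite linearD opprD addrA Ey !ffunE.
have [JK|JK] := boolP (J \in P); last first.
  have := (cochainsP _ _ _ _ _).1 yC J; have := (cochainsP _ _ _ _ _).1 (coboundary_cochains PS hyC) J.
  by rewrite (negbTE JK) /= => -> ->; rewrite subr0.
rewrite coboundaryE JK.
have DP k : (J :\ k)%SET \in P by apply: PS JK _; rewrite finset.subD1set.
have sJK : J \subset K by rewrite powersetE in JK.
have [iJ|iJ] := boolP (i \in J).
  rewrite (bigD1 i) //= big1 => [|k /andP[kJ ki]]; last first.
    by rewrite ffunE !inE iJ eq_sym ki andbF linear0.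
  rewrite addr0 [hy _]ffunE DP !inE eqxx /= finset.setD1K // contract_wedge1 mi scale1r.
  have yJ := (cochainsP _ _ _ _ _).1 yC J; move: yJ; case: ifP => [_ /face_formsP[_ _ ->//]|_ ->].
    by rewrite linear0 subr0 subrr.
  by rewrite !linear0 addr0 subrr.
have yJ : y J = 0 by apply: zs; move: iJs; rewrite /= (negbTE iJ).
have := congr1 (fun f : families => f (i |: J)%SET) dy.
rewrite coboundaryE [RHS]ffunE powersetE finset.subUset finset.sub1set iK sJK /=.
rewrite big_setU1 //= finset.setU1K // yJ linear0 add0r => dyJ.
rewrite sub0r; apply/eqP; rewrite oppr_eq0; apply/eqP.
transitivity (- wedge1 m (\sum_(k in J) contract (ray k) (y ((i |: J) :\ k)%SET))).
  rewrite linear_sum -sumrN; apply: eq_bigr => k kJ.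
  have ik : i != k by apply: contraNneq iJ => ->.
  rewrite ffunE DP !inE (negbTE iJ) andbF /= contract_wedge1 mK ?(fintype.subsetP sJK) 1?eq_sym //.
  rewrite scale0r sub0r; congr (- wedge1 _ (contract _ (y _))).
  by apply/setP => h; rewrite !inE; case: eqVneq => [->|//]; rewrite ik.
by rewrite dyJ linear0 oppr0.
Qed.

(** Closedness says that the only value, at the empty face, is killed by every ray of [K]; the space
    killing it is then too large for a nonzero form of degree [l]. *)
Lemma simplex_kernel l (x : families) : x \in cochains P B l 0 -> coboundary P x = 0 ->
  (d < l + \dim B + #|K|)%N -> x = 0.
Proof.
move=> xC dx0 lt; apply/ffunP => J; rewrite [RHS]ffunE.
have := (cochainsP _ _ _ _ _).1 xC J; case: ifP => // /andP[JK]; rewrite cards_eq0 => /eqP J0.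
rewrite {JK}J0 => /face_formsP[dx Bx _]; apply/eqP; rewrite -memv0.
rewrite -(@killed_eq0 d (span_face B K) l 0) ?indepK ?addn0 ?addnA //.
apply/killedP; split; first by rewrite cards0 in dx.
move=> _ /memv_addP[u uB [v vK ->]]; rewrite -[u]scale1r contractDl Bx // scaler0 add0r.
apply: contract_span vK => _ /mapP[i + ->]; rewrite mem_enum => iK.
have := congr1 (fun f : families => f [set i]%SET) dx0.
rewrite coboundaryE [RHS]ffunE powersetE finset.sub1set iK big_set1.
by rewrite finset.setDv.
Qed.

End Simplex.

End IshidaComplex.

(** * Vanishing below the top degree *)

Section Vanishing.
Variables (R : realFieldType) (d r n : nat) (a : 'I_n -> 'rV[R]_r).
Variables (Delta : {set {set 'I_n}}) (ray : 'I_n -> 'rV[rat]_d).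
Variables (B : {vspace 'rV[rat]_d}) (l : nat).
Implicit Types (J K L : {set 'I_n}) (Gamma : {set {set 'I_n}}).
Local Notation families := {ffun {set 'I_n} -> ext d}.
Local Notation interior_face K := (interior a Delta (center a K)).

Hypothesis DeltaS : forall J J', J \in Delta -> J' \subset J -> J' \in Delta.
Hypothesis carried_inj : forall J J' c c', J \in Delta -> J' \in Delta ->
  carried J c -> carried J' c' -> comb a c = comb a c' -> c =1 c'.
Hypothesis fanD : forall x y,
  in_fan a Delta x -> in_fan a Delta y -> in_fan a Delta (x + y).
Hypothesis chamber : exists2 J, J \in Delta & #|J| = r.
Hypothesis indep : forall K, K \in Delta ->
  \dim (span_face ray B K) = (\dim B + #|K|)%N.
Hypothesis dimB : (\dim B + r)%N = d.

Definition restrict K (x : families) : families :=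
  [ffun J : {set 'I_n} => if J \subset K then x J else 0].

Lemma restrict_is_linear K : linear (restrict K).
Proof.
move=> c x y; apply/ffunP => J; rewrite !ffunE.
by case: ifP => // _; rewrite scaler0 addr0.
Qed.

HB.instance Definition _ K :=
  GRing.isLinear.Build rat families families *:%R (restrict K) (restrict_is_linear K).

Lemma restrict_restrict K L (x : families) : K \subset L ->
  restrict K (restrict L x) = restrict K x.
Proof.
move=> KL; apply/ffunP => J; rewrite !ffunE.
by case: ifP => // JK; rewrite (fintype.subset_trans JK KL).
Qed.

Let powS K J J' : J \in powerset K -> J' \subset J -> J' \in powerset K.
Proof. by rewrite !powersetE => JK /fintype.subset_trans; apply. Qed.

Lemma coboundary_restrict Gamma K (x : families) :
  (forall J, J \subset K -> J \in Gamma) ->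
  coboundary ray (powerset K) (restrict K x) = restrict K (coboundary ray Gamma x).
Proof.
move=> KG; apply/ffunP => J; rewrite [RHS]ffunE !coboundaryE powersetE.
case: ifP => // JK; rewrite KG //; apply: eq_bigr => i _; rewrite ffunE.
by rewrite (fintype.subset_trans _ JK) // finset.subD1set.
Qed.

Lemma restrict_cochains Gamma K j (x : families) :
  (forall J, J \subset K -> J \in Gamma) -> x \in cochains ray Gamma B l j ->
  restrict K x \in cochains ray (powerset K) B l j.
Proof.
move=> KG /cochainsP xC; apply/cochainsP => J; rewrite powersetE ffunE.
by have := xC J; case: (boolP (J \subset K)) => // /KG ->.
Qed.

(** The horizontal differential of the double complex, from cones with one ray more. *)
Definition row_diff (y : {set 'I_n} -> families) K : families :=
  \sum_(k | addable Delta K k) (incidence K k)%:~R *: restrict K (y (k |: K)%SET).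

(** The entry of the double complex at (m, j). A family is unconstrained at all other [K], so
    equalities of families are only stated for [at_level]. *)
Definition level m j (y : {set 'I_n} -> families) := forall K, K \in Delta ->
  interior_face K -> #|K| = m -> y K \in cochains ray (powerset K) B l j.

Definition at_level m K := [/\ K \in Delta, interior_face K & #|K| = m].

Lemma at_level_add m K k : at_level m K -> addable Delta K k ->
  at_level m.+1 (k |: K)%SET.
Proof.
move=> [KD iK cK] kK; have [kK' kD] := andP kK; split=> //.
  by apply: interior_centerS iK; rewrite ?finset.subsetUr.
by rewrite (card_addable kK) cK.
Qed.

Lemma row_diff_cochains m j y K : level m.+1 j y -> at_level m K ->
  row_diff y K \in cochains ray (powerset K) B l j.
Proof.
move=> ly aK; apply: rpred_sum => k kK; apply: rpredZ.
have [D1 i1 c1] := at_level_add aK kK.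
apply: (restrict_cochains (Gamma := powerset (k |: K)%SET)); last exact: ly.
by move=> J JK; rewrite powersetE (fintype.subset_trans JK) // finset.subsetUr.
Qed.

Lemma coboundary_row_diff y K :
  coboundary ray (powerset K) (row_diff y K) =
  row_diff (fun L => coboundary ray (powerset L) (y L)) K.
Proof.
rewrite linear_sum; apply: eq_bigr => k _; rewrite linearZ /=; congr (_ *: _).
apply: coboundary_restrict => J JK.
by rewrite powersetE (fintype.subset_trans JK) // finset.subsetUr.
Qed.

Lemma row_diff_row_diff y K : row_diff (row_diff y) K = 0.
Proof.
apply: etrans (@sum_addable2 _ _ DeltaS _ K (fun L => restrict K (y L))).
apply: eq_bigr => k kK; rewrite /row_diff linear_sum scaler_sumr.
apply: eq_bigr => k' _; rewrite [X in _ *: X]linearZ /= scalerA -intrM scaler_int.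
rewrite restrict_restrict //; exact: finset.subsetUr.
Qed.

Lemma eq_row_diff m y y' K : at_level m K ->
  (forall L, at_level m.+1 L -> y L = y' L) -> row_diff y K = row_diff y' K.
Proof.
move=> aK E; apply: eq_bigr => k kK; rewrite E //; exact: at_level_add kK.
Qed.

Lemma row_diff_scalar y K J (S : {set 'I_d}) : J \subset K ->
  row_diff y K J S = \sum_(k | addable Delta K k) y (k |: K)%SET J S *~ incidence K k.
Proof.
move=> JK; rewrite /row_diff !sum_ffunE; apply: eq_bigr => k _.
by rewrite !ffunE JK; apply: mulrzl.
Qed.

(** The values at a face [J] involve only the interior cones that contain [J], so the homotopy of
    [interior_exact_rat] applies face by face. It has scalar entries, and the new values are
    combinations of forms in the same [face_forms]. *)
Lemma row_exact m j y : (m < r)%N -> level m j y ->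
  (forall K, K \in Delta -> interior_face K -> #|K|.+1 = m -> row_diff y K = 0) ->
  exists2 x, level m.+1 j x & forall K, at_level m K -> row_diff x K = y K.
Proof.
move=> mr ly y0.
have [J|h hP] := @choice _ _ (fun (J : {set 'I_n}) (h : {set 'I_n} -> {set 'I_n} -> rat) =>
  J \in Delta -> forall w : {set 'I_n} -> rat,
    (forall L, inter a Delta J L -> #|L|.+1 = m ->
       \sum_(k | addable Delta L k) w (k |: L)%SET *~ incidence L k = 0) ->
    forall K, inter a Delta J K -> #|K| = m -> w K = \sum_(k | addable Delta K k)
      (\sum_(L | inter a Delta J L && (#|L| == m)) h L (k |: K)%SET * w L) *~ incidence K k).
  have [JD|_] := boolP (J \in Delta); last by exists (fun _ _ => 0).
  by have [h hP] := interior_exact_rat DeltaS carried_inj fanD chamber JD mr; exists h.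
exists (fun K => [ffun J : {set 'I_n} => if J \subset K then
  \sum_(L | inter a Delta J L && (#|L| == m)) h J L K *: y L J else 0]).
  move=> K KD iK cK; apply/cochainsP => J; rewrite powersetE ffunE.
  have [JK|//] := boolP (J \subset K); rewrite /=.
  have yL L : inter a Delta J L && (#|L| == m) ->
      if #|J| == j then is_true (y L J \in face_forms ray B l J) else y L J = 0.
    case/andP=> /interP[LD iL JL] /eqP cL.
    by have /cochainsP/(_ J) := ly L LD iL cL; rewrite powersetE JL.
  case: ifP => cJ.
    by apply: rpred_sum => L /yL; rewrite cJ => yLJ; apply: rpredZ.
  by apply: big1 => L /yL; rewrite cJ => ->; rewrite scaler0.
move=> K [KD iK cK]; apply/ffunP => J; apply/ffunP => S.
have [JK|JK] := boolP (J \subset K); last first.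
  have /cochainsP/(_ J) := ly K KD iK cK; rewrite powersetE (negbTE JK) /= => ->.
  by rewrite /row_diff !sum_ffunE big1 ?ffunE // => k _; rewrite !ffunE (negbTE JK) ffunE scaler0.
rewrite row_diff_scalar //; have JD := DeltaS KD JK.
rewrite (hP J JD (fun K => y K J S)) //; last by apply/interP.
  apply: eq_bigr => k _; rewrite ffunE (fintype.subset_trans JK) ?finset.subsetUr //.
  by rewrite !sum_ffunE; congr (_ *~ _); apply: eq_bigr => L _; rewrite ffunE.
move=> L /interP[LD iL JL] cL; rewrite -row_diff_scalar //.
by rewrite y0 // !ffunE.
Qed.

(** At the end of a row stand the cochains of the whole complex, mapped to chambers by restriction
    with the sign of the orientation. *)
Lemma top_exact j y : level r j y ->
  (forall K, K \in Delta -> interior_face K -> #|K|.+1 = r -> row_diff y K = 0) ->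
  exists2 x, x \in cochains ray Delta B l j &
    forall K, at_level r K -> y K = (orientation a K)%:~R *: restrict K x.
Proof.
move=> ly y0.
have [J|h hP] := @choice _ _ (fun (J : {set 'I_n}) (h : {set 'I_n} -> rat) =>
  J \in Delta -> forall w : {set 'I_n} -> rat,
    (forall L, inter a Delta J L -> #|L|.+1 = r ->
       \sum_(k | addable Delta L k) w (k |: L)%SET *~ incidence L k = 0) ->
    forall K, inter a Delta J K -> #|K| = r -> w K =
      (\sum_(L | inter a Delta J L && (#|L| == r)) h L * w L) *~ orientation a K).
  have [JD|_] := boolP (J \in Delta); last by exists (fun _ => 0).
  by have [h hP] := interior_exact_top DeltaS carried_inj fanD chamber JD; exists h.
exists [ffun J => if J \in Delta then
  \sum_(L | inter a Delta J L && (#|L| == r)) h J L *: y L J else 0].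
  apply/cochainsP => J; rewrite ffunE; have [JD|//] := boolP (J \in Delta); rewrite /=.
  have yL L : inter a Delta J L && (#|L| == r) ->
      if #|J| == j then is_true (y L J \in face_forms ray B l J) else y L J = 0.
    case/andP=> /interP[LD iL JL] /eqP cL.
    by have /cochainsP/(_ J) := ly L LD iL cL; rewrite powersetE JL.
  case: ifP => cJ.
    by apply: rpred_sum => L /yL; rewrite cJ => yLJ; apply: rpredZ.
  by apply: big1 => L /yL; rewrite cJ => ->; rewrite scaler0.
move=> K [KD iK cK]; apply/ffunP => J; apply/ffunP => S; rewrite !ffunE.
have [JK|JK] := boolP (J \subset K); last first.
  have /cochainsP/(_ J) := ly K KD iK cK; rewrite powersetE (negbTE JK) /= => ->.
  by rewrite ?(negbTE JK) !ffunE scaler0.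
have JD := DeltaS KD JK; rewrite JD (hP J JD (fun K => y K J S)) //; last by apply/interP.
  rewrite -mulrzl sum_ffunE; congr (_ * _); apply: eq_bigr => L _; by rewrite ffunE.
move=> L /interP[LD iL JL] cL; rewrite -row_diff_scalar //.
by rewrite y0 // !ffunE.
Qed.

Lemma level_kernel m u : (r < l + m)%N -> level m 0 u ->
  (forall K, at_level m K -> coboundary ray (powerset K) (u K) = 0) ->
  forall K, at_level m K -> u K = 0.
Proof.
move=> lt lu du K aK; have [KD iK cK] := aK.
apply: (simplex_kernel (indep KD) (lu K KD iK cK) (du K aK)).
by rewrite cK; move: dimB lt; set b := \dim B; lia.
Qed.

Lemma level_exact m j u : level m j.+1 u ->
  (forall K, at_level m K -> coboundary ray (powerset K) (u K) = 0) ->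
  exists2 w, level m j w &
    forall K, at_level m K -> u K = coboundary ray (powerset K) (w K).
Proof.
move=> lu du; have [K|w wP] := @choice _ _ (fun K (w : families) => at_level m K ->
    w \in cochains ray (powerset K) B l j /\ u K = coboundary ray (powerset K) w).
  case: (pselect (at_level m K)) => [aK|]; last by exists 0.
  have [KD iK cK] := aK.
  by have [w wC E] := simplex_exact (indep KD) (lu K KD iK cK) (du K aK); exists w.
exists w => [K KD iK cK|K aK]; first by have [] := wP K (And3 KD iK cK).
by have [] := wP K aK.
Qed.

Lemma levelB m j y y' : level m j y -> level m j y' -> level m j (fun K => y K - y' K).
Proof. by move=> ly ly' K KD iK cK; rewrite rpredB ?ly ?ly'. Qed.

Lemma row_diffB y y' K : row_diff (fun L => y L - y' L) K = row_diff y K - row_diff y' K.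
Proof.
by rewrite /row_diff -sumrB; apply: eq_bigr => k _; rewrite linearB scalerBr.
Qed.

(** Descent along a staircase. With [u] the coboundary of [w], the row differential of [w] is again
    closed in both directions, at [m - 1] and [j - 1], so the inequality is preserved. Its lift [v']
    corrects [w] to be row-closed, hence the row differential of some [x], whose coboundary is the
    lift of [u]. At [j = 0] the inequality makes [u] vanish by [level_kernel]. *)
Lemma row_closed_lift j m u : (m < r)%N -> (r + j < l + m)%N -> level m j u ->
  (forall K, at_level m K -> coboundary ray (powerset K) (u K) = 0) ->
  (forall K, K \in Delta -> interior_face K -> #|K|.+1 = m -> row_diff u K = 0) ->
  exists v, [/\ level m.+1 j v,
    forall K, at_level m.+1 K -> coboundary ray (powerset K) (v K) = 0
    & forall K, at_level m K -> row_diff v K = u K].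
Proof.
elim: j m u => [|j IHj] m u mr lt lu du ru.
  exists (fun=> 0); split=> [K _ _ _|K _|K aK]; [exact: mem0v|exact: linear0|].
  rewrite (level_kernel _ lu du aK); last by rewrite addn0 in lt.
  by rewrite /row_diff big1 // => k _; rewrite linear0 scaler0.
have [w lw uw] := level_exact lu du.
have [v' [lv' dv' rv']] : exists v', [/\ level m j v',
    forall K, at_level m K -> coboundary ray (powerset K) (v' K) = 0
    & forall K, K \in Delta -> interior_face K -> #|K|.+1 = m ->
        row_diff v' K = row_diff w K].
  case: m mr lt lu du ru lw uw => [|m] mr lt lu du ru lw uw.
    by exists (fun=> 0); split=> [K _ _ _|K _|K _ _ E]; [exact: mem0v|exact: linear0|discriminate E].
  have [|||K [KD iK cK]||v' [lv' dv' rv']] := IHj m (row_diff w).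
  - exact: ltnW.
  - by lia.
  - by move=> K KD iK cK; apply: row_diff_cochains lw _.
  - rewrite coboundary_row_diff -(@eq_row_diff m u) ?ru ?cK //.
  - by move=> K _ _ _; apply: row_diff_row_diff.
  exists v'; split; [exact: lv'|exact: dv'|move=> K KD iK [cK]].
  by apply: rv'; split.
have [K KD iK cK|x lx rx] := row_exact mr (levelB lw lv').
  by rewrite row_diffB rv' // subrr.
exists (fun K => coboundary ray (powerset K) (x K)); split=> [K KD iK cK|K aK|K aK].
- apply: coboundary_cochains; last exact: lx.
  exact: powS.
- by apply: coboundary_coboundary; apply: powS.
- by rewrite -coboundary_row_diff rx // linearB /= dv' // subr0 uw.
Qed.

(** Every cone is a face of a chamber, so restrictions to chambers determine a cochain. *)
Lemma restrict_eq0 (x : families) j : x \in cochains ray Delta B l j ->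
  (forall K, at_level r K -> restrict K x = 0) -> x = 0.
Proof.
move=> /cochainsP xC x0; apply/ffunP => J; rewrite [RHS]ffunE; have := xC J.
case: ifP => // /andP[JD _] _.
have [b nb] := exists_near1 carried_inj fanD chamber JD.
have [ib sb] := near1 nb; have [K KD bK] := interior_in ib.
have := congr1 (fun f : families => f J) (x0 K _); rewrite !ffunE (sb K KD bK); apply.
split=> //; first exact: interior_center bK ib.
exact: (near1_cone carried_inj nb KD bK).
Qed.

Lemma orientation_neq0 K : at_level r K -> (orientation a K)%:~R != 0 :> rat.
Proof.
by move=> [KD iK cK]; rewrite intr_eq0 sgz_eq0 (vol_chamber_neq0 carried_inj KD cK).
Qed.

(* The cochains restricted to the interior cones K form a double complex: for
   fixed K it is the Koszul complex of the simplex K, and in the direction of K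
   it is exact by interior_exact_rat. *)
Lemma ishida_vanishing k y : (k < l)%N -> y \in cochains ray Delta B l k ->
  coboundary ray Delta y = 0 ->
  if k is j.+1 then exists2 x, x \in cochains ray Delta B l j & y = coboundary ray Delta x
  else y = 0.
Proof.
move=> kl yC dy; pose u K := (orientation a K)%:~R *: restrict K y.
have inD K : K \in Delta -> forall J, J \subset K -> J \in Delta by move=> KD J; apply: DeltaS.
have lu : level r k u.
  by move=> K KD iK cK; apply/rpredZ/(restrict_cochains (inD K KD)).
have du K : at_level r K -> coboundary ray (powerset K) (u K) = 0.
  by move=> [KD _ _]; rewrite linearZ /= (coboundary_restrict _ (inD K KD)) dy linear0 scaler0.
case: k => [|j] in kl yC lu *.
  apply: (restrict_eq0 yC) => K aK; apply/eqP.
  have uK : u K = 0 by apply: (level_kernel _ lu du aK); lia.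
  by move/eqP: uK; rewrite scaler_eq0 (negbTE (orientation_neq0 aK)).
have [w lw uw] := level_exact lu du.
(* [w] need not agree along the walls; [row_closed_lift] gives a closed [v'] with the same
   disagreement, and [w - v'] comes from a cochain of [Delta]. *)
have [v' [lv' dv' rv']] : exists v', [/\ level r j v',
    forall K, at_level r K -> coboundary ray (powerset K) (v' K) = 0
    & forall K, K \in Delta -> interior_face K -> #|K|.+1 = r ->
        row_diff v' K = row_diff w K].
  have [r0|r0] := posnP r.
    exists (fun=> 0); split=> [K _ _ _|K _|K _ _]; [exact: mem0v|exact: linear0|].
    by rewrite r0 => E; discriminate E.
  have lev K : #|K| = r.-1 -> #|K|.+1 = r by move=> ->; rewrite prednK.
  have [|||K [KD iK cK]||v' [lv' dv' rv']] := @row_closed_lift j r.-1 (row_diff w).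
  - by rewrite prednK.
  - by lia.
  - by move=> K KD iK cK; apply: (@row_diff_cochains r.-1); rewrite ?prednK.
  - rewrite coboundary_row_diff.
    transitivity (row_diff u K).
      apply: (@eq_row_diff r.-1) => // L; rewrite prednK // => aL.
      by rewrite uw.
    (* All chambers at [K] restrict [y] to the same cochain on [K], so only the sum of orientations
       remains. *)
    transitivity ((\sum_(k | addable Delta K k)
        incidence K k * orientation a (k |: K)%SET)%:~R *: restrict K y).
      rewrite rmorph_sum scaler_suml; apply: eq_bigr => k _.
      rewrite linearZ scalerA -rmorphM; congr (_ *: _); apply/ffunP => J; rewrite !ffunE.
      by case: ifP => // JK; rewrite (fintype.subset_trans JK) // finset.subsetUr.
    rewrite (orientation_wall DeltaS carried_inj fanD chamber KD iK) ?scale0r //.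
    by rewrite cK prednK.
  - by move=> K _ _ _; apply: row_diff_row_diff.
  rewrite prednK // in lv' dv'.
  exists v'; split; [exact: lv'|exact: dv'|move=> K KD iK cK].
  by apply: rv'; split; rewrite // -cK.
have [K KD iK cK|x xC xP] := top_exact (levelB lw lv').
  by rewrite row_diffB rv' // subrr.
exists x => //; apply/eqP; rewrite -subr_eq0; apply/eqP.
apply: (restrict_eq0 (j := j.+1)) => [|K aK].
  by rewrite rpredB // coboundary_cochains.
have [KD iK cK] := aK.
apply: (scalerI (orientation_neq0 aK)); rewrite scaler0 linearB /= scalerBr -/(u K).
rewrite -(coboundary_restrict _ (inD K KD)) -linearZ -xP // linearB /= dv' // subr0.
by rewrite -uw // subrr.
Qed.

End Vanishing.

(** * Dimension of the cohomology *)

Section Dimensions.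
Variables (d n : nat) (ray : 'I_n -> 'rV[rat]_d) (Delta : {set {set 'I_n}}).
Implicit Types (J K : {set 'I_n}) (B : {vspace 'rV[rat]_d}).
Local Notation families := {ffun {set 'I_n} -> ext d}.
Local Notation cob := (coboundary ray Delta).
Local Notation C := (cochains ray Delta).

Hypothesis DeltaS : forall J J', J \in Delta -> J' \subset J -> J' \in Delta.

Definition abs_cocycles B l k : {vspace families} := (C B l k :&: lker cob)%VS.

Definition abs_coboundaries B l k : {vspace families} :=
  if k is j.+1 then (cob @: C B l j)%VS else 0%VS.

Definition hdim B l k := (\dim (abs_cocycles B l k) - \dim (abs_coboundaries B l k))%N.

Lemma abs_cocyclesP B l k (x : families) :
  x \in abs_cocycles B l k <-> x \in C B l k /\ cob x = 0.
Proof.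
rewrite memv_cap memv_ker; split=> [/andP[xC /eqP dx]|[xC dx]] //.
by rewrite xC dx eqxx.
Qed.

Lemma coboundaries_sub B l k : (abs_coboundaries B l k <= abs_cocycles B l k)%VS.
Proof.
case: k => [|j] /=; first exact: sub0v.
apply/subvP => _ /memv_imgP[x xC ->]; apply/abs_cocyclesP; split.
  exact: coboundary_cochains.
exact: coboundary_coboundary.
Qed.

Lemma ext_degS l j (w : ext d) : ext_deg l.+1 j.+1 w <-> ext_deg l j w.
Proof. by split=> dw S; have := dw S; rewrite addnS eqSS. Qed.

Lemma killedSS (U : {vspace 'rV[rat]_d}) l j : killed U l.+1 j.+1 = killed U l j.
Proof.
apply/vspaceP => w; apply/idP/idP => /killedP[dw kw]; apply/killedP; split=> //;
  exact/ext_degS.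
Qed.

Lemma killed0S (U : {vspace 'rV[rat]_d}) j : killed U 0 j.+1 = 0%VS.
Proof.
apply/eqP; rewrite -subv0; apply/subvP => w /killedP[dw _].
by rewrite (ext_deg_eq0 _ dw) ?mem0v.
Qed.

Lemma dim_killed_diag (U : {vspace 'rV[rat]_d}) k : \dim (killed U k k) = 1%N.
Proof.
have -> : killed U k k = <[ext1 d]>%VS; last by rewrite dim_vline ext1_neq0.
apply/eqP; rewrite eqEsubv -memvE ext1_killed andbT; apply/subvP => w /killedP[dw _].
apply/vlineP; exists (w finset.set0); apply/ffunP => S; rewrite !ffunE.
have [->|nS] := eqVneq S finset.set0; first by rewrite [RHS]mulr1.
rewrite [RHS]mulr0 dw //; apply: contra nS.
by rewrite -[X in _ == X]add0n eqn_add2r cards_eq0.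
Qed.

Lemma cochains_deg B l k (x : families) J : x \in C B l k -> ext_deg l k (x J).
Proof.
move=> /cochainsP/(_ J); case: ifP => [/andP[_ /eqP <-] /face_formsP[]//|_ ->].
exact: ext_deg0.
Qed.

Lemma cochains_eq0 B l k : (l < k)%N -> C B l k = 0%VS.
Proof.
move=> lk; apply/eqP; rewrite -subv0; apply/subvP => x xC; rewrite memv0.
apply/eqP/ffunP => J; rewrite [RHS]ffunE.
exact: ext_deg_eq0 lk (cochains_deg J xC).
Qed.

Lemma cochainsE B l k (x : families) : x \in C B l k <->
  (forall J, ext_deg l k (x J)) /\
  (forall J, [/\ ~~ ((J \in Delta) && (#|J| == k)) -> x J = 0,
     forall b, b \in B -> contract b (x J) = 0 &
     forall i, i \in J -> contract (ray i) (x J) = 0]).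
Proof.
split=> [xC|[xd xP]].
  split=> J; first exact: cochains_deg xC.
  have /cochainsP/(_ J) := xC; case: ifP => [_ /face_formsP[_ xB xJ]//|_ ->].
  by split=> [//|b _|i _]; rewrite linear0.
apply/cochainsP => J; have [x0 xB xJ] := xP J.
case: ifP => [/andP[_ /eqP cJ]|nJ]; last by rewrite x0 ?nJ.
by apply/face_formsP; rewrite cJ; split.
Qed.

Definition single J (w : ext d) : families := [ffun K => if K == J then w else 0].

Lemma single_cochains l J w : J \in Delta -> w \in face_forms ray 0%VS l J ->
  single J w \in C 0%VS l #|J|.
Proof.
move=> JD wJ; apply/cochainsP => K; rewrite ffunE.
have [->|KJ] := eqVneq K J; first by rewrite JD eqxx.
by case: ifP => // _; rewrite mem0v.
Qed.

(** * Adding one vector to B *)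

Section Add.
Variables (B : {vspace 'rV[rat]_d}) (t f : 'rV[rat]_d).
Hypothesis tB : forall x, x \in B -> pairing t x = 0.
Hypothesis tray : forall i, pairing t (ray i) = 0.
Hypothesis tf : pairing t f = 1.
Local Notation B' := (B + <[f]>)%VS.

Definition contract_fam_fun (x : families) : families := [ffun J => contract f (x J)].
Definition wedge_fam_fun (x : families) : families := [ffun J => wedge1 t (x J)].

Lemma contract_fam_is_linear : linear contract_fam_fun.
Proof. by move=> c x y; apply/ffunP => J; rewrite !ffunE linearP. Qed.

Lemma wedge_fam_is_linear : linear wedge_fam_fun.
Proof. by move=> c x y; apply/ffunP => J; rewrite !ffunE linearP. Qed.

HB.instance Definition _ := GRing.isLinear.Build rat families families *:%R
  contract_fam_fun contract_fam_is_linear.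
HB.instance Definition _ := GRing.isLinear.Build rat families families *:%R
  wedge_fam_fun wedge_fam_is_linear.

Local Notation F := (linfun contract_fam_fun).
Local Notation T := (linfun wedge_fam_fun).

Lemma contract_famE x J : F x J = contract f (x J). Proof. by rewrite lfunE ffunE. Qed.
Lemma wedge_famE x J : T x J = wedge1 t (x J). Proof. by rewrite lfunE ffunE. Qed.

Lemma contract_fam_cob x : F (cob x) = - cob (F x).
Proof.
apply/ffunP => J; rewrite contract_famE [RHS]ffunE !coboundaryE.
case: ifP => _; last by rewrite linear0 oppr0.
rewrite linear_sum -sumrN; apply: eq_bigr => i _ /=.
by rewrite contractC contract_famE.
Qed.

Lemma wedge_fam_cob x : T (cob x) = - cob (T x).
Proof.
apply/ffunP => J; rewrite wedge_famE [RHS]ffunE !coboundaryE.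
case: ifP => _; last by rewrite linear0 oppr0.
rewrite linear_sum -sumrN; apply: eq_bigr => i _ /=.
by rewrite wedge_famE contract_wedge1 tray scale0r sub0r opprK.
Qed.

Lemma fam_split x : F (T x) + T (F x) = x.
Proof.
apply/ffunP => J; rewrite ffunE contract_famE !wedge_famE contract_famE.
by rewrite -wedge_contract_split.
Qed.

Lemma cochains_add l k x : x \in C B' l k <-> x \in C B l k /\ F x = 0.
Proof.
split=> [/cochainsE[xd xP]|[/cochainsE[xd xP] Fx]].
  split; last first.
    apply/ffunP => J; rewrite contract_famE [RHS]ffunE; have [_ xB _] := xP J.
    exact/xB/(subvP (addvSr _ _))/memv_line.
  apply/cochainsE; split=> // J; have [x0 xB xJ] := xP J; split=> // b bB.
  exact/xB/(subvP (addvSl _ _)).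
apply/cochainsE; split=> // J; have [x0 xB xJ] := xP J; split=> //.
move=> _ /memv_addP[b bB [_ /vlineP[c ->] ->]]; rewrite addrC contractDl (xB b) // addr0.
have := congr1 (fun g : families => g J) Fx; rewrite contract_famE => ->.
by rewrite ffunE scaler0.
Qed.

Lemma contract_fam_cochains l k x : x \in C B l.+1 k -> F x \in C B' l k.
Proof.
move=> /cochainsE[xd xP]; apply/cochains_add; split; last first.
  by apply/ffunP => J; rewrite !contract_famE contract_contract ffunE.
apply/cochainsE; split=> J.
  by rewrite contract_famE; apply/ext_degS/ext_deg_contract/xd.
have [x0 xB xJ] := xP J; rewrite contract_famE; split=> [/x0 ->|b /xB E|i /xJ E].
- by rewrite linear0.
- by rewrite contractC E linear0 oppr0.
- by rewrite contractC E linear0 oppr0.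
Qed.

Lemma wedge_fam_cochains l k x : x \in C B l k -> T x \in C B l.+1 k.
Proof.
move=> /cochainsE[xd xP]; apply/cochainsE; split=> J.
  by rewrite wedge_famE; apply/ext_deg_wedge1l/xd.
have [x0 xB xJ] := xP J; rewrite wedge_famE; split=> [/x0 ->|b bB|i iJ].
- by rewrite linear0.
- by rewrite contract_wedge1 tB // xB // linear0 scale0r subrr.
- by rewrite contract_wedge1 tray xJ // linear0 scale0r subrr.
Qed.

(** Pascal's rule for families: contraction by [f] has the cocycles for [B'] as kernel and those of
    form degree one less as image. Preimages come from [wedge1 t], which anticommutes with the
    coboundary because [t] vanishes on the rays. *)
Lemma dim_cocycles_add l k : \dim (abs_cocycles B l.+1 k) =
  (\dim (abs_cocycles B' l.+1 k) + \dim (abs_cocycles B' l k))%N.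
Proof.
rewrite -(limg_ker_dim F (abs_cocycles B l.+1 k)).
congr (_ + _)%N; congr (\dim _); apply/vspaceP => x.
  rewrite memv_cap memv_ker; apply/andP/idP => [[/abs_cocyclesP[xC dx] /eqP Fx]|].
    by apply/abs_cocyclesP; split=> //; apply/cochains_add.
  by move/abs_cocyclesP => [/cochains_add[xC ->] dx]; split=> //; apply/abs_cocyclesP.
apply/memv_imgP/idP => [[u /abs_cocyclesP[uC du] ->]|/abs_cocyclesP[xC dx]].
  apply/abs_cocyclesP; split; first exact: contract_fam_cochains.
  by apply/eqP; rewrite -oppr_eq0 -contract_fam_cob du linear0.
have [xC' Fx] := (cochains_add _ _ _).1 xC.
exists (T x); last by rewrite -{1}[x]fam_split Fx linear0 addr0.
apply/abs_cocyclesP; split; first exact: wedge_fam_cochains.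
by apply/eqP; rewrite -oppr_eq0 -wedge_fam_cob dx linear0.
Qed.

Lemma dim_coboundaries_add l k : \dim (abs_coboundaries B l.+1 k) =
  (\dim (abs_coboundaries B' l.+1 k) + \dim (abs_coboundaries B' l k))%N.
Proof.
case: k => [|k] /=; first by rewrite dimv0.
rewrite -(limg_ker_dim F (cob @: C B l.+1 k)).
congr (_ + _)%N; congr (\dim _); apply/vspaceP => x.
  rewrite memv_cap memv_ker; apply/andP/memv_imgP => [[/memv_imgP[u uC xE] /eqP Fx]|].
    exists (F (T u)); first by apply/contract_fam_cochains/wedge_fam_cochains.
    rewrite -{1}[x]fam_split Fx linear0 addr0 xE wedge_fam_cob linearN /=.
    by rewrite contract_fam_cob opprK.
  move=> [u /cochains_add[uC Fu] ->]; split; first exact: memv_img.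
  by rewrite contract_fam_cob Fu linear0 oppr0.
apply/memv_imgP/memv_imgP => [[_ /memv_imgP[u uC ->] ->]|[u uC ->]].
  exists (- F u); first by rewrite rpredN contract_fam_cochains.
  by rewrite contract_fam_cob linearN.
have [uC' Fu] := (cochains_add _ _ _).1 uC.
exists (cob (- T u)).
  by apply/memv_img; rewrite rpredN wedge_fam_cochains.
rewrite linearN /= -wedge_fam_cob -{1}[cob u]fam_split contract_fam_cob Fu.
by rewrite linear0 oppr0 linear0 addr0.
Qed.

Lemma hdim_addS l k : hdim B l.+1 k = (hdim B' l.+1 k + hdim B' l k)%N.
Proof.
rewrite /hdim dim_cocycles_add dim_coboundaries_add.
have := dimvS (coboundaries_sub B' l.+1 k); have := dimvS (coboundaries_sub B' l k).
by lia.
Qed.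

(** For [l = 0] only scalars occur, and every vector contracts them to 0. *)
Lemma hdim_add0 k : hdim B 0 k = hdim B' 0 k.
Proof.
have CE j : C B 0 j = C B' 0 j.
  apply/vspaceP => x; apply/idP/idP => [xC|/cochains_add[]//].
  apply/cochains_add; split=> //; apply/ffunP => J; rewrite contract_famE [RHS]ffunE.
  by apply: (@ext_deg_eq0 _ 0 j.+1) => //; apply/ext_deg_contract/cochains_deg/xC.
by rewrite /hdim /abs_cocycles /abs_coboundaries CE; case: k => // k; rewrite CE.
Qed.

End Add.
End Dimensions.

Section DimensionFormula.
Variables (R : realFieldType) (d r n : nat) (a : 'I_n -> 'rV[R]_r).
Variables (Delta : {set {set 'I_n}}) (ray : 'I_n -> 'rV[rat]_d).
Implicit Types (J K : {set 'I_n}) (B : {vspace 'rV[rat]_d}).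

Hypothesis DeltaS : forall J J', J \in Delta -> J' \subset J -> J' \in Delta.
Hypothesis carried_inj : forall J J' c c', J \in Delta -> J' \in Delta ->
  carried J c -> carried J' c' -> comb a c = comb a c' -> c =1 c'.
Hypothesis fanD : forall x y,
  in_fan a Delta x -> in_fan a Delta y -> in_fan a Delta (x + y).
Hypothesis chamber : exists2 J, J \in Delta & #|J| = r.

Definition span_rays : {vspace 'rV[rat]_d} := <<[seq ray i | i <- enum 'I_n]>>%VS.

Hypothesis free_ray : forall K, K \in Delta ->
  \dim <<[seq ray i | i <- enum K]>> = #|K|.
Hypothesis dim_rays : \dim span_rays = r.

(* Induction on the codimension of B + span_rays: contraction by a new vector f
   and multiplication by a dual form split both sides in the same way. In
   codimension 0 the cohomology vanishes for k < l. *)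
Lemma hdim_formula B l k : \dim (B + span_rays) = (\dim B + r)%N ->
  hdim ray Delta B l k =
  (hdim ray Delta B k k * \dim (killed (B + span_rays)%VS l k))%N.
Proof.
move=> dB; have [m] := ubnP (d - (\dim B + r)); elim: m B dB l => // m IHm B dB l leB.
have led : (\dim B + r <= d)%N.
  by rewrite -dB (leq_trans (dimvS (subvf _))) // dimvf /dim /= mul1n.
have [E|ne] := eqVneq (\dim B + r)%N d.
  have [lk|kl|->] := ltngtP l k; last by rewrite dim_killed_diag muln1.
    have d0 : \dim (killed (B + span_rays) l k) = 0%N.
      apply/eqP; rewrite dimv_eq0 -subv0; apply/subvP => w /killedP[dw _].
      by rewrite (ext_deg_eq0 lk dw) mem0v.
    by rewrite d0 muln0 /hdim /abs_cocycles cochains_eq0 // cap0v dimv0.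
  (* Here [B] is a complement of the span of the rays, and both sides are 0: there are no nonzero
     forms of degree [l - k > 0] killed by the whole space. *)
  rewrite killed_eq0 ?dimv0 ?muln0; last by rewrite dB E addnC ltn_add2r.
  have indep K : K \in Delta -> \dim (span_face ray B K) = (\dim B + #|K|)%N.
    move=> KD; rewrite dimv_disjoint_sum ?free_ray //.
    have : (B :&: span_rays <= 0)%VS.
      by have /leqifP := dimv_add_leqif B span_rays; case: ifP => //; rewrite dB dim_rays ltnn.
    rewrite subv0 => /eqP BS; apply/eqP; rewrite -subv0 -BS capvS //.
    apply/span_subvP => _ /mapP[i _ ->]; apply/memv_span/map_f; exact: mem_enum.
  apply/eqP; rewrite /hdim subn_eq0; apply/dimvS/subvP => y /abs_cocyclesP[yC dy].
  have := ishida_vanishing DeltaS carried_inj fanD chamber indep E kl yC dy.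
  clear IHm; case: k kl yC => [|k] kl yC /=; first by move=> ->; rewrite mem0v.
  by case=> x xC ->; apply: memv_img.
have lt : (\dim (B + span_rays) < d)%N by rewrite dB ltn_neqAle ne.
have [t [f [tU tf]]] := exists_dual lt.
have tB x : x \in B -> pairing t x = 0 by move=> xB; apply/tU/(subvP (addvSl _ _)).
have tray i : pairing t (ray i) = 0.
  by apply/tU/(subvP (addvSr _ _))/memv_span/map_f/mem_enum.
have UE : (B + <[f]> + span_rays = B + span_rays + <[f]>)%VS by rewrite -!addvA [(<[f]> + _)%VS]addvC.
have dB' : \dim (B + <[f]> + span_rays) = (\dim (B + <[f]>) + r)%N.
  by rewrite UE (dim_add_dual tU tf) dB (dim_add_dual tB tf).
have IH l' : hdim ray Delta (B + <[f]>)%VS l' k =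
    (hdim ray Delta (B + <[f]>)%VS k k * \dim (killed (B + span_rays + <[f]>)%VS l' k))%N.
  by rewrite IHm // ?UE // (dim_add_dual tB tf); lia.
have H l' : hdim ray Delta B l' k =
    (hdim ray Delta (B + <[f]>)%VS k k * \dim (killed (B + span_rays)%VS l' k))%N.
  case: l' => [|l'].
    rewrite (hdim_add0 ray Delta B f) IH (dim_killed_add tU tf 0).
    by rewrite killed0S dimv0 addn0.
  have -> := hdim_addS DeltaS tB tray tf l' k.
  rewrite IH (IH l') -mulnDr; congr (_ * _)%N.
  by have -> := dim_killed_add tU tf l'.+1 k; rewrite killedSS.
(* The case [l' = k] of [H] shows that adding [f] does not change [hdim] at (k, k). *)
by rewrite H [in RHS]H dim_killed_diag muln1.
Qed.

End DimensionFormula.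

(** * The Chow ring *)

Section Monomials.
Variable n : nat.
Implicit Types (m b : 'X_{1..n}) (J : {set 'I_n}) (i j : 'I_n).

Definition supp m : {set 'I_n} := [set i | m i != 0%N]%SET.

Definition sqfree J : 'X_{1..n} := [multinom (i \in J : nat) | i < n].

Lemma sqfreeE J i : sqfree J i = (i \in J).
Proof. by rewrite mnmE. Qed.

Lemma supp_sqfree J : supp (sqfree J) = J.
Proof. by apply/setP => i; rewrite inE sqfreeE; case: (i \in J). Qed.

Lemma mdeg_sqfree J : mdeg (sqfree J) = #|J|.
Proof.
rewrite mdegE -sum1_card [RHS]big_mkcond; apply: eq_bigr => i _.
by rewrite sqfreeE; case: (i \in J).
Qed.

Lemma supp_add1 m i : supp (m + U_(i))%MM = (i |: supp m)%SET.
Proof.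
by apply/setP => j; rewrite !inE mnmDE mnm1E addn_eq0 negb_and orbC [j == i]eq_sym; case: (i == j).
Qed.

Lemma suppS m b : supp m \subset supp (b + m)%MM.
Proof.
apply/fintype.subsetP => i; rewrite !inE mnmDE addn_eq0 negb_and => ->.
by rewrite orbT.
Qed.

Lemma mulXE J : \prod_(i in J) 'X_i = 'X_[sqfree J] :> {mpoly rat[n]}.
Proof.
rewrite mprodXE; congr 'X_[_]; apply/mnmP => i; rewrite sqfreeE mnm_sumE.
rewrite big_mkcond (bigD1 i) //= big1 ?addn0 => [|j /negbTE ji].
  by rewrite mnm1E eqxx; case: (i \in J).
by rewrite mnm1E ji; case: ifP.
Qed.

Lemma sqfree_supp m : (forall i, (m i <= 1)%N) -> m = sqfree (supp m).
Proof.
move=> m1; apply/mnmP => i; rewrite sqfreeE inE; have := m1 i.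
by case: (m i) => [|[|]].
Qed.

Lemma supp_sub1 m i : (1 < m i)%N -> supp (m - U_(i))%MM = supp m.
Proof.
move=> mi; apply/setP => j; rewrite !inE mnmBE mnm1E.
case: (eqVneq i j) => [<-|_] /=; last by rewrite subn0.
by move: mi; case: (m i) => [|[|]].
Qed.

Lemma mdeg_sub1 m i : (0 < m i)%N -> (mdeg (m - U_(i))%MM).+1 = mdeg m.
Proof.
move=> mi; rewrite -addn1 -(mdeg1 i) -mdegD; congr mdeg; apply/mnmP => j.
rewrite mnmDE mnmBE mnm1E; case: (eqVneq i j) => [<-|_] /=; last by rewrite subn0 addn0.
by rewrite subnK.
Qed.

Lemma sub1_add1 m i : (0 < m i)%N -> (m - U_(i) + U_(i))%MM = m.
Proof.
move=> mi; apply/mnmP => j.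
rewrite mnmDE mnmBE mnm1E; case: (eqVneq i j) => [<-|_] /=; last by rewrite subn0 addn0.
by rewrite subnK.
Qed.

Lemma add1_add1C m i j : (m + U_(i) + U_(j))%MM = (m + U_(j) + U_(i))%MM.
Proof. by apply/mnmP => k; rewrite !mnmDE addnAC. Qed.

Lemma add1K m i : (m + U_(i) - U_(i))%MM = m.
Proof. by apply/mnmP => k; rewrite mnmBE mnmDE addnK. Qed.

End Monomials.

Lemma card_set_le n (A : {set 'I_n}) : (#|A| <= n)%N.
Proof. by rewrite -[leqRHS]card_ord max_card. Qed.

(** * Functionals on monomials from balanced weights *)

Section Weights.
Variables (d n : nat) (ray : 'I_n -> 'rV[rat]_d) (Delta : {set {set 'I_n}}).
Implicit Types (J L : {set 'I_n}) (a b : 'X_{1..n}) (m : 'rV[rat]_d).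
Hypothesis DeltaS : forall J J', J \in Delta -> J' \subset J -> J' \in Delta.
Variable form : {set 'I_n} -> 'I_n -> 'rV[rat]_d.
Hypothesis formP : forall J i k, J \in Delta -> i \in J -> k \in J ->
  pairing (form J i) (ray k) = (k == i)%:R.

Variables (k : nat) (c : {set 'I_n} -> rat).
Hypothesis balanced : forall L m, L \in Delta -> #|L|.+1 = k ->
  (forall i, i \in L -> pairing m (ray i) = 0) ->
  \sum_(j | addable Delta L j) pairing m (ray j) * c (j |: L)%SET = 0.

(* The linear relation dual to a vertex i of the support expresses a monomial
   with exponent at least 2 at i by monomials of larger support. *)
Fixpoint weight (N : nat) a : rat :=
  if supp a \notin Delta then 0 else
  if [pick i | (1 < a i)%N] is Some i then
    if N is N'.+1 then - \sum_(j | j \notin supp a)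
      pairing (form (supp a) i) (ray j) * weight N' (a - U_(i) + U_(j))%MM
    else 0
  else c (supp a).

Lemma supp_exchange a i j : (1 < a i)%N -> supp (a - U_(i) + U_(j))%MM = (j |: supp a)%SET.
Proof. by move=> ai; rewrite supp_add1 supp_sub1. Qed.

(** Each call enlarges the support. When the fuel is used up, no vertex is left outside the support,
    so the default 0 agrees with the empty sum. *)
Lemma weight_stable N N' a : (n <= N + #|supp a|)%N -> (n <= N' + #|supp a|)%N ->
  weight N a = weight N' a.
Proof.
elim: N N' a => [|N IHN] N' a leN leN' /=; case: N' leN' => [//|N'] leN' /=.
- case: ifP => // _; case: pickP => // i ai.
  rewrite big1 ?oppr0 // => j jS; exfalso.
  have := card_set_le (j |: supp a)%SET; rewrite cardsU1 jS add1n.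
  by move: leN; rewrite add0n; lia.
- case: ifP => // _; case: pickP => // i ai.
  rewrite big1 ?oppr0 // => j jS; exfalso.
  have := card_set_le (j |: supp a)%SET; rewrite cardsU1 jS add1n.
  by move: leN'; rewrite add0n; lia.
case: ifP => // _; case: pickP => // i ai; congr (- _).
apply: eq_bigr => j jS; congr (_ * _).
by apply: IHN; rewrite supp_exchange // cardsU1 jS add1n; lia.
Qed.

Definition wt := weight n.

Lemma wt_notin a : supp a \notin Delta -> wt a = 0.
Proof. by rewrite /wt => aD; case: n => /= [|?]; rewrite aD. Qed.

Lemma wt_sqfree J : J \in Delta -> wt (sqfree J) = c J.
Proof.
move=> JD; rewrite /wt; have nopick : [pick i | (1 < sqfree J i)%N] = None.
  by case: pickP => // i; rewrite sqfreeE; case: (i \in J).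
by case: {1}n => /= [|?]; rewrite nopick supp_sqfree JD.
Qed.

Lemma wt_step a : supp a \in Delta -> (exists i, (1 < a i)%N) ->
  exists2 i, (1 < a i)%N & wt a = - \sum_(j | j \notin supp a)
      pairing (form (supp a) i) (ray j) * wt (a - U_(i) + U_(j))%MM.
Proof.
move=> aD [i0 ai0]; have E : wt a = weight n.+1 a.
  by apply: weight_stable; rewrite ?leq_addr // addSn leqW // leq_addr.
rewrite E /= aD /=; case: pickP => [i ai|/(_ i0)]; last by rewrite ai0.
by exists i.
Qed.

(** The functional [wt] evaluated on the linear relation of [m] times the monomial of [b]. *)
Definition relation_wt m b := \sum_j pairing m (ray j) * wt (b + U_(j))%MM.

Lemma relation_wt_form J i b : J \in Delta -> i \in J ->
  relation_wt (form J i) b = wt (b + U_(i))%MM +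
    \sum_(j | j \notin J) pairing (form J i) (ray j) * wt (b + U_(j))%MM.
Proof.
move=> JD iJ; rewrite /relation_wt (bigID (mem J)) /=; congr (_ + _).
rewrite (bigD1 i) //= formP // eqxx mul1r big1 ?addr0 // => j /andP[jJ /negbTE ji].
by rewrite formP // ji mul0r.
Qed.

Lemma relation_wt_perp J m b : (forall i, i \in J -> pairing m (ray i) = 0) ->
  relation_wt m b = \sum_(j | j \notin J) pairing m (ray j) * wt (b + U_(j))%MM.
Proof.
move=> mJ; rewrite /relation_wt (bigID (mem J)) /= big1 ?add0r // => j /mJ ->.
by rewrite mul0r.
Qed.

(** Descending induction on the support [J] of [b]. For a form dual to a ray of [J] the identity is
    the recursion defining [wt], once that is independent of the vertex picked there. For a form
    vanishing on [J] it is [balanced] if [b] is squarefree; otherwise a double exponent of [b] is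
    expanded and the identity follows from larger supports by exchanging sums. *)
Lemma relation_wt0 m b : (mdeg b).+1 = k -> relation_wt m b = 0.
Proof.
have [N] := ubnP (n - #|supp b|); elim: N b m => // N IH b m; rewrite ltnS => leN bk.
have [bD|bD] := boolP (supp b \in Delta); last first.
  rewrite /relation_wt big1 // => j _; rewrite wt_notin ?mulr0 // supp_add1.
  by apply: contra bD => /DeltaS; apply; rewrite finset.subsetUr.
have [J Jb] : exists J, supp b = J by exists (supp b).
rewrite Jb in bD leN.
have bigger b' j : supp b' = J -> j \notin J -> (mdeg b').+2 = k ->
    forall m', relation_wt m' (b' + U_(j))%MM = 0.
  move=> sb jJ dk m'; apply: IH; last by rewrite mdegD mdeg1 addn1.
  have := card_set_le (j |: J)%SET; rewrite supp_add1 sb cardsU1 jJ add1n.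
  by move: leN; lia.
(* Independence of the picked vertex: with the relations at larger support, both expansions become a
   double sum that is unchanged when [p] and [q] are interchanged. *)
have symm a p q : supp a = J -> mdeg a = k -> (1 < a p)%N -> (1 < a q)%N ->
    \sum_(j | j \notin J) pairing (form J p) (ray j) * wt (a - U_(p) + U_(j))%MM =
    \sum_(j | j \notin J) pairing (form J q) (ray j) * wt (a - U_(q) + U_(j))%MM.
  move=> sa ak ap aq; have [->//|pq] := eqVneq p q.
  pose b' := (a - U_(p) - U_(q))%MM.
  have aq' : (1 < (a - U_(p))%MM q)%N by rewrite mnmBE mnm1E (negbTE pq) subn0.
  have sb' : supp b' = J by rewrite !supp_sub1.
  have bq : (a - U_(p))%MM = (b' + U_(q))%MM by rewrite sub1_add1 // ltnW.
  have bp : (a - U_(q))%MM = (b' + U_(p))%MM.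
    apply/mnmP => i; rewrite /b' !(mnmDE, mnmBE, mnm1E).
    case: (eqVneq p i) => [<-|_] /=; last by rewrite subn0 addn0.
    by rewrite eq_sym (negbTE pq) /= !subn0 subnK // ltnW.
  have db' : (mdeg b').+2 = k by rewrite -ak -(mdeg_sub1 (ltnW ap)) bq mdegD mdeg1 addn1.
  have inJ i : (1 < a i)%N -> i \in J by move=> ai; rewrite -sa inE; lia.
  have H p' q' : q' \in J -> \sum_(j | j \notin J) pairing (form J p') (ray j) *
      wt (b' + U_(q') + U_(j))%MM = - \sum_(j | j \notin J) \sum_(h | h \notin J)
      pairing (form J p') (ray j) * pairing (form J q') (ray h) * wt (b' + U_(j) + U_(h))%MM.
    move=> qJ; rewrite -sumrN; apply: eq_bigr => j jJ.
    have /eqP := bigger b' j sb' jJ db' (form J q').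
    rewrite (relation_wt_form _ bD qJ) addr_eq0 add1_add1C => /eqP ->.
    rewrite mulrN mulr_sumr; congr (- _); apply: eq_bigr => h _; exact: mulrA.
  rewrite bq bp !H ?inJ // exchange_big; congr (- _); apply: eq_bigr => j _.
  apply: eq_bigr => h _; rewrite add1_add1C; congr (_ * _); exact: mulrC.
have R_form i : i \in J -> relation_wt (form J i) b = 0.
  move=> iJ; rewrite (relation_wt_form _ bD iJ); set a := (b + U_(i))%MM.
  have sa : supp a = J.
    by rewrite supp_add1 Jb; apply/finset.setUidPr; rewrite finset.sub1set.
  have ai : (1 < a i)%N.
    by rewrite mnmDE mnm1E eqxx; move: iJ; rewrite -Jb inE; lia.
  have [|q aq ->] := @wt_step a _ (ex_intro _ i ai); first by rewrite sa.
  rewrite sa (symm a q i) //; last by rewrite mdegD mdeg1 addn1.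
  by rewrite /a add1K addNr.
have R_perp m' : (forall i, i \in J -> pairing m' (ray i) = 0) -> relation_wt m' b = 0.
  move=> m'J; rewrite (relation_wt_perp _ m'J).
  have [/existsP[i bi]|sq] := boolP [exists i, (1 < b i)%N].
    have iJ : i \in J by rewrite -Jb inE; move: bi; case: (b i).
    pose b' := (b - U_(i))%MM; have sb' : supp b' = J by rewrite supp_sub1 // Jb.
    have bE : b = (b' + U_(i))%MM by rewrite sub1_add1 // ltnW.
    have db' : (mdeg b').+2 = k by rewrite -bk bE mdegD mdeg1 addn1.
    transitivity (- \sum_(j | j \notin J) \sum_(h | h \notin J)
      pairing m' (ray j) * (pairing (form J i) (ray h) * wt (b' + U_(j) + U_(h))%MM)).
      rewrite -sumrN; apply: eq_bigr => j jJ.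
      have /eqP := bigger b' j sb' jJ db' (form J i).
      rewrite (relation_wt_form _ bD iJ) addr_eq0 add1_add1C -bE => /eqP ->.
      by rewrite mulrN mulr_sumr.
    rewrite exchange_big /= big1 ?oppr0 // => h hJ.
    have := bigger b' h sb' hJ db' m'; rewrite (relation_wt_perp _ m'J) => E.
    transitivity (pairing (form J i) (ray h) * \sum_(j | j \notin J)
      pairing m' (ray j) * wt (b' + U_(h) + U_(j))%MM); last by rewrite E mulr0.
    by rewrite mulr_sumr; apply: eq_bigr => j _; rewrite mulrCA add1_add1C.
  have bJ : b = sqfree J.
    by rewrite -Jb; apply: sqfree_supp => i; move: sq; rewrite negb_exists => /forallP/(_ i); rewrite -leqNgt.
  have cJ : #|J|.+1 = k by rewrite -bk -(mdeg_sqfree J) -bJ.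
  apply: etrans (balanced bD cJ m'J); rewrite big_mkcond [RHS]big_mkcond; apply: eq_bigr => j _.
  have sj : j \notin J -> (b + U_(j))%MM = sqfree (j |: J)%SET.
    move=> jJ; rewrite {1}bJ; apply/mnmP => i; rewrite mnmDE mnm1E !sqfreeE !inE.
    case: (eqVneq j i) => [<-|ji]; first by rewrite (negbTE jJ).
    by rewrite addn0.
  rewrite /addable; case: (boolP (j \in J)) => //= jJ; rewrite sj //.
  case: ifP => [jD|jD]; first by rewrite wt_sqfree.
  by rewrite wt_notin ?mulr0 // supp_sqfree jD.
(* The part of [m] outside the dual forms vanishes on [J], so the two special cases suffice. *)
pose m' := m - \sum_(i in J) pairing m (ray i) *: form J i.
have pair_sum (x : 'rV[rat]_d) : pairing (\sum_(i in J) pairing m (ray i) *: form J i) x =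
    \sum_(i in J) pairing m (ray i) * pairing (form J i) x.
  rewrite pairingC linear_sum; apply: eq_bigr => i _.
  by rewrite linearZ /= pairingC.
have m'J i : i \in J -> pairing m' (ray i) = 0.
  move=> iJ; rewrite /m' pairingC linearB /= ![pairing (ray i) _]pairingC pair_sum.
  rewrite (bigD1 i) //= formP // eqxx mulr1 big1 ?addr0 ?subrr // => j /andP[jJ ji].
  by rewrite formP // eq_sym (negbTE ji) mulr0.
apply: etrans (R_perp m' m'J); rewrite /relation_wt.
have E j : pairing m (ray j) = pairing m' (ray j) +
    \sum_(i in J) pairing m (ray i) * pairing (form J i) (ray j).
  by rewrite -pair_sum [in RHS]pairingC /m' linearB /= ![pairing (ray j) _]pairingC subrK.
under eq_bigr do rewrite E mulrDl mulr_suml.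
rewrite big_split /= [X in _ + X]exchange_big /= [X in _ + X]big1 ?addr0 // => i iJ.
transitivity (pairing m (ray i) * relation_wt (form J i) b); last by rewrite R_form // mulr0.
by rewrite /relation_wt mulr_sumr; apply: eq_bigr => j _; rewrite mulrA.
Qed.

End Weights.

Section SeparatingFunctional.
Import VectorInternalTheory.
Variables (V : vectType rat) (U : {vspace V}).

Definition coker_coord j (v : V) : rat^o := (v2r v *m cokermx (vs2mx U)) 0 j.

Lemma coker_coord_is_linear j : linear (coker_coord j).
Proof. by move=> c u v; rewrite /coker_coord linearP mulmxDl -scalemxAl !mxE. Qed.

HB.instance Definition _ j := GRing.isLinear.Build rat V rat^o *:%R
  (coker_coord j) (coker_coord_is_linear j).

Lemma separating_functional x : x \notin U ->
  exists2 f : {linear V -> rat^o}, forall u, u \in U -> f u = 0 & f x != 0.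
Proof.
have mem v : (v \in U) = (v2r v *m cokermx (vs2mx U) == 0).
  by rewrite -[in LHS](v2rK v) memvE /subsetv -submxE genmxE v2rK.
rewrite mem => /eqP xU; have [j xj] : exists j, coker_coord j x != 0.
  apply/existsP; apply: contraT; rewrite negb_exists => /forallP H.
  case: xU; apply/rowP => j; have := H j; rewrite negbK => /eqP; rewrite /coker_coord => ->.
  by rewrite mxE.
by exists (coker_coord j) => // u; rewrite mem => /eqP E; rewrite /= /coker_coord E mxE.
Qed.

End SeparatingFunctional.

(** * Top cochains and squarefree polynomials *)

Section ChowDegree.
Variables (d n : nat) (rayz : 'I_n -> 'rV[int]_d) (Delta : {set {set 'I_n}}).
Variables (SR : set {mpoly rat[n]}) (k : nat).
Implicit Types (J L : {set 'I_n}) (a b : 'X_{1..n}).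
Local Notation families := {ffun {set 'I_n} -> ext d}.

Definition ratray i : 'rV[rat]_d := map_mx intr (rayz i).

Hypothesis DeltaS : forall J J', J \in Delta -> J' \subset J -> J' \in Delta.
Hypothesis free_ray : forall K, K \in Delta ->
  \dim <<[seq ratray i | i <- enum K]>> = #|K|.
Hypothesis SRP : forall g, SR g <-> exists2 J, J \notin Delta & g = \prod_(i in J) 'X_i.

Definition chow_gens : set {mpoly rat[n]} :=
  [set q * g | q in [set: {mpoly rat[n]}]%classic & g in (linear_relations rayz `|` SR)%classic]%classic.

Local Notation ideal := (lspanb chow_gens).
Local Notation C := (cochains ratray Delta 0%VS).

Lemma ideal_gen b g : (linear_relations rayz g \/ SR g) -> 'X_[b] * g \in ideal.
Proof. by move=> gG; apply/lspanbP/lspan_gen; exists 'X_[b] => //; exists g. Qed.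

Lemma ideal_notin a : supp a \notin Delta -> 'X_[a] \in ideal.
Proof.
move=> aD; have -> : a = (a - sqfree (supp a) + sqfree (supp a))%MM.
  apply/mnmP => i; rewrite mnmDE mnmBE sqfreeE inE.
  by case: (a i) => //= c; rewrite subnK.
by rewrite mpolyXD; apply: ideal_gen; right; apply/SRP; exists (supp a); rewrite ?mulXE.
Qed.

Lemma ideal_linear b (m : 'rV[rat]_d) :
  \sum_i pairing m (ratray i) *: 'X_[b + U_(i)] \in ideal.
Proof.
(* [linear_relations] ranges over integral forms; [N] clears the denominators of [m]. *)
pose N := \prod_j denq (m 0 j).
have N0 : (N%:~R : rat) != 0.
  by rewrite intr_eq0; apply/prodf_neq0 => j _; rewrite denq_neq0.
pose mz : 'rV[int]_d := \row_j (numq (m 0 j) * \prod_(i | i != j) denq (m 0 i)).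
have mE j : (mz 0 j)%:~R = N%:~R * m 0 j :> rat.
  rewrite mxE /N [in RHS](bigD1 j) //= !intrM -[X in _ = _ * X](divq_num_den (m 0 j)).
  by field; rewrite intr_eq0 denq_neq0.
have -> : \sum_i pairing m (ratray i) *: 'X_[b + U_(i)] =
    N%:~R^-1 *: ('X_[b] * \sum_i (pairing mz (rayz i))%:~R *: 'X_i) :> {mpoly rat[n]}.
  rewrite mulr_sumr scaler_sumr; apply: eq_bigr => i _.
  rewrite -scalerAr scalerA -mpolyXD; congr (_ *: _).
  apply: (mulfI N0); rewrite mulrA mulfV // mul1r /pairing rmorph_sum mulr_sumr.
  by apply: eq_bigr => j _; rewrite mxE rmorphM /= mE mulrA.
by apply/rpredZ/ideal_gen; left; exists mz.
Qed.

(** For [l = k] the values are scalars, stored at the empty set of indices. *)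
Definition poly_of (x : families) : {mpoly rat[n]} :=
  \sum_J x J finset.set0 *: 'X_[sqfree J].

Lemma poly_of_is_linear : linear poly_of.
Proof.
move=> c x y; rewrite /poly_of scaler_sumr -big_split; apply: eq_bigr => J _ /=.
by rewrite !ffunE scalerDl scalerA.
Qed.

HB.instance Definition _ := GRing.isLinear.Build rat families {mpoly rat[n]} *:%R
  poly_of poly_of_is_linear.

Lemma poly_of_single J w : poly_of (single J w) = w finset.set0 *: 'X_[sqfree J].
Proof.
rewrite /poly_of (bigD1 J) //= ffunE eqxx big1 ?addr0 // => K /negbTE KJ.
by rewrite ffunE KJ ffunE scale0r.
Qed.

Lemma single1_cochains J : J \in Delta -> #|J| = k -> single J (ext1 d) \in C k k.
Proof. by move=> JD <-; apply: single_cochains => //; apply: ext1_killed. Qed.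

Lemma cochains_single x : x \in C k k -> x = \sum_J x J finset.set0 *: single J (ext1 d).
Proof.
move=> xC; apply/ffunP => J; rewrite sum_ffunE (bigD1 J) //= big1 => [|K /negbTE KJ].
  rewrite !ffunE eqxx addr0; apply/ffunP => S; rewrite !ffunE.
  have [->|S0] := eqVneq S finset.set0; first by rewrite [RHS]mulr1.
  rewrite [RHS]mulr0; apply: (cochains_deg J xC).
  by rewrite -[X in _ != X]add0n eqn_add2r cards_eq0.
by rewrite !ffunE eq_sym KJ scaler0.
Qed.

Lemma contract_set0 e (w : ext d) :
  contract e w finset.set0 = pairing (\row_s w [set s]%SET) e.
Proof.
rewrite ffunE /pairing; apply: eq_big => [s|s _]; first by rewrite inE.
rewrite mxE finset.setU0 /ext_sign (_ : [set _ in _ | _]%SET = finset.set0).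
  by rewrite cards0 expr0 mul1r mulrC.
by apply/setP => t; rewrite !inE.
Qed.

Lemma sqfree_add1 L i : i \notin L -> (sqfree L + U_(i))%MM = sqfree (i |: L)%SET.
Proof.
move=> iL; apply/mnmP => j; rewrite mnmDE mnm1E !sqfreeE !inE.
by case: (eqVneq i j) => [<-|ij]; [rewrite (negbTE iL) | rewrite addn0].
Qed.

(** Only the linear part [m L] of [u L] is seen, and it vanishes on the rays of [L]. The
    contribution of [L] is thus its linear relation times the monomial of [L], up to monomials of
    non-faces. *)
Lemma poly_of_coboundary j u : u \in C k j ->
  poly_of (coboundary ratray Delta u) \in ideal.
Proof.
move=> uC; pose m L : 'rV[rat]_d := \row_s u L [set s]%SET.
pose G L i : {mpoly rat[n]} := if (i |: L)%SET \in Delta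
  then pairing (m L) (ratray i) *: 'X_[sqfree (i |: L)%SET] else 0.
have -> : poly_of (coboundary ratray Delta u) =
    \sum_(L : {set 'I_n}) \sum_(i | i \notin L) G L i.
  rewrite sum_add_remove; apply: eq_bigr => J _; rewrite coboundaryE.
  have [JD|JD] := boolP (J \in Delta); last first.
    by rewrite ffunE scale0r big1 // => i iJ; rewrite /G finset.setD1K // (negbTE JD).
  rewrite sum_ffunE scaler_suml; apply: eq_bigr => i iJ.
  by rewrite /G finset.setD1K // JD contract_set0.
apply: rpred_sum => L _.
have uL i : i \in L -> pairing (m L) (ratray i) = 0.
  move=> iL; rewrite -contract_set0; have /cochainsE[_ /(_ L)[_ _ /(_ i iL) ->]] := uC.
  by rewrite ffunE.
rewrite -[X in X \in _](subrK (\sum_i pairing (m L) (ratray i) *: 'X_[sqfree L + U_(i)])).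
apply: rpredD; last exact: ideal_linear.
rewrite [X in _ - X](bigID (mem L)) /= [X in _ - (X + _)]big1 ?add0r => [|i iL]; last first.
  by rewrite uL // scale0r.
rewrite -sumrB; apply: rpred_sum => i iL; rewrite /G sqfree_add1 //.
case: ifP => iD; first by rewrite subrr rpred0.
by rewrite sub0r rpredN; apply/rpredZ/ideal_notin; rewrite supp_sqfree iD.
Qed.

Let form_exists : exists form : {set 'I_n} -> 'I_n -> 'rV[rat]_d,
  forall J i j, J \in Delta -> i \in J -> j \in J ->
    pairing (form J i) (ratray j) = (j == i)%:R.
Proof.
have [|f fP] := @choice _ _ (fun (x : {set 'I_n} * 'I_n) (m : 'rV[rat]_d) =>
  x.1 \in Delta -> x.2 \in x.1 -> forall j, j \in x.1 ->
    pairing m (ratray j) = (j == x.2)%:R); last first.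
  by exists (fun J i => f (J, i)) => J i j JD iJ jJ; apply: (fP (J, i)).
move=> [J i] /=; have [JD|_] := boolP (J \in Delta); last by exists 0.
have [iJ|_] := boolP (i \in J); last by exists 0.
have [|m [_ mi mj]] := @exists_dual_form d n ratray 0%VS J _ i iJ.
  by rewrite /span_face add0v free_ray // dimv0.
exists m => _ _ j jJ; have [->|ji] := eqVneq j i; first exact: mi.
exact: mj.
Qed.

(** The recursion of [weight] carried out modulo the ideal: the relation dual to a ray with exponent
    at least 2 yields monomials of the same degree with larger support. *)
Lemma monomial_poly_of a : mdeg a = k -> exists2 x, x \in C k k &
  'X_[a] - poly_of x \in ideal.
Proof.
have [form formP] := form_exists.
have [N] := ubnP (n - #|supp a|); elim: N a => // N IH a; rewrite ltnS => leN ak.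
have [aD|aD] := boolP (supp a \in Delta); last first.
  by exists 0; rewrite ?mem0v // linear0 subr0 ideal_notin.
have [/existsP[i ai]|sq] := boolP [exists i, (1 < a i)%N]; last first.
  have aE : a = sqfree (supp a).
    by apply: sqfree_supp => i; move: sq; rewrite negb_exists => /forallP/(_ i); rewrite -leqNgt.
  exists (single (supp a) (ext1 d)).
    by apply: single1_cochains => //; rewrite -ak {2}aE mdeg_sqfree.
  by rewrite poly_of_single ffunE eqxx scale1r -aE subrr rpred0.
have iS : i \in supp a by rewrite inE; move: ai; case: (a i).
pose b := (a - U_(i))%MM.
have sb : supp b = supp a by rewrite supp_sub1.
have bE : a = (b + U_(i))%MM by rewrite sub1_add1 // ltnW.
have [|x xP] := @choice _ _ (fun (j : 'I_n) (x : families) => j \notin supp a ->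
    x \in C k k /\ 'X_[b + U_(j)] - poly_of x \in ideal).
  move=> j; have [jS|_] := boolP (j \notin supp a); last by exists 0.
  have [||x xC xI] := IH (b + U_(j))%MM; last by exists x.
    have := card_set_le (j |: supp a)%SET; rewrite supp_add1 sb cardsU1 jS add1n.
    by move: leN; lia.
  by rewrite mdegD mdeg1 addn1 mdeg_sub1 // ltnW.
exists (- \sum_(j | j \notin supp a) pairing (form (supp a) i) (ratray j) *: x j).
  by rewrite rpredN; apply: rpred_sum => j /xP[xC _]; apply: rpredZ.
rewrite linearN opprK linear_sum /=.
have := ideal_linear b (form (supp a) i); rewrite (bigID (mem (supp a))) /=.
rewrite (bigD1 i) //= formP // eqxx scale1r big1 ?addr0 => [|j /andP[jS /negbTE ji]]; last first.
  by rewrite formP // ji scale0r.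
rewrite -bE => relI.
move: relI; set S := \sum_(j | _) _ => relI; set T := \sum_(j | _) _.
have -> : 'X_[a] + T = ('X_[a] + S) - (S - T) by rewrite opprB addrACA subrr addr0.
apply: rpredB => //.
rewrite -sumrB; apply: rpred_sum => j /xP[_ xI].
by rewrite linearZ /= -scalerBr rpredZ.
Qed.

Lemma homog_poly_of p : p \is k.-homog -> exists2 x, x \in C k k & p - poly_of x \in ideal.
Proof.
move=> /dhomogP pk; have [|x xP] := @choice _ _ (fun (m : 'X_{1..n}) (x : families) =>
    mdeg m = k -> x \in C k k /\ 'X_[m] - poly_of x \in ideal).
  move=> m; have [E|] := eqVneq (mdeg m) k; last by move=> /eqP ne; exists 0 => /ne.
  by have [x xC xI] := monomial_poly_of E; exists x.
exists (\sum_(m <- msupp p) p@_m *: x m).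
  by rewrite big_seq; apply: rpred_sum => m /pk /xP[xC _]; apply: rpredZ.
rewrite {1}[p]mpolyE [poly_of _]linear_sum /= -sumrB big_seq; apply: rpred_sum => m /pk /xP[_ xI].
by rewrite linearZ /= -scalerBr rpredZ.
Qed.

Lemma poly_of_homog x : x \in C k k -> poly_of x \is k.-homog.
Proof.
move=> xC; apply: rpred_sum => J _.
have /cochainsP/(_ J) := xC; case: ifP => [/andP[_ /eqP cJ] _|_ ->]; last first.
  by rewrite ffunE scale0r rpred0.
by apply: rpredZ; rewrite dhomogX /= mdeg_sqfree cJ.
Qed.

Section Functional.
Variable weight : 'X_{1..n} -> rat.

Definition functional (p : {mpoly rat[n]}) : rat^o :=
  \sum_(m : 'X_{1..n < k.+1} | mdeg m == k) p@_m * weight m.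

Lemma functional_is_linear : linear functional.
Proof.
move=> c p q; rewrite /functional scaler_sumr -big_split; apply: eq_bigr => m _ /=.
by rewrite mcoeffD mcoeffZ mulrDl -mulrA.
Qed.

HB.instance Definition _ := GRing.isLinear.Build rat {mpoly rat[n]} rat^o *:%R
  functional functional_is_linear.

Lemma functionalX a : functional 'X_[a] = if mdeg a == k then weight a else 0.
Proof.
rewrite /functional; case: eqP => [ak|nak]; last first.
  rewrite big1 // => m /eqP mk; rewrite mcoeffX; case: eqP => [E|]; rewrite ?mul0r //.
  by rewrite E in nak.
have bnd : (mdeg a < k.+1)%N by rewrite ak.
rewrite (bigD1 (BMultinom bnd)) /= ?ak // mcoeffX eqxx mul1r big1 ?addr0 // => m /andP[_ ne].
rewrite mcoeffX; case: eqP => [E|]; rewrite ?mul0r //.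
by case/eqP: ne; apply/val_inj.
Qed.

End Functional.

(** By contradiction, with a functional that separates [x] from the coboundaries. Its vanishing on
    the coboundary of the form [m] placed at [L] is the condition [balanced] for its values [c] on
    single cones. *)
Lemma poly_of_ideal x : x \in C k k -> poly_of x \in ideal ->
  x \in abs_coboundaries ratray Delta 0%VS k k.
Proof.
move=> xC xI; apply/negPn/negP => /separating_functional[f f0 fx].
have [form formP] := form_exists.
pose c J := f (single J (ext1 d)).
have balanced L m : L \in Delta -> #|L|.+1 = k ->
    (forall i, i \in L -> pairing m (ratray i) = 0) ->
    \sum_(j | addable Delta L j) pairing m (ratray j) * c (j |: L)%SET = 0.
  move=> LD cL mL; pose w := wedge1 m (ext1 d).
  have wL : w \in face_forms ratray 0%VS k L.
    apply/face_formsP; split.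
    - by apply: ext_deg_wedge1; have /killedP[+ _] := @ext1_killed d 0%VS k; rewrite cL.
    - move=> e; rewrite memv0 => /eqP ->.
      by rewrite contract_wedge1 /pairing big1 ?scale0r ?sub0r => [|i _]; rewrite ?mxE ?mulr0 // contract_ext1 linear0 oppr0.
    - by move=> i iL; rewrite contract_wedge1 mL // scale0r contract_ext1 linear0 subrr.
  have uB : coboundary ratray Delta (single L w) \in abs_coboundaries ratray Delta 0%VS k k.
    by rewrite -cL; apply/memv_img; apply: single_cochains; rewrite ?cL.
  rewrite -[RHS](f0 _ uB).
  have -> : coboundary ratray Delta (single L w) = \sum_(j | addable Delta L j)
      pairing m (ratray j) *: single (j |: L)%SET (ext1 d).
    apply/ffunP => J; rewrite coboundaryE sum_ffunE.
    have [JD|JD] := boolP (J \in Delta); last first.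
      rewrite big1 // => j /andP[_ jD]; rewrite !ffunE; case: eqP => [E|_]; last exact: scaler0.
      by rewrite E jD in JD.
    rewrite big_mkcond [RHS]big_mkcond; apply: eq_bigr => i _; rewrite !ffunE /addable.
    have -> : (if J == (i |: L)%SET then ext1 d else 0) =
        (if (i \notin L) && (J == (i |: L)%SET) then ext1 d else 0) +
        (if (i \in L) && (J == (i |: L)%SET) then ext1 d else 0).
      by case: (i \in L); rewrite /= ?add0r ?addr0.
    have eJL : (i \in J) && ((J :\ i)%SET == L) = (i \notin L) && (J == (i |: L)%SET).
      apply/andP/andP => -[iJ /eqP E].
        by rewrite -E !inE eqxx finset.setD1K.
      by rewrite E !inE eqxx finset.setU1K.
    have [/andP[iL /eqP E]|] := boolP ((i \notin L) && (J == (i |: L)%SET)).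
      move: eJL; rewrite iL -E eqxx JD (negbTE iL) /= addr0 => /andP[-> ->].
      by rewrite contract_wedge1 contract_ext1 linear0 subr0.
    rewrite -eJL negb_and; case: (boolP (i \in J)) => /= [_ /negbTE ->|iJ _]; first rewrite linear0.
      by case: ifP => // /andP[/negbTE -> _] /=; rewrite addr0 scaler0.
    by case: ifP => // /andP[/negbTE -> _] /=; rewrite addr0 scaler0.
  rewrite linear_sum; apply: eq_bigr => j _; by rewrite linearZ.
pose L : {linear {mpoly rat[n]} -> rat^o} := functional (wt ratray Delta form c).
have LX a : L 'X_[a] = if mdeg a == k then wt ratray Delta form c a else 0 by exact: functionalX.
have LI p : p \in ideal -> L p = 0.
  move=> /lspanbP[s [sG ->]]; rewrite linear_sum big_seq big1 // => -[e p'] /sG /= [q _ [g gG <-]].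
  rewrite linearZ /=; apply/eqP; rewrite mulf_eq0; apply/orP; right; apply/eqP.
  rewrite [q]mpolyE mulr_suml linear_sum big1 // => b _; rewrite -scalerAl linearZ.
  suff -> : L ('X_[b] * g) = 0 by exact: scaler0.
  case: gG => [[m _ <-]|/SRP[J JD ->]]; last first.
    rewrite mulXE -mpolyXD LX; case: ifP => // _; apply: wt_notin.
    apply: contra JD => /DeltaS; apply.
    by rewrite -{1}(supp_sqfree J) suppS.
  rewrite mulr_sumr linear_sum.
  have E i : L ('X_[b] * ((pairing m (rayz i))%:~R *: 'X_i)) =
      pairing (map_mx intr m) (ratray i) *
      (if (mdeg b).+1 == k then wt ratray Delta form c (b + U_(i))%MM else 0).
    rewrite -scalerAr linearZ /= -mpolyXD LX mdegD mdeg1 addn1; congr (_ * _).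
    by rewrite /pairing rmorph_sum; apply: eq_bigr => h _; rewrite !mxE rmorphM.
  rewrite (eq_bigr _ (fun i _ => E i)); case: eqP => bk; last by rewrite big1 // => i _; rewrite mulr0.
  exact: (relation_wt0 DeltaS formP balanced).
have := LI _ xI; rewrite /poly_of linear_sum => Lx.
case/eqP: fx; rewrite (cochains_single xC) linear_sum -[RHS]Lx; apply: eq_bigr => J _.
rewrite !linearZ /=; have /cochainsP/(_ J) := xC.
case: ifP => [/andP[JD /eqP cJ] _|_ ->]; last by rewrite ffunE !scale0r.
by rewrite LX mdeg_sqfree cJ eqxx wt_sqfree.
Qed.

End ChowDegree.

(** * Normalising the multipliers *)

Section Twisted.
Variables (d n : nat) (ray : 'I_n -> 'rV[rat]_d) (Delta : {set {set 'I_n}}) (l : nat).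
Implicit Types (J K L : {set 'I_n}).
Local Notation families := {ffun {set 'I_n} -> ext d}.
Local Notation C := (cochains ray Delta 0%VS l).
Local Notation forms := (face_forms ray 0%VS l).

Hypothesis DeltaS : forall J J', J \in Delta -> J' \subset J -> J' \in Delta.
Hypothesis free_ray : forall K, K \in Delta ->
  \dim <<[seq ray i | i <- enum K]>> = #|K|.
Hypothesis ld : (l <= d)%N.

Variable c : {set 'I_n} -> 'I_n -> rat.
Hypothesis c_neq0 : forall J i, J \in Delta -> i \in J -> c J i != 0.

Definition twisted_coboundary (x : families) : families :=
  [ffun J => if J \in Delta
    then \sum_(i in J) c J i *: contract (ray i) (x (J :\ i)%SET) else 0].

Hypothesis twisted_twisted : forall j x, x \in C j ->
  twisted_coboundary (twisted_coboundary x) = 0.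

(** A form to test the square of the twisted coboundary on. Since [l <= d], a nonzero [u] killed by
    [J] exists; wedging it with the forms dual to [i] and [k] makes the double contraction recover
    it. *)
Lemma exists_contract2 J i k : J \in Delta -> (#|J| <= l)%N -> i \in J -> k \in J ->
  i != k -> exists2 w, w \in forms (J :\ i :\ k)%SET &
    contract (ray i) (contract (ray k) w) != 0.
Proof.
move=> JD Jl iJ kJ ik.
have indep : \dim (span_face ray 0%VS J) = (\dim (0%VS : {vspace 'rV[rat]_d}) + #|J|)%N.
  by rewrite /span_face add0v free_ray // dimv0.
have [mi [_ mii miJ]] := exists_dual_form indep iJ.
have [mk [_ mkk mkJ]] := exists_dual_form indep kJ.
have [|u uJ u0] := @killed_neq0 d (span_face ray 0%VS J) l #|J| Jl.
  by rewrite indep dimv0 add0n leq_add2r.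
have /face_formsP[du _ uz] := uJ.
have cJ : #|J| = #|(J :\ i :\ k)%SET|.+2.
  by rewrite (cardsD1 i) iJ (cardsD1 k (J :\ i)%SET) !inE eq_sym ik kJ !add1n.
have step h v : (pairing mk (ray h) = 0 -> contract (ray h) v = 0 ->
    contract (ray h) (wedge1 mk v) = 0).
  by move=> mh vh; rewrite contract_wedge1 mh scale0r vh linear0 subrr.
exists (wedge1 mk (wedge1 mi u)).
  apply/face_formsP; split.
  - by do 2 apply: ext_deg_wedge1; rewrite -cJ.
  - move=> x; rewrite memv0 => /eqP ->.
    apply/ffunP => S; rewrite !ffunE big1 // => s _.
    by rewrite mxE mulr0 mul0r.
  - move=> h; rewrite !inE => /and3P[hk hi hJ].
    by rewrite step ?mkJ // contract_wedge1 miJ // scale0r uz // linear0 subrr.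
have -> : contract (ray i) (contract (ray k) (wedge1 mk (wedge1 mi u))) = u => //.
rewrite contract_wedge1 mkk scale1r linearB /= contract_wedge1 mii scale1r uz // linear0 subr0.
rewrite [contract _ (wedge1 mk _)]step ?subr0 ?mkJ //.
rewrite contractC contract_wedge1 mii scale1r (uz i iJ) linear0 subr0.
by rewrite uz // oppr0.
Qed.

Lemma twist_cocycle J i k : J \in Delta -> (#|J| <= l)%N -> i \in J -> k \in J ->
  i != k -> c J i * c (J :\ i)%SET k = c J k * c (J :\ k)%SET i.
Proof.
move=> JD Jl iJ kJ ik; have [w wL w0] := exists_contract2 JD Jl iJ kJ ik.
set L := (J :\ i :\ k)%SET in wL.
have LE : (J :\ k :\ i)%SET = L by apply/setP => h; rewrite !inE andbCA.
have sub i' : (J :\ i')%SET \in Delta by apply: (DeltaS JD); apply: finset.subD1set.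
have LD : L \in Delta by apply: (DeltaS (sub i)); apply: finset.subD1set.
have /twisted_twisted/(congr1 (fun f : families => f J)) := single_cochains LD wL.
rewrite !ffunE JD (bigD1 i) //= (bigD1 k) /=; last by rewrite kJ eq_sym.
have one i' k' : k' \in (J :\ i')%SET -> (J :\ i' :\ k')%SET = L ->
    twisted_coboundary (single L w) (J :\ i')%SET = c (J :\ i')%SET k' *: contract (ray k') w.
  move=> k'J k'L; rewrite ffunE sub (bigD1 k') //= ffunE k'L eqxx big1 ?addr0 // => h /andP[hJ hk].
  rewrite ffunE; case: eqP => [E|_]; last by rewrite linear0 scaler0.
  have : k' \in (J :\ i' :\ h)%SET by rewrite !inE eq_sym hk; move: k'J; rewrite !inE.
  by rewrite E -k'L !inE eqxx.
rewrite (one i k) ?LE //; last by rewrite !inE eq_sym ik.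
rewrite (one k i) ?LE //; last by rewrite !inE ik.
rewrite big1 ?addr0 => [|h /andP[/andP[hJ hi] hk]]; last first.
  rewrite ffunE sub big1 ?linear0 ?scaler0 // => k' k'J.
  rewrite ffunE; case: eqP => [E|_]; last by rewrite linear0 scaler0.
  have : h \in L by rewrite !inE hi hk.
  by rewrite -E !inE eqxx andbF.
rewrite !linearZ /= [contract (ray k) (contract _ _)]contractC !scalerA scalerN -scalerBl.
by move/eqP; rewrite scaler_eq0 (negbTE w0) orbF subr_eq0 => /eqP E; rewrite mulrC E mulrC.
Qed.

(* The condition delta \o delta = 0 makes the multipliers c a multiplicative
   cocycle; it is the coboundary of untwisting, computed by removing the
   elements of J one at a time. *)
Fixpoint untwist N J : rat := if N is N'.+1 then
  if [pick i in J] is Some i then untwist N' (J :\ i)%SET / c J i else 1 else 1.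

Definition untwisting J := untwist #|J| J.

Lemma untwisting_pick J i0 : i0 \in J -> exists2 i, i \in J &
  untwisting J = untwisting (J :\ i)%SET / c J i.
Proof.
move=> i0J; rewrite /untwisting; case E: #|J| => [|N] /=.
  by move/eqP: E i0J; rewrite cards_eq0 => /eqP ->; rewrite inE.
case: pickP => [i iJ|/(_ i0)]; last by rewrite i0J.
exists i => //; suff -> : #|(J :\ i)%SET| = N by [].
by apply/eqP; rewrite -(eqn_add2l 1) -{1}[1%N]/(nat_of_bool true) -iJ -cardsD1 E.
Qed.

Lemma untwisting_neq0 J : J \in Delta -> untwisting J != 0.
Proof.
have [N] := ubnP #|J|; elim: N J => // N IH J; rewrite ltnS => leN JD.
have [->|[i0 i0J]] := finset.set_0Vmem J.
  by rewrite /untwisting cards0 oner_neq0.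
have [i iJ ->] := untwisting_pick i0J.
rewrite mulf_neq0 ?invr_neq0 ?c_neq0 // IH //; last exact: (DeltaS JD (finset.subD1set _ _)).
by move: leN; rewrite (cardsD1 i) iJ.
Qed.

(** [untwisting] removes elements in one chosen order; any other first element gives the same value,
    by [twist_cocycle] and induction through [J] without both elements. *)
Lemma untwisting_step J i : J \in Delta -> (#|J| <= l)%N -> i \in J ->
  untwisting J * c J i = untwisting (J :\ i)%SET.
Proof.
have [N] := ubnP #|J|; elim: N J i => // N IH J i; rewrite ltnS => leN JD Jl iJ.
have [k kJ ->] := untwisting_pick iJ.
have [->|ki] := eqVneq k i; first by rewrite divfK ?c_neq0.
have sub h : (J :\ h)%SET \in Delta by apply: (DeltaS JD); apply: finset.subD1set.
have card h : h \in J -> (#|(J :\ h)%SET| < #|J|)%N by move=> hJ; rewrite [leqRHS](cardsD1 h) hJ.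
have iJk : i \in (J :\ k)%SET by rewrite !inE eq_sym ki.
have kJi : k \in (J :\ i)%SET by rewrite !inE ki.
have Ek : untwisting (J :\ k)%SET * c (J :\ k)%SET i = untwisting (J :\ k :\ i)%SET.
  apply: IH => //; first exact: leq_trans (card k kJ) leN.
  exact: leq_trans (ltnW (card k kJ)) Jl.
have Ei : untwisting (J :\ i)%SET * c (J :\ i)%SET k = untwisting (J :\ i :\ k)%SET.
  apply: IH => //; first exact: leq_trans (card i iJ) leN.
  exact: leq_trans (ltnW (card i iJ)) Jl.
apply: (mulIf (c_neq0 (sub i) kJi)); rewrite Ei.
have -> : (J :\ i :\ k)%SET = (J :\ k :\ i)%SET by apply/setP => h; rewrite !inE andbCA.
rewrite -Ek -[LHS]mulrA twist_cocycle // 1?eq_sym //.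
by rewrite -mulrA; congr (_ * _); rewrite mulrA mulVf ?mul1r ?c_neq0.
Qed.

Lemma untwisting_coboundary j x : x \in C j ->
  [ffun J => untwisting J *: twisted_coboundary x J] =
  coboundary ray Delta [ffun J => untwisting J *: x J].
Proof.
move=> xC; apply/ffunP => J; rewrite coboundaryE !ffunE.
have [JD|_] := ifP; last exact: scaler0.
rewrite scaler_sumr; apply: eq_bigr => i iJ; rewrite ffunE [contract _ (_ *: _)]linearZ /= scalerA.
(* Beyond [l] rays the multipliers need not be compatible, but the contracted form would have
   negative degree and is 0. *)
have [Jl|lJ] := leqP #|J| l; first by rewrite untwisting_step.
suff -> : contract (ray i) (x (J :\ i)%SET) = 0 by rewrite !scaler0.
have /cochainsP/(_ (J :\ i)%SET) := xC.
case: ifP => [/andP[_ /eqP cJ] _|_ ->]; last exact: linear0.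
apply: (@ext_deg_eq0 _ l j.+1); last by apply/ext_deg_contract/cochains_deg/xC.
by rewrite -cJ; move: lJ; rewrite (cardsD1 i J) iJ add1n.
Qed.

End Twisted.

(** * Dimensions of modules *)

Lemma bijective_of_injective (A : Type) (B : Type) (f : A -> B) :
  injective f -> (forall y, exists x, f x = y) -> bijective f.
Proof. by move=> fI /choice[g fK]; exists g => // x; apply: fI. Qed.

Section Dimension.
Variable K : fieldType.

(** Quotients and tensor products are bare modules, so dimension is expressed by a linear bijection
    from row vectors. *)
Definition hasdim (W : lmodType K) (N : nat) :=
  exists f : {linear 'rV[K]_N -> W}, bijective f.

Lemma linear_of (V W : lmodType K) (f : V -> W) : linear f ->
  exists g : {linear V -> W}, g =1 f.
Proof.
move=> fl; pose h := GRing.isLinear.Build K V W *:%R f fl.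
by exists (HB.pack_for {linear V -> W} f h).
Qed.

Lemma hasdim_linear_bij (W W' : lmodType K) N : hasdim W N -> hasdim W' N ->
  exists f : {linear W -> W'}, bijective f.
Proof.
case=> g [g' gK g'K] [h hb].
have [f fE] : exists f : {linear W -> W'}, f =1 h \o g'.
  apply: linear_of => c u v /=; rewrite -linearP; congr (h _).
  by rewrite -{1}[u]g'K -{1}[v]g'K -linearP gK.
exists f; apply: (eq_bij _ (fsym fE)); apply: bij_comp => //.
by exists g.
Qed.

(** [W], embedded by [iota], is the image of [U] under [theta], whose kernel on [U] is [U0]; a
    complement of [U0] in [U] gives the coordinates. The ambient [X] is there for modules such as
    the graded pieces of the Chow ring. *)
Lemma hasdim_subquotient (V : vectType K) (X W : lmodType K) (theta : {linear V -> X})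
    (iota : {linear W -> X}) (U U0 : {vspace V}) N :
  injective iota ->
  (forall u, u \in U -> exists w, iota w = theta u) ->
  (forall w, exists2 u, u \in U & iota w = theta u) ->
  (forall u, u \in U -> theta u = 0 <-> u \in U0) ->
  (U0 <= U)%VS -> \dim U = (N + \dim U0)%N -> hasdim W N.
Proof.
move=> iotaI lift surj ker U0U dimU; pose D := (U :\: U0)%VS.
have dimD : \dim D = N.
  by have := dimv_cap_compl U U0; rewrite (capv_idPr U0U) dimU addnC => /addIn.
have [|lft lftP] := @choice _ _ (fun u w => u \in U -> iota w = theta u).
  move=> u; have [uU|_] := boolP (u \in U); last by exists 0.
  by have [w wE] := lift u uU; exists w.
have DU v : v \in D -> v \in U by apply/subvP/diffvSl.
move: dimD; rewrite -/D => <-; pose s (r : 'rV[K]_(\dim D)) := \sum_i r 0 i *: (vbasis D)`_i.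
have sD r : s r \in D.
  by apply: rpred_sum => i _; apply/rpredZ/vbasis_mem/mem_nth; rewrite size_tuple.
have sl : linear s.
  move=> c r r'; rewrite /s scaler_sumr -big_split; apply: eq_bigr => i _ /=.
  by rewrite !mxE scalerDl scalerA.
have [f fE] : exists f : {linear 'rV[K]_(\dim D) -> W}, f =1 lft \o s.
  apply: linear_of => c r r' /=; apply: iotaI; rewrite linearP !lftP ?DU //.
  by rewrite sl linearP.
exists f; apply: bijective_of_injective => [|w].
  move=> r r' E; have : s (r - r') = 0.
    apply/eqP; rewrite -memv0 -(capv_diff U U0) memv_cap sD.
    apply/ker; rewrite ?DU // -lftP ?DU //.
    by have := fE (r - r'); rewrite linearB E subrr /= => <-; rewrite linear0.
  move=> s0; apply/rowP => i; apply/eqP; rewrite -subr_eq0; apply/eqP.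
  have /freeP/(_ (fun i => (r - r') 0 i) s0 i) := basis_free (vbasisP D).
  by rewrite !mxE.
have [u uU wE] := surj w.
have : u \in (D + U0)%VS by rewrite addv_diff; apply: subvP uU; apply: addvSl.
case/memv_addP => x xD [y yU0 uE].
have xs : x = s (\row_i coord (vbasis D) i x).
  by rewrite {1}(coord_vbasis xD); apply: eq_bigr => i _; rewrite mxE.
exists (\row_i coord (vbasis D) i x); rewrite fE /= -xs; apply: iotaI.
rewrite wE lftP ?DU // uE linearD /= [theta y](_ : _ = 0) ?addr0 //.
by apply/ker => //; apply: subvP yU0.
Qed.

Lemma hasdim_subvs (V : vectType K) (U : {vspace V}) : hasdim (subvs_of U) (\dim U).
Proof.
apply: (@hasdim_subquotient _ _ _ (vsproj U) (idfun : {linear subvs_of U -> subvs_of U})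
  U 0%VS) => //=; first by move=> u _; exists (vsproj U u).
- by move=> w; exists (vsval w); rewrite ?subvsP // vsvalK.
- move=> u uU; rewrite memv0; split=> [E|/eqP ->]; last exact: linear0.
  by rewrite -(vsprojK uU) E linear0.
- exact: sub0v.
- by rewrite dimv0 addn0.
Qed.

Section TensorDimension.
Variables (V W : lmodType K) (a b : nat).
Variables (f : {linear 'rV[K]_a -> V}) (g : {linear 'rV[K]_b -> W}).

Definition pure (v : V) (w : W) : tensor V W := qpi _ << (v, w) >>.

Lemma pure_linearl c u v w : pure (c *: u + v) w = c *: pure u w + pure v w.
Proof.
apply/eqP; rewrite /pure -linearZ -linearD qpi_eq opprD addrA.
by apply/lspanbP/lspan_gen; left; exists c, u, v, w.
Qed.

Lemma pure_linearr c u v w : pure u (c *: v + w) = c *: pure u v + pure u w.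
Proof.
apply/eqP; rewrite /pure -linearZ -linearD qpi_eq opprD addrA.
by apply/lspanbP/lspan_gen; right; exists c, u, v, w.
Qed.

Lemma pure_suml n (c : 'I_n -> K) (v : 'I_n -> V) w :
  pure (\sum_i c i *: v i) w = \sum_i c i *: pure (v i) w.
Proof.
elim: n c v => [|n IH] c v; last by rewrite !big_ord_recl pure_linearl IH.
rewrite !big_ord0; have /eqP := pure_linearl 1 0 0 w.
by rewrite !scale1r addr0 -[X in X == _]addr0 (inj_eq (addrI _)) eq_sym => /eqP.
Qed.

Lemma pure_sumr n (c : 'I_n -> K) u (w : 'I_n -> W) :
  pure u (\sum_i c i *: w i) = \sum_i c i *: pure u (w i).
Proof.
elim: n c w => [|n IH] c w; last by rewrite !big_ord_recl pure_linearr IH.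
rewrite !big_ord0; have /eqP := pure_linearr 1 u 0 0.
by rewrite !scale1r addr0 -[X in X == _]addr0 (inj_eq (addrI _)) eq_sym => /eqP.
Qed.

Lemma fglift_linear (M : lmodType K) (T : choiceType) (h : T -> M) :
  linear (fglift h : {freeg T / K} -> M).
Proof.
have hB := lift_is_additive h.
have h0 : fglift h 0 = 0 by have := hB 0 0; rewrite !subrr.
have hD x y : fglift h (x + y) = fglift h x + fglift h y.
  by rewrite -{1}[y]opprK -{1}(sub0r y) !hB h0 sub0r opprK.
have hsum (I : Type) (s : seq I) F :
    fglift h (\sum_(i <- s) F i) = \sum_(i <- s) fglift h (F i).
  by elim/big_rec2: _ => // i y x _ E; rewrite hD E.
move=> c x y; rewrite hD; congr (_ + _).
rewrite -[x in RHS]freeg_sumE [in RHS]hsum scaler_sumr.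
transitivity (fglift h (\sum_(z <- dom x) << c * coeff z x *g z >>)); first by [].
rewrite hsum; apply: eq_bigr => z _; by rewrite !liftU scalerA.
Qed.

(** Pure tensors of basis vectors give a surjection [T] from matrices. The bilinear map [H],
    extended to the free module, kills the relations and is a left inverse of [T], hence
    injectivity. *)
Lemma hasdim_tensor : bijective f -> bijective g -> hasdim (tensor V W) (a * b).
Proof.
case=> f' fK f'K [g' gK g'K].
have f'l : linear f' by move=> c u v; rewrite -{1}[u]f'K -{1}[v]f'K -linearP fK.
have g'l : linear g' by move=> c u v; rewrite -{1}[u]g'K -{1}[v]g'K -linearP gK.
have pureE v w : pure v w =
    \sum_i f' v 0 i *: \sum_j g' w 0 j *: pure (f (delta_mx 0 i)) (g (delta_mx 0 j)).
  rewrite -[v in LHS]f'K [in LHS](row_sum_delta (f' v)) linear_sum.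
  under [in LHS]eq_bigr do rewrite linearZ.
  rewrite pure_suml; apply: eq_bigr => i _; congr (_ *: _).
  rewrite -[w in LHS]g'K [in LHS](row_sum_delta (g' w)) linear_sum.
  under [in LHS]eq_bigr do rewrite linearZ.
  by rewrite pure_sumr.
pose T (M : 'M[K]_(a, b)) := \sum_i \sum_j M i j *: pure (f (delta_mx 0 i)) (g (delta_mx 0 j)).
have [t tE] : exists t : {linear 'M[K]_(a, b) -> tensor V W}, t =1 T.
  apply: linear_of => c M M'; rewrite /T scaler_sumr -big_split; apply: eq_bigr => i _.
  rewrite scaler_sumr -big_split; apply: eq_bigr => j _ /=.
  by rewrite !mxE scalerDl scalerA.
pose H (p : V * W) : 'M[K]_(a, b) := (f' p.1)^T *m g' p.2.
have Hl := fglift_linear H.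
have [h hE] := linear_of Hl.
have h_rel x : x \in lspanb (@bilinear_relations K V W) -> h x = 0.
  move=> /lspanbP[s [sG ->]]; rewrite linear_sum big_seq big1 // => -[c r] /sG /= rR.
  rewrite linearZ /= [h r](_ : _ = 0) ?scaler0 //.
  case: rR => [[e [u [v [w ->]]]]|[e [u [v [w ->]]]]]; rewrite !linearB linearZ /= !hE !liftU !scale1r /H /=.
    by rewrite f'l linearD linearZ /= mulmxDl scalemxAl addrAC addrK subrr.
  by rewrite g'l mulmxDr -scalemxAr addrAC addrK subrr.
have hT x M : qpi _ x = T M -> h x = M.
  pose y : {freeg (V * W) / K} :=
    \sum_i \sum_j M i j *: << (f (delta_mx 0 i), g (delta_mx 0 j)) >>.
  have -> : T M = qpi _ y.
    rewrite /T linear_sum; apply: eq_bigr => i _; rewrite linear_sum.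
    by apply: eq_bigr => j _; rewrite linearZ.
  move=> /eqP; rewrite qpi_eq => /h_rel /eqP; rewrite linearB subr_eq0 => /eqP ->.
  rewrite linear_sum [RHS]matrix_sum_delta; apply: eq_bigr => i _.
  rewrite linear_sum; apply: eq_bigr => j _; rewrite linearZ /= hE liftU scale1r /H /=.
  by rewrite fK gK trmx_delta mul_delta_mx.
have surj x : exists M, T M = x.
  have [y ->] := qpi_surj x; exists (\matrix_(i, j) \sum_(z <- dom y) coeff z y * (f' z.1 0 i * g' z.2 0 j)).
  rewrite -[in RHS](freeg_sumE y) linear_sum /=.
  have U1 z : << coeff z y *g z >> = coeff z y *: << z >> :> {freeg (V * W) / K}.
    by apply/eqP/freeg_eqP => z'; rewrite coeffZ !coeffU mul1r.
  have zE z : qpi _ << coeff z y *g z >> = coeff z y *: \sum_i f' z.1 0 i *: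
      \sum_j g' z.2 0 j *: pure (f (delta_mx 0 i)) (g (delta_mx 0 j)).
    by rewrite U1 linearZ /= -pureE /pure -surjective_pairing.
  under [in RHS]eq_bigr do rewrite zE scaler_sumr.
  rewrite [in RHS]exchange_big; apply: eq_bigr => i _ /=.
  under eq_bigr do rewrite mxE scaler_suml.
  rewrite exchange_big; apply: eq_bigr => z _ /=.
  by rewrite !scaler_sumr; apply: eq_bigr => j _; rewrite !scalerA mulrA.
apply: (@hasdim_subquotient _ _ _ t (idfun : {linear tensor V W -> tensor V W}) fullv 0%VS) => //=.
- by move=> u _; exists (t u).
- by move=> x; have [M <-] := surj x; exists M; rewrite ?memvf ?tE.
- move=> M _; rewrite memv0 tE; split=> [E|/eqP ->].
    apply/eqP; rewrite -(hT 0 M); first by rewrite linear0.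
    by rewrite linear0.
  by rewrite /T big1 // => i _; rewrite big1 // => j _; rewrite mxE scale0r.
- exact: sub0v.
by rewrite dimv0 addn0 dimvf dim_matrix.
Qed.

End TensorDimension.
End Dimension.

Section SubquotientDimensions.
Variables (V : vectType rat) (Z B : {vspace V}).

Lemma hasdim_quotmod N : (B <= Z)%VS -> \dim Z = (N + \dim B)%N ->
  hasdim (quotmod [set z : subvs_of Z | vsval z \in B]%classic) N.
Proof.
move=> BZ dimZ; pose G := [set z : subvs_of Z | vsval z \in B]%classic.
have [t tE] : exists t : {linear V -> quotmod G}, t =1 fun v => qpi G (vsproj Z v).
  by apply: linear_of => c u v; rewrite !linearP.
apply: (@hasdim_subquotient _ _ _ _ t (idfun : {linear quotmod G -> quotmod G}) Z B) => //=.
- by move=> u _; exists (t u).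
- move=> w; have [z ->] := qpi_surj w; exists (vsval z); rewrite ?subvsP // tE vsvalK //.
move=> u uZ; rewrite tE; split.
  move/eqP; rewrite -[X in _ == X](linear0 (qpi G)) qpi_eq subr0 => /lspanbP[s [sG E]].
  rewrite -(vsprojK uZ) E linear_sum big_seq; apply: rpred_sum => x /sG xB.
  by rewrite linearZ rpredZ.
move=> uB; apply/eqP; rewrite -[X in _ == X](linear0 (qpi G)) qpi_eq subr0.
by apply/lspanbP/lspan_gen; rewrite /G /= vsprojK.
Qed.

End SubquotientDimensions.

Section ChowDimension.
Variables (d n : nat) (rayz : 'I_n -> 'rV[int]_d) (Delta : {set {set 'I_n}}).
Variables (SR : set {mpoly rat[n]}) (k : nat).

Hypothesis DeltaS : forall J J' : {set 'I_n}, J \in Delta -> J' \subset J -> J' \in Delta.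
Hypothesis free_ray : forall K : {set 'I_n}, K \in Delta ->
  \dim <<[seq ratray rayz i | i <- enum K]>> = #|K|.
Hypothesis SRP : forall g, SR g <-> exists2 J : {set 'I_n}, J \notin Delta & g = \prod_(i in J) 'X_i.

Let ray := ratray rayz.
Let chow_ring : lmodType rat := quotmod (chow_gens rayz SR).

Lemma cocycles_top : abs_cocycles ray Delta 0%VS k k = cochains ray Delta 0%VS k k.
Proof.
apply/vspaceP => x; apply/idP/idP => [/abs_cocyclesP[]//|xC].
apply/abs_cocyclesP; split=> //; have := coboundary_cochains DeltaS xC.
by rewrite cochains_eq0 // memv0 => /eqP.
Qed.

Lemma hasdim_chow_degree :
  hasdim (submod [set x : chow_ring |
      exists2 p : {mpoly rat[n]}, p \is k.-homog & x = qpi _ p]%classic)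
    (hdim ray Delta 0%VS k k).
Proof.
set G := [set x : chow_ring | _]%classic.
have GS x : lspan G x -> G x.
  move=> [s [sG ->]]; elim: s sG => [|c s IH] sG.
    by exists 0; rewrite ?rpred0 // big_nil linear0.
  have [|p ph pE] := IH; first by move=> y ys; apply: sG; rewrite inE ys orbT.
  have [|q qh qE] := sG c; first by rewrite inE eqxx.
  exists (c.1 *: q + p); first by apply: rpredD => //; apply: rpredZ.
  by rewrite big_cons pE qE linearD linearZ.
have valI : injective (\val : {linear submod G -> chow_ring}) by apply: val_inj.
have [t tE] : exists t : {linear {ffun {set 'I_n} -> ext d} -> chow_ring},
    t =1 fun x => qpi _ (poly_of x).
  by apply: linear_of => c u v; rewrite !linearP.
have SubE g : G g -> exists w : submod G, val w = g.
  move=> Gg; have gS : g \in lspanb G by apply/lspanbP/lspan_gen.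
  by exists (Submod gS).
apply: (@hasdim_subquotient _ _ _ _ t (\val : {linear submod G -> chow_ring})
  (cochains ray Delta 0%VS k k) (abs_coboundaries ray Delta 0%VS k k)) => //.
- move=> u uC; apply: SubE; exists (poly_of u) => //; exact: (poly_of_homog uC).
- move=> w; have [p ph pE] : G (val w) by apply/GS/lspanbP; case: w.
  have [x xC xI] := homog_poly_of free_ray SRP ph.
  by exists x => //; rewrite tE; apply: (etrans pE); apply/eqP; rewrite qpi_eq.
- move=> u uC; rewrite tE; split.
    move/eqP; rewrite -[X in _ == X](linear0 (qpi _)) qpi_eq subr0.
    exact: (poly_of_ideal DeltaS free_ray SRP).
  move=> uB; apply/eqP; rewrite -[X in _ == X](linear0 (qpi _)) qpi_eq subr0.
  case: k uB {uC G GS valI SubE} => [|j] /=; first by rewrite memv0 => /eqP ->; rewrite linear0 rpred0.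
  case/memv_imgP=> x xC ->; exact: (poly_of_coboundary SRP xC).
- by rewrite -cocycles_top coboundaries_sub.
by rewrite /hdim cocycles_top subnK // dimvS // -cocycles_top coboundaries_sub.
Qed.

End ChowDimension.

(** * Simplicial fans *)

(** A nonzero coordinate of [w] gives the ratio in lowest terms, [p] over [q]. Then [p] divides all
    of [v] and [q] all of [w], so both are units, of the same sign because [t] is positive. *)
Lemma primitive_eq d (v w : 'rV[int]_d) (K : realFieldType) (t : K) :
  primitive v -> primitive w -> 0 < t ->
  map_mx intr v = t *: map_mx intr w :> 'rV[K]_d -> v = w.
Proof.
move=> pv pw t0 vE; have E j : (v 0 j)%:~R = t * (w 0 j)%:~R :> K.
  by have := congr1 (fun x : 'rV[K]_d => x 0 j) vE; rewrite !mxE.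
have [/existsP[h wh]|] := boolP [exists h, w 0 h != 0]; last first.
  rewrite negb_exists => /forallP w0; suff w_eq0 : w = 0 by have := pw 2 0; rewrite scaler0 w_eq0 => /(_ erefl).
  by apply/rowP => h; apply/eqP; have := w0 h; rewrite negbK mxE.
have wh0 : (w 0 h)%:~R != 0 :> K by rewrite intr_eq0.
have cross j : w 0 h * v 0 j = v 0 h * w 0 j.
  apply/eqP; rewrite -(eqr_int K) !rmorphM /= !E.
  by rewrite mulrCA mulrA.
pose g := gcdz (v 0 h) (w 0 h).
have g0 : g != 0 by rewrite gcdz_eq0 negb_and wh orbT.
pose p := (v ord0 h %/ g)%Z; pose q := (w ord0 h %/ g)%Z.
have pE : v 0 h = p * g by rewrite divzK // dvdz_gcdl.
have qE : w 0 h = q * g by rewrite divzK // dvdz_gcdr.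
have cross' j : q * v 0 j = p * w 0 j.
  by apply: (mulIf g0); rewrite mulrAC -qE cross pE mulrAC.
have cop : coprimez p q.
  have /eqP : g = gcdz p q * g.
    by rewrite {1}/g {1}pE {1}qE -mulz_gcdl; congr (_ * _); rewrite abszE ger0_norm.
  by rewrite -{1}[g]mul1r (inj_eq (mulIf g0)) /coprimez eq_sym.
have dp j : (p %| v ord0 j)%Z.
  by rewrite -(Gauss_dvdzr _ cop) cross' dvdz_mulr.
have dq j : (q %| w ord0 j)%Z.
  by rewrite coprimez_sym in cop; rewrite -(Gauss_dvdzr _ cop) -cross' dvdz_mulr.
have p1 : `|p| = 1.
  apply: (pv p (\row_j (v ord0 j %/ p)%Z)); apply/rowP => j.
  by rewrite !mxE mulrC divzK.
have q1 : `|q| = 1.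
  apply: (pw q (\row_j (w ord0 j %/ q)%Z)); apply/rowP => j.
  by rewrite !mxE mulrC divzK.
suff pq : p = q.
  by apply/rowP => j; have := cross' j; rewrite pq => /mulfI; apply; rewrite -normr_eq0 q1.
have pqt : p%:~R = t * q%:~R :> K.
  have g0' : g%:~R != 0 :> K by rewrite intr_eq0.
  by apply: (mulIf g0'); rewrite -mulrA -!intrM -pE -qE E.
have [p0|p0] := ltP 0 p.
  have q0 : 0 < q by rewrite -(ltr0z K) -(pmulr_rgt0 _ t0) -pqt ltr0z.
  by rewrite -[LHS]gtr0_norm // p1 -q1 gtr0_norm.
have q0 : q <= 0 by rewrite -(lerz0 K) -(pmulr_rle0 _ t0) -pqt lerz0.
by apply: oppr_inj; rewrite -[LHS]ler0_norm // p1 -q1 ler0_norm.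
Qed.

(** * Independent rays and their faces *)

Section Independence.
Variables (K : realFieldType) (d n : nat) (v : 'I_n -> 'rV[K]_d).
Implicit Types (J T : {set 'I_n}) (c : 'I_n -> K).

Definition independent J := forall c, (forall i, i \notin J -> c i = 0) ->
  comb v c = 0 -> forall i, c i = 0.

Lemma independentS J T : independent J -> T \subset J -> independent T.
Proof.
move=> iJ TJ c c0; apply: iJ => i iJ; apply: c0; apply: contra iJ.
exact: (fintype.subsetP TJ).
Qed.

Lemma independent_neq0 J i : independent J -> i \in J -> v i != 0.
Proof.
move=> iJ iin; apply/eqP => v0; have /eqP : ((i == i)%:R : K) = 0; last first.
  by rewrite eqxx oner_eq0.
apply: (iJ (fun j => (j == i)%:R)) => [j jJ|].
  by case: eqP jJ => [->|//]; rewrite iin.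
by rewrite /comb (bigD1 i) //= v0 scaler0 add0r big1 // => j /negbTE ->; rewrite scale0r.
Qed.

Lemma pairing_comb m c : pairing m (comb v c) = \sum_i c i * pairing m (v i).
Proof. by rewrite linear_sum; apply: eq_bigr => i _; rewrite linearZ. Qed.

Lemma independent_dual J (t : 'I_n -> K) : independent J ->
  exists m, forall i, i \in J -> pairing m (v i) = t i.
Proof.
move=> iJ; pose A : 'M[K]_(#|J|, d) := \matrix_h v (enum_val h).
have freeA : row_free A.
  rewrite -kermx_eq0; apply/eqP/row_matrixP => h; rewrite row0.
  set u := row h _; have uA : u *m A = 0 by rewrite -row_mul mulmx_ker row0.
  pose c i := \sum_(g | enum_val g == i) u 0 g.
  have /iJ c0 : forall i, i \notin J -> c i = 0.
    by move=> i iJn; apply: big1 => g /eqP E; rewrite -E enum_valP in iJn.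
  have cE g : c (enum_val g) = u 0 g.
    by rewrite /c (big_pred1 g) // => g'; rewrite (inj_eq enum_val_inj).
  apply/rowP => g; rewrite -cE mxE; apply: c0; rewrite -[RHS]uA.
  transitivity (\sum_g' u 0 g' *: v (enum_val g')); last first.
    by rewrite mulmx_sum_row; apply: eq_bigr => g' _; rewrite rowK.
  rewrite /comb /c; under eq_bigr do rewrite scaler_suml.
  rewrite (exchange_big_dep predT) //=; apply: eq_bigr => g' _.
  by rewrite (big_pred1 (enum_val g')) // => i; rewrite eq_sym.
have /row_freeP[B AB] := freeA; pose u : 'cV[K]_#|J| := \col_h t (enum_val h).
exists (B *m u)^T => i iJ'; pose h := enum_rank_in iJ' i.
have hE : enum_val h = i by rewrite enum_rankK_in.
have := congr1 (fun M => (M *m u) h 0) AB; rewrite mul1mx -mulmxA mxE [in RHS]mxE hE => <-.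
by apply: eq_bigr => j _; rewrite !mxE hE mulrC.
Qed.

Lemma in_cone_ray J i : i \in J -> in_cone v J (v i).
Proof.
move=> iJ; exists (fun j => (j == i)%:R); first split=> j.
- exact: ler0n.
- by apply: contraNeq; rewrite pnatr_eq0 eqb0 negbK => /eqP ->.
rewrite /comb (bigD1 i) //= eqxx scale1r big1 ?addr0 // => j /negbTE ->.
by rewrite scale0r.
Qed.

Lemma in_coneS J T x : T \subset J -> in_cone v T x -> in_cone v J x.
Proof.
move=> TJ [c [c0 cT] ->]; exists c => //; split=> // i iJ; apply: cT.
by apply: contra iJ; apply: (fintype.subsetP TJ).
Qed.

Lemma cone_face m J c : (forall x, in_cone v J x -> 0 <= pairing m x) ->
  carried J c -> pairing m (comb v c) = 0 -> forall i, c i != 0 -> pairing m (v i) = 0.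
Proof.
move=> mJ [c0 cJ]; rewrite pairing_comb => s0 i ci.
have ge j : 0 <= c j * pairing m (v j).
  have [jJ|/cJ ->] := boolP (j \in J); last by rewrite mul0r.
  by rewrite mulr_ge0 // mJ //; apply: in_cone_ray.
have /eqP := @psumr_eq0P _ _ predT _ (fun j _ => ge j) s0 i isT.
by rewrite mulf_eq0 (negbTE ci) => /eqP.
Qed.

Lemma dim_independent J : independent J -> \dim <<[seq v i | i <- enum J]>> = #|J|.
Proof.
move=> iJ; have X : size [seq v i | i <- enum J] == #|J| by rewrite size_map -cardE.
suff /eqP -> : free (Tuple X) by rewrite /= (eqP X).
apply/freeP => c c0 g; pose c' i := \sum_(h | enum_val h == i) c h.
have cE h : c' (enum_val h) = c h.
  by rewrite /c' (big_pred1 h) // => h'; rewrite (inj_eq enum_val_inj).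
rewrite -cE; apply: iJ => [i iJ|].
  by apply: big1 => h /eqP E; rewrite -E enum_valP in iJ.
rewrite -[RHS]c0 /comb /c'; under eq_bigr do rewrite scaler_suml.
rewrite (exchange_big_dep predT) //=; apply: eq_bigr => h _.
rewrite (big_pred1 (enum_val h)); last by move=> i; rewrite eq_sym.
congr (_ *: _); rewrite (nth_map (enum_val h)) -?cardE //.
by congr v; rewrite [in LHS]/enum_val (set_nth_default (enum_val h)) -?cardE.
Qed.

End Independence.

Section ConeGeometry.
Variables (R : realType) (d : nat).
Local Notation NR := 'rV[R]_d.

Lemma cone_hullE (s : seq NR) :
  cone_hull s = in_cone (fun j : 'I_(size s) => s`_j) [set: 'I_(size s)]%SET.
Proof.
apply/seteqP; split=> x [c].
  by move=> c0 ->; exists c => //; split=> // i; rewrite inE.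
by case=> c0 _ ->; exists c.
Qed.

Lemma cone_hull1P (v x : NR) : cone_hull [:: v] x <-> exists2 t, 0 <= t & x = t *: v.
Proof.
split=> [[c c0 ->]|[t t0 ->]].
  by exists (c ord0) => //; rewrite big_ord_recl big_ord0 addr0.
by exists (fun=> t) => //; rewrite big_ord_recl big_ord0 addr0.
Qed.

Section Generated.
Variables (n : nat) (v : 'I_n -> NR).
Implicit Types J T : {set 'I_n}.

Lemma in_cone1P i : in_cone v [set i]%SET = cone_hull [:: v i].
Proof.
apply/seteqP; split=> x.
  move=> [c [c0 cJ] ->]; apply/cone_hull1P; exists (c i) => //.
  rewrite /comb (bigD1 i) //= big1 ?addr0 // => j ji.
  by rewrite cJ ?scale0r // inE.
move=> /cone_hull1P[t t0 ->]; exists (fun j => if j == i then t else 0); first split.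
- by move=> j; case: ifP.
- by move=> j; rewrite inE => /negbTE ->.
rewrite /comb (bigD1 i) //= eqxx big1 ?addr0 // => j /negbTE ->.
by rewrite scale0r.
Qed.

(** The face is cut out by a form equal to 0 on [T] and to 1 on the rest of [J]. *)
Lemma independent_face J T : independent v J -> T \subset J ->
  face (in_cone v T) (in_cone v J).
Proof.
move=> iJ TJ; have [m mP] := independent_dual (fun i => (i \notin T)%:R) iJ.
have mE c : carried J c -> pairing m (comb v c) = \sum_(i | i \notin T) c i.
  move=> [_ cJ]; rewrite pairing_comb [RHS]big_mkcond; apply: eq_bigr => i _.
  have [/mP ->|/cJ ->] := boolP (i \in J); last by rewrite mul0r; case: ifP.
  by case: (i \notin T); rewrite ?mulr1 ?mulr0.
exists m.
  by move=> _ [c cJ ->]; rewrite mE //; apply: sumr_ge0 => i _; case: cJ.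
apply/seteqP; split=> x.
  move=> xT; split; first exact: in_coneS xT.
  case: xT => c [c0 cT] ->; rewrite mE; first by apply: big1 => i /cT.
  by split=> // i iJ'; apply: cT; apply: contra iJ'; apply: (fintype.subsetP TJ).
case=> [[c [c0 cJ] ->]]; rewrite mE // => s0; exists c => //; split=> // i iT.
exact: (psumr_eq0P (fun j _ => c0 j) s0).
Qed.

Lemma vspan_cone J : vspan (in_cone v J) = <<[seq v i | i <- enum J]>>%VS.
Proof.
apply/eqP; rewrite eqEsubv; apply/andP; split.
  apply/subvP => x /vspanP; apply: (@lspan_min _ _ _ <<_>>%VS) => {}x [c [_ cJ] ->].
  apply: rpred_sum => i _; have [iJ|/cJ ->] := boolP (i \in J); last by rewrite scale0r mem0v.
  by apply/rpredZ/memv_span/map_f; rewrite mem_enum.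
apply/span_subvP => _ /mapP[i + ->]; rewrite mem_enum => iJ.
exact/vspanP/lspan_gen/in_cone_ray.
Qed.

Lemma cdim_cone J : independent v J -> cdim (in_cone v J) = #|J|.
Proof. by move=> iJ; rewrite /cdim vspan_cone dim_independent. Qed.

End Generated.
End ConeGeometry.

(** * From a simplicial fan to the complex of its ray sets *)

Section SimplicialFan.
Variables (R : realType) (d : nat) (Sigma : {fset set 'rV[R]_d}).
Variables (n : nat) (ray : 'I_n -> 'rV[int]_d).
Local Notation NR := 'rV[R]_d.
Implicit Types (sigma gamma : set NR) (J T : {set 'I_n}).

Hypothesis fanS : simplicial_fan Sigma.
Hypothesis raysS : ray_generators Sigma ray.

Definition realray i : NR := intvec R (ray i).
Local Notation cone := (in_cone realray).

Definition rays_of sigma : {set 'I_n} := [set i | `[< sigma (realray i) >]]%SET.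

Definition complex : {set {set 'I_n}} :=
  [set J | `[< exists2 sigma, sigma \in Sigma & rays_of sigma = J >]]%SET.

Lemma mem_rays_of sigma i : reflect (sigma (realray i)) (i \in rays_of sigma).
Proof. by rewrite inE; apply: asboolP. Qed.

Lemma ray_cone i : cone_hull [:: realray i] \in Sigma.
Proof. by case: raysS => _ /(_ i)[]. Qed.

Lemma realray_neq0 i : realray i != 0.
Proof.
apply/eqP => r0; have [_ /(_ i)[prim _] _] := raysS.
have : ray i = 2 *: 0.
  rewrite scaler0; apply/rowP => j; apply/eqP; rewrite !mxE -(intr_eq0 R).
  by have := congr1 (fun x : NR => x 0 j) r0; rewrite !mxE => /eqP.
by move=> /prim.
Qed.

Lemma realray_inj i j (t : R) : 0 < t -> realray i = t *: realray j -> i = j.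
Proof.
have [inj prim _] := raysS; move=> t0 E; apply: inj.
by apply: (primitive_eq _ _ t0 E); case: (prim i); case: (prim j).
Qed.

Lemma simplicial_generators sigma : sigma \in Sigma -> exists p (v : 'I_p -> NR),
  independent v [set: 'I_p]%SET /\ sigma = in_cone v [set: 'I_p]%SET.
Proof.
move=> sS; have [_ /(_ _ sS)[s [/= fs ->]]] := fanS.
exists (size (map (@intvec R d) s)), (fun j : 'I__ => (map (@intvec R d) s)`_j); split; last exact: cone_hullE.
by move=> c _ c0 j; have /freeP/(_ c c0 j) := fs : free (in_tuple _).
Qed.

(** A generator spans a one-dimensional face, hence a ray of the fan. Conversely, a ray of the fan
    inside [sigma] meets it in a face, and a generator with nonzero coefficient in the ray lies on
    that face. *)
Lemma rays_of_generators sigma p (v : 'I_p -> NR) : sigma \in Sigma ->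
  independent v [set: 'I_p]%SET -> sigma = in_cone v [set: 'I_p]%SET ->
  (forall j, exists i, exists2 t, 0 < t & v j = t *: realray i) /\
  (forall i, i \in rays_of sigma -> exists j, exists2 t, 0 < t & realray i = t *: v j).
Proof.
move=> sS iv sE.
have v0 j : v j != 0.
  by apply: (independent_neq0 iv); rewrite inE.
split=> [j|i /mem_rays_of si].
  have jv : independent v [set j]%SET by apply: independentS iv _; apply: finset.subsetT.
  have fj : face (in_cone v [set j]%SET) sigma.
    by rewrite sE; apply: independent_face => //; apply: finset.subsetT.
  have jS : in_cone v [set j]%SET \in Sigma by case: fanS => -[_ _ + _] _; apply; eassumption.
  have [_ _ /(_ _ jS)[|i]] := raysS; first by rewrite cdim_cone // cards1.
  rewrite in_cone1P => iE; have : cone_hull [:: v j] (v j).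
    by rewrite -in_cone1P; apply: in_cone_ray; rewrite inE.
  rewrite iE => /cone_hull1P[t t0 vE]; exists i, t => //.
  by rewrite lt_def t0 andbT; apply: contra (v0 j) => /eqP t0'; rewrite vE t0' scale0r.
have [[_ _ _ /(_ _ _ sS (ray_cone i))[[m mP mE] _]] _] := fanS.
have : (sigma `&` cone_hull [:: realray i])%classic (realray i).
  by split=> //; apply/cone_hull1P; exists 1; rewrite ?scale1r.
rewrite mE /= => -[+ mi]; rewrite sE => -[c cJ iE].
have [/existsP[j cj]|] := boolP [exists j, c j != 0]; last first.
  rewrite negb_exists => /forallP c0; case/eqP: (realray_neq0 i).
  by rewrite iE /comb big1 // => j _; have := c0 j; rewrite negbK => /eqP ->; rewrite scale0r.
rewrite sE in mP; rewrite iE in mi.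
have mj := cone_face mP cJ mi cj.
have : (sigma `&` cone_hull [:: realray i])%classic (v j).
  by rewrite mE /= sE; split=> //; apply: in_cone_ray.
case=> _ /cone_hull1P[t t0 vE].
have t0' : t != 0 by apply: contra (v0 j) => /eqP t0'; rewrite vE t0' scale0r.
exists j, t^-1; first by rewrite invr_gt0 lt_def t0' t0.
by rewrite vE scalerA mulVf // scale1r.
Qed.

(** Distinct rays lie on distinct generators by primitivity ([realray_inj]), so a relation of rays
    is one of generators. *)
Lemma independent_rays sigma : sigma \in Sigma -> independent realray (rays_of sigma).
Proof.
move=> sS; have [p [v [iv sE]]] := simplicial_generators sS.
have [_ gen] := rays_of_generators sS iv sE.
move=> c c0 cs i; have [iS|/c0//] := boolP (i \in rays_of sigma).
have [j0 _] := gen i iS.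
have [|f fP] := @choice _ _ (fun i (jt : 'I_p * R) => i \in rays_of sigma ->
    0 < jt.2 /\ realray i = jt.2 *: v jt.1).
  move=> h; have [/gen[j [t t0 E]]|_] := boolP (h \in rays_of sigma); first by exists (j, t).
  by exists (j0, 0).
have [ti iE] := fP i iS.
have : \sum_(h | (h \in rays_of sigma) && ((f h).1 == (f i).1)) c h * (f h).2 = 0.
  apply: (iv (fun j => \sum_(h | (h \in rays_of sigma) && ((f h).1 == j)) c h * (f h).2)) => [j|].
    by rewrite inE.
  rewrite -[RHS]cs /comb [RHS](bigID (mem (rays_of sigma))) /= [X in _ = _ + X]big1 ?addr0 => [|h /c0 ->]; last first.
    by rewrite scale0r.
  under eq_bigr do rewrite scaler_suml.
  rewrite (exchange_big_dep (mem (rays_of sigma))) /= => [|j h _ /andP[]//].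
  apply: eq_bigr => h hS; rewrite (big_pred1 (f h).1) => [|j]; last by rewrite hS eq_sym.
  by have [_ ->] := fP h hS; rewrite scalerA.
rewrite (big_pred1 i) => [/eqP|h].
  by rewrite mulf_eq0 (gt_eqF ti) orbF => /eqP.
rewrite /=; apply/andP/eqP => [[hS /eqP E]|->]; last by rewrite eqxx.
have [th hE] := fP h hS; apply: (@realray_inj _ _ ((f h).2 / (f i).2)).
  by rewrite divr_gt0.
by rewrite hE iE E scalerA mulfVK // gt_eqF.
Qed.

Lemma cone_rays_of sigma : sigma \in Sigma -> cone (rays_of sigma) = sigma.
Proof.
move=> sS; have [p [v [iv sE]]] := simplicial_generators sS.
have [gen _] := rays_of_generators sS iv sE.
have sD x y : sigma x -> sigma y -> sigma (x + y).
  rewrite sE => -[c [c0 _] ->] [c' [c'0 _] ->]; rewrite combD; eexists; last reflexivity.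
  by split=> i; rewrite ?inE // addr_ge0.
have sZ t x : 0 <= t -> sigma x -> sigma (t *: x).
  move=> t0; rewrite sE => -[c [c0 _] ->]; exists (fun i => t * c i).
    by split=> i; rewrite ?inE // mulr_ge0.
  by rewrite /comb scaler_sumr; apply: eq_bigr => i _; rewrite scalerA.
have s0 : sigma 0.
  rewrite sE; exists (fun=> 0); first by split=> i.
  by rewrite /comb big1 // => i _; rewrite scale0r.
apply/seteqP; split=> x.
  move=> [c [c0 cJ] ->]; rewrite /comb; elim/big_ind: _ => // i _.
  have [/mem_rays_of si|/cJ ->] := boolP (i \in rays_of sigma); last by rewrite scale0r.
  exact: sZ.
rewrite {1}sE => -[c [c0 _] ->]; rewrite /comb.
elim/big_ind: _ => [|x' y' [cx cxJ ->] [cy cyJ ->]|j _].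
- exists (fun=> 0); first by split=> i.
  by rewrite /comb big1 // => i _; rewrite scale0r.
- rewrite combD; eexists; last reflexivity.
  case: cxJ cyJ => [cx0 cxJ] [cy0 cyJ]; split=> i; first by rewrite addr_ge0.
  by move=> iJ; rewrite cxJ // cyJ // addr0.
have [i [t t0 vE]] := gen j.
have iS : i \in rays_of sigma.
  apply/mem_rays_of; have -> : realray i = t^-1 *: v j by rewrite vE scalerA mulVf ?scale1r // gt_eqF.
  apply: sZ; first by rewrite invr_ge0 ltW.
  by rewrite sE; apply: in_cone_ray; rewrite inE.
have [c' [c'0 c'J] iE] := in_cone_ray realray iS.
exists (fun h => c j * t * c' h).
  split=> h; first by rewrite !mulr_ge0 // ltW.
  by move=> /c'J ->; rewrite mulr0.
rewrite vE {1}iE scalerA /comb scaler_sumr; apply: eq_bigr => h _.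
by rewrite scalerA.
Qed.

Lemma rays_of_inj sigma gamma : sigma \in Sigma -> gamma \in Sigma ->
  rays_of sigma = rays_of gamma -> sigma = gamma.
Proof. by move=> /cone_rays_of {2}<- /cone_rays_of {2}<- ->. Qed.

Lemma rays_of_cone sigma J : sigma \in Sigma -> J \subset rays_of sigma ->
  rays_of (cone J) = J.
Proof.
move=> sS JS; apply/setP => i; apply/mem_rays_of/idP => [[c [c0 cJ] iE]|]; last exact: in_cone_ray.
apply: contraT => iJ; have iS : i \in rays_of sigma.
  apply/mem_rays_of; rewrite -(cone_rays_of sS); apply: (in_coneS JS).
  by exists c.
have /eqP : c i - (i == i)%:R = 0; last by rewrite eqxx cJ // sub0r oppr_eq0 oner_eq0.
apply: (independent_rays sS (c := fun h => c h - (h == i)%:R)) => [h hS|].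
  rewrite cJ; last by apply: contra hS; apply: (fintype.subsetP JS).
  by rewrite sub0r; case: eqP hS => [->|]; rewrite ?iS // oppr0.
rewrite /comb; under eq_bigr do rewrite scalerBl.
rewrite sumrB -/(comb realray c) -iE (bigD1 i) //= eqxx scale1r big1 ?addr0 ?subrr // => h /negbTE ->.
by rewrite scale0r.
Qed.

Lemma cone_in_fan sigma J : sigma \in Sigma -> J \subset rays_of sigma -> cone J \in Sigma.
Proof.
move=> sS JS; have [[_ _ faceS _] _] := fanS; apply: (faceS _ _ sS).
rewrite -(cone_rays_of sS); apply: independent_face => //.
exact: independent_rays.
Qed.

Lemma complexP J : J \in complex <-> cone J \in Sigma /\ rays_of (cone J) = J.
Proof.
rewrite inE; split=> [/asboolP[sigma sS <-]|[JS JE]].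
  by rewrite cone_rays_of.
by apply/asboolP; exists (cone J).
Qed.

Lemma rays_of_complex sigma : sigma \in Sigma -> rays_of sigma \in complex.
Proof. by move=> sS; apply/complexP; rewrite cone_rays_of. Qed.

Lemma complexS J T : J \in complex -> T \subset J -> T \in complex.
Proof.
move=> /complexP[JS JE] TJ; rewrite -JE in TJ; apply/complexP; split.
  exact: (cone_in_fan JS).
exact: (rays_of_cone JS).
Qed.

Lemma independent_complex J : J \in complex -> independent realray J.
Proof. by move=> /complexP[JS JE]; rewrite -JE; apply: independent_rays. Qed.

(** The common point lies on the face where the two cones meet. The form cutting it out vanishes on
    all rays used by [c], which therefore belong to [T], and independence in [T] compares the
    coefficients. *)
Lemma complex_inj J T c c' : J \in complex -> T \in complex ->
  carried J c -> carried T c' -> comb realray c = comb realray c' -> c =1 c'.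
Proof.
move=> JD TD; have [[JS JE] [TS TE]] := ((complexP J).1 JD, (complexP T).1 TD).
have [[_ _ _ /(_ _ _ JS TS)[[m mP mE] _]] _] := fanS.
move=> cJ cT E; have : (cone J `&` cone T)%classic (comb realray c).
  by split; [exists c | exists c'].
rewrite mE => -[_ m0]; have zero := cone_face mP cJ m0.
have inT i : i \notin T -> c i = 0.
  apply: contraNeq => ci; rewrite -TE; apply/mem_rays_of.
  suff : (cone J `&` cone T)%classic (realray i) by case.
  rewrite mE /=; split; last exact: zero.
  apply: in_cone_ray; apply: contraT => /(proj2 cJ) ci0; by rewrite ci0 eqxx in ci.
move=> i; apply/eqP; rewrite -subr_eq0; apply/eqP.
apply: (independent_complex TD (c := fun i => c i - c' i)) => [h hT|].
  by rewrite inT // (proj2 cT) // subrr.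
rewrite /comb; under eq_bigr do rewrite scalerBl.
by rewrite sumrB; move/eqP: E; rewrite -subr_eq0 => /eqP.
Qed.

Lemma in_fan_support x : in_fan realray complex x <-> Defs.support Sigma x.
Proof.
split=> [[J /complexP[JS _] xJ]|[sigma sS xs]]; first by exists (cone J).
exists (rays_of sigma); first exact: rays_of_complex.
by rewrite cone_rays_of.
Qed.

Lemma stanley_reisnerP g : stanley_reisner Sigma ray g <->
  exists2 J : {set 'I_n}, J \notin complex & g = \prod_(i in J) 'X_i.
Proof.
have E J : J \in complex <-> exists2 sigma, sigma \in Sigma &
    forall i, i \in J -> sigma (intvec R (ray i)).
  split=> [/complexP[JS JE]|[sigma sS Js]].
    by exists (cone J) => // i iJ; apply: in_cone_ray.
  apply: (complexS (rays_of_complex sS)); apply/fintype.subsetP => i /Js si.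
  exact/mem_rays_of.
split=> [[J nJ <-]|[J nJ ->]]; exists J => //.
  by apply/negP => /E.
by move=> /E JD; rewrite JD in nJ.
Qed.

Lemma cdim_rays_of sigma : sigma \in Sigma -> cdim sigma = #|rays_of sigma|.
Proof.
by move=> sS; rewrite -{1}(cone_rays_of sS) cdim_cone //; apply: independent_rays.
Qed.

Lemma facetP gamma sigma : gamma \in Sigma -> sigma \in Sigma ->
  facet gamma sigma <->
  exists2 i, i \in rays_of sigma & rays_of gamma = (rays_of sigma :\ i)%SET.
Proof.
move=> gS sS; split=> [[[m _ gE]]|[i iS gE]].
  rewrite !cdim_rays_of // => cE.
  have sub : rays_of gamma \subset rays_of sigma.
    apply/fintype.subsetP => i /mem_rays_of; rewrite gE => -[si _].
    exact/mem_rays_of.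
  have : #|(rays_of sigma :\: rays_of gamma)%SET| == 1%N.
    by rewrite cardsD (finset.setIidPr sub) cE subSnn.
  move=> /cards1P[i iE]; have := finset.set11 i; rewrite -iE inE => /andP[ig iS].
  exists i => //; apply/eqP; rewrite eqEcard finset.subsetD1 sub ig /=.
  by rewrite -ltnS -cE (cardsD1 i) iS add1n.
split; last by rewrite !cdim_rays_of // gE (cardsD1 i (rays_of sigma)) iS add1n.
rewrite -(cone_rays_of gS) -(cone_rays_of sS) gE; apply: independent_face.
  exact: independent_rays.
exact: finset.subD1set.
Qed.

End SimplicialFan.

(** * Coordinates on the span of tau *)

Section Coordinates.
Variables (R : realType) (d : nat) (Sigma : {fset set 'rV[R]_d}) (tau : set 'rV[R]_d).
Variables (n : nat) (ray : 'I_n -> 'rV[int]_d).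
Implicit Types (J K : {set 'I_n}).

Hypothesis convT : convex_cone tau.
Hypothesis subdivS : simplicial_subdivision Sigma tau.
Hypothesis raysS : ray_generators Sigma ray.

Let fanS : simplicial_fan Sigma. Proof. by case: subdivS. Qed.
Let supportS : Defs.support Sigma = tau. Proof. by case: subdivS. Qed.
Local Notation realray := (realray R ray).
Local Notation ratray := (ratray ray).
Local Notation Delta := (complex Sigma ray).

Lemma realrayE i : realray i = map_mx ratr (ratray i).
Proof. by apply/rowP => j; rewrite !mxE ratr_int. Qed.

Lemma comb_ratr c : comb realray (fun i => ratr (c i)) = map_mx ratr (comb ratray c).
Proof.
rewrite /comb raddf_sum; apply: eq_bigr => i _.
by rewrite realrayE /= map_mxZ.
Qed.

Lemma pairing_ratr (m v : 'rV[rat]_d) :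
  pairing (map_mx ratr m) (map_mx ratr v) = ratr (pairing m v) :> R.
Proof.
by rewrite /pairing rmorph_sum; apply: eq_bigr => i _; rewrite !mxE rmorphM.
Qed.

Lemma free_ratray K : K \in Delta -> \dim <<[seq ratray i | i <- enum K]>> = #|K|.
Proof.
move=> KD; apply: dim_independent => c c0 cE i.
have /eqP : ratr (c i) = 0 :> R; last by rewrite fmorph_eq0 => /eqP.
apply: (independent_complex fanS raysS KD (c := fun i => ratr (c i))) => [j /c0 ->|].
  exact: rmorph0.
by rewrite comb_ratr cE map_mx0.
Qed.

Let A : 'M[rat]_(n, d) := \matrix_i ratray i.
Definition ray_rank := \rank A.
Local Notation r := ray_rank.

(** The geometric part assumes cones of full dimension, so the rays are rewritten in a rational
    basis of their span; multiplication by [E] maps back. *)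
Definition coords i : 'rV[R]_r := row i (map_mx ratr (col_base A)).

Let E : 'M[R]_(r, d) := map_mx ratr (row_base A).

Lemma coordsE i : coords i *m E = realray i.
Proof.
by rewrite -row_mul -map_mxM mulmx_base realrayE -map_row rowK.
Qed.

Lemma comb_coords c : comb coords c *m E = comb realray c.
Proof.
rewrite /comb mulmx_suml; apply: eq_bigr => i _.
by rewrite -scalemxAl coordsE.
Qed.

Lemma coords_free : injective (mulmxr E : 'rV[R]_r -> 'rV[R]_d).
Proof.
move=> x y /= /eqP; rewrite -subr_eq0 -mulmxBl.
have freeE : row_free E by rewrite row_free_map row_base_free.
by rewrite mulmx_free_eq0 // subr_eq0 => /eqP.
Qed.

Lemma coords_span x : exists w, x = comb coords w.
Proof.
have fullC : row_full (map_mx ratr (col_base A) : 'M[R]_(n, r)).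
  by rewrite row_full_map col_base_full.
have [u ->] := submxP (submx_full x fullC).
by exists (fun i => u 0 i); rewrite mulmx_sum_row.
Qed.

Lemma coords_inj J K c c' : J \in Delta -> K \in Delta -> carried J c -> carried K c' ->
  comb coords c = comb coords c' -> c =1 c'.
Proof.
move=> JD KD cJ cK eq_c; apply: (complex_inj fanS raysS JD KD cJ cK).
by rewrite -!comb_coords eq_c.
Qed.

Lemma in_fan_coords x : in_fan coords Delta x <-> tau (x *m E).
Proof.
rewrite -supportS -(in_fan_support fanS raysS); split=> -[J JD [c cJ xE]].
  by exists J => //; exists c => //; rewrite xE comb_coords.
exists J => //; exists c => //; apply: coords_free.
by rewrite /= comb_coords.
Qed.

Lemma fan_coordsD x y : in_fan coords Delta x -> in_fan coords Delta y ->
  in_fan coords Delta (x + y).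
Proof.
move=> /in_fan_coords tx /in_fan_coords ty; apply/in_fan_coords.
by rewrite mulmxDl; case: convT => _ + _; apply.
Qed.

Lemma tau_ray i : tau (realray i).
Proof.
rewrite -supportS; exists (cone_hull [:: realray i]); first exact: ray_cone raysS i.
by apply/cone_hull1P; exists 1; rewrite ?scale1r.
Qed.

Lemma tau_comb c : (forall i, 0 <= c i) -> tau (comb realray c).
Proof.
case: convT => t0 tD tZ c0; rewrite /comb; elim/big_ind: _ => // i _.
by apply: tZ => //; apply: tau_ray.
Qed.

Lemma span_rays_le : (\dim (span_rays ratray) <= r)%N.
Proof.
pose f := linfun (mulmxr (row_base A) : 'rV[rat]_r -> 'rV[rat]_d).
have sub : (span_rays ratray <= limg f)%VS.
  apply/span_subvP => _ /mapP[i _ ->].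
  have -> : ratray i = f (row i (col_base A)).
    by rewrite lfunE /= -row_mul mulmx_base rowK.
  exact: memv_img (memvf _).
apply: leq_trans (dimvS sub) _.
have dE := limg_ker_dim f fullv; have : (\dim (limg f) <= \dim {:'rV[rat]_r})%N.
  by rewrite -dE leq_addl.
by rewrite dimvf /dim /= mul1n.
Qed.

Lemma card_complex J : J \in Delta -> (#|J| <= r)%N.
Proof.
move=> JD; rewrite -(free_ratray JD); apply: leq_trans span_rays_le.
apply/dimvS/span_subvP => _ /mapP[i _ ->]; apply/memv_span/map_f.
exact: mem_enum.
Qed.

(** Otherwise every cone lies in a hyperplane. A positive combination of all rays off these
    hyperplanes still belongs to [tau] by convexity, hence to some cone. *)
Lemma coords_chamber : exists2 J, J \in Delta & #|J| = r.
Proof.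
apply: contrapT => no; have lt J : J \in Delta -> (#|J| < r)%N.
  move=> JD; rewrite ltn_neqAle card_complex // andbT.
  by apply/eqP => cJ; apply: no; exists J.
have [|g gP] := @choice _ _ (fun J (g : 'rV[R]_r) => J \in Delta ->
    g != 0 /\ forall i, i \in J -> pairing g (coords i) = 0).
  move=> J; have [/lt JD|_] := boolP (J \in Delta); last by exists 0.
  have [|g g0 gJ] := @exists_normal R r [seq coords i | i <- enum J].
    by rewrite size_map -cardE.
  by exists g => _; split=> // i iJ; apply/gJ/map_f; rewrite mem_enum.
have [|||b [c [c0 bE]] bP] := @avoid_hyperplanes R r [seq g J | J <- enum Delta]
    (fun b => exists c, (forall i, 0 < c i) /\ b = comb coords c).
- move=> _ v [c [c0 ->]]; have [w ->] := coords_span v.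
  have [|e e0 eP] := @small_perturbation R _ (enum 'I_n) c w; first by [].
  exists e => // t te; exists (fun i => c i + t * w i); split=> [i|].
    by apply: eP => //; rewrite mem_enum.
  rewrite /comb scaler_sumr -big_split; apply: eq_bigr => i _ /=.
  by rewrite scalerDl scalerA.
- by exists (comb coords (fun=> 1)), (fun=> 1).
- by apply/allP => _ /mapP[J + ->]; rewrite mem_enum => /gP[].
have : in_fan coords Delta b.
  by apply/in_fan_coords; rewrite bE comb_coords; apply: tau_comb => i; apply: ltW.
case=> J JD [c' [c'0 c'J] bE']; have [_ gJ] := gP J JD.
have /bP/eqP[] : g J \in [seq g K | K <- enum Delta] by apply: map_f; rewrite mem_enum.
rewrite bE' pairing_comb big1 // => i _.
have [/gJ ->|/c'J ->] := boolP (i \in J); last exact: mul0r.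
exact: mulr0.
Qed.

Lemma dim_span_rays : \dim (span_rays ratray) = r.
Proof.
apply/eqP; rewrite eqn_leq span_rays_le /=; have [J JD <-] := coords_chamber.
rewrite -(free_ratray JD); apply/dimvS/span_subvP => _ /mapP[i _ ->].
exact/memv_span/map_f/mem_enum.
Qed.

Lemma perp_cone J : perp (in_cone realray J) = ann <<[seq ratray i | i <- enum J]>>%VS.
Proof.
apply/vspaceP => m; apply/idP/idP => [/mem_perp mJ|/annP mJ].
  apply/annP => x xJ; pose U := [set x : 'rV[rat]_d | pairing m x = 0]%classic.
  have : x \in vspan U.
    move: xJ; apply/subvP/span_subvP => _ /mapP[i + ->]; rewrite mem_enum => iJ.
    apply/vspanP/lspan_gen; rewrite /U /=.
    suff /eqP : ratr (pairing m (ratray i)) = 0 :> R by rewrite fmorph_eq0 => /eqP.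
    by rewrite -pairing_ratr -realrayE; apply/mJ/in_cone_ray.
  have [||xU _] := @mem_vspan _ _ U x; last exact: xU.
    exact: linear0.
  by move=> c u v; rewrite /U /= => u0 v0; rewrite linearP /= u0 v0 mulr0 addr0.
apply/mem_perp => _ [c [_ cJ] ->]; rewrite pairing_comb big1 // => i _.
have [iJ|/cJ ->] := boolP (i \in J); last by rewrite mul0r.
rewrite realrayE pairing_ratr mJ ?rmorph0 ?mulr0 //.
by apply/memv_span/map_f; rewrite mem_enum.
Qed.

Lemma perp_tau : perp tau = ann (span_rays ratray).
Proof.
apply/vspaceP => m; apply/idP/idP => [/mem_perp mT|mA].
  have := perp_cone [set: 'I_n]%SET => /vspaceP/(_ m); rewrite /span_rays.
  have -> : enum [set: 'I_n]%SET = enum 'I_n by apply: eq_enum => i; rewrite inE.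
  move=> <-; apply/mem_perp => _ [c [c0 _] ->]; exact/mT/tau_comb.
apply/mem_perp => x; rewrite -supportS => -[sigma sS].
rewrite -(cone_rays_of fanS raysS sS) => -[c [_ _] ->].
rewrite pairing_comb big1 // => i _.
rewrite realrayE pairing_ratr ((annP _ _).1 mA) ?rmorph0 ?mulr0 //.
exact/memv_span/map_f/mem_enum.
Qed.

End Coordinates.

(** * The cohomology of the fan *)

Lemma extpow_ann d (U : {vspace 'rV[rat]_d}) (l j : nat) :
  extpow (l%:Z - j%:Z) (ann U) = killed U l j.
Proof.
have [jl|lj] := leqP j l; first by rewrite subzn // killed_extpow.
have -> : l%:Z - j%:Z = Negz (j - l).-1 by rewrite NegzE prednK ?subn_gt0 // -subzn 1?ltnW // opprB.
apply/esym/eqP; rewrite -subv0; apply/subvP => w /killedP[dw _].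
by rewrite (ext_deg_eq0 lj dw) mem0v.
Qed.

(** * From Ishida cochains to cochains of the complex *)

Section Identification.
Variables (R : realType) (d : nat) (Sigma : {fset set 'rV[R]_d}) (tau : set 'rV[R]_d).
Variables (n : nat) (ray : 'I_n -> 'rV[int]_d).
Variables (e : set 'rV[R]_d -> set 'rV[R]_d -> 'rV[rat]_d) (l : nat).
Implicit Types (J K : {set 'I_n}).

Hypothesis subdivS : simplicial_subdivision Sigma tau.
Hypothesis raysS : ray_generators Sigma ray.
Hypothesis eP : facet_vectors Sigma e.
Hypothesis ld : (l <= d)%N.
Hypothesis complexD : ishida_complex Sigma e l.

Let fanS : simplicial_fan Sigma. Proof. by case: subdivS. Qed.
Local Notation realray := (realray R ray).
Local Notation ratray := (ratray ray).
Local Notation Delta := (complex Sigma ray).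
Local Notation rays := (rays_of (R := R) ray).
Local Notation forms := (face_forms ratray 0%VS l).
Local Notation C := (cochains ratray Delta 0%VS l).
Local Notation families := {ffun {set 'I_n} -> ext d}.

Lemma extpow_perp (gamma : set 'rV[R]_d) : gamma \in Sigma ->
  extpow (l%:Z - (cdim gamma)%:Z) (perp gamma) = forms (rays gamma).
Proof.
move=> gS; rewrite (cdim_rays_of fanS raysS) // -{2}(cone_rays_of fanS raysS gS).
by rewrite perp_cone extpow_ann /face_forms /span_face add0v.
Qed.

Lemma pairing_vspan_cone m J z : (forall i, i \in J -> pairing m (realray i) = 0) ->
  z \in vspan (in_cone realray J) -> pairing m z = 0.
Proof.
move=> mJ /vspanP[s [sJ ->]]; rewrite linear_sum big_seq big1 // => a /sJ[c [_ cJ] ->].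
rewrite linearZ /= pairing_comb big1 ?mulr0 // => i _.
have [/mJ ->|/cJ ->] := boolP (i \in J); last exact: mul0r.
exact: mulr0.
Qed.

(** [facet_vectors] makes the vector a real multiple of the ray [i] plus an element of the span of
    [gamma], which contracts the forms on [gamma] to 0. Pairing with a rational form dual to the ray
    shows that the multiple is rational and nonzero. *)
Lemma contract_facet_vector gamma sigma i : gamma \in Sigma -> sigma \in Sigma ->
  i \in rays sigma -> rays gamma = (rays sigma :\ i)%SET ->
  exists2 c : rat, c != 0 & forall w, w \in forms (rays gamma) ->
    contract (e gamma sigma) w = c *: contract (ratray i) w.
Proof.
move=> gS sS iS gE; have EQ := eP gS sS ((facetP fanS raysS gS sS).2 (ex_intro2 _ _ i iS gE)).
have sD := rays_of_complex fanS raysS sS.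
set U := vspan gamma in EQ.
have gU y : gamma y -> y \in U by move=> gy; apply/vspanP/lspan_gen.
have gC := cone_rays_of fanS raysS gS; have sC := cone_rays_of fanS raysS sS.
have UE : U = vspan (in_cone realray (rays gamma)) by rewrite gC.
have [t [z1 z1U eE]] : exists t, exists2 z, z \in U & ratvec R (e gamma sigma) = t *: realray i + z.
  have : [set t *: ratvec R (e gamma sigma) + z | t in [set t : R | 0 <= t]%classic & z in [set` U]]%classic
      (ratvec R (e gamma sigma)).
    by exists 1; rewrite /= ?ler01 //; exists 0; rewrite /= ?mem0v // scale1r addr0.
  rewrite -EQ => -[x + [y gy <-]]; rewrite -{1}sC => -[c [c0 cJ] xE].
  exists (c i), (x - y - c i *: realray i); last by rewrite addrCA subrr addr0.
  rewrite addrAC; apply: rpredB; last exact: gU.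
  rewrite xE /comb (bigD1 i) //= addrAC subrr add0r.
  apply: rpred_sum => h hi; have [hS|/cJ ->] := boolP (h \in rays sigma); last first.
    by rewrite scale0r mem0v.
  apply/rpredZ/gU; have : in_cone realray (rays gamma) (realray h).
    by apply: in_cone_ray; rewrite gE finset.in_setD1 hi.
  by rewrite gC.
have [t' [z2 z2U iE]] : exists t', exists2 z, z \in U & realray i = t' *: ratvec R (e gamma sigma) + z.
  have : [set x - y | x in sigma & y in gamma]%classic (realray i).
    exists (realray i); first exact/mem_rays_of.
    exists 0; last exact: subr0.
    have : in_cone realray (rays gamma) 0.
      exists (fun=> 0); first by split.
      by rewrite /comb big1 // => h _; rewrite scale0r.
    by rewrite gC.
  by rewrite EQ => -[t' _ [z2 z2U <-]]; exists t', z2.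
have indep : \dim (span_face ratray 0%VS (rays sigma)) =
    (\dim (0%VS : {vspace 'rV[rat]_d}) + #|rays sigma|)%N.
  by rewrite /span_face add0v (free_ratray subdivS raysS) // dimv0.
have [m [_ mi mJ]] := exists_dual_form indep iS.
have mg h : h \in rays gamma -> pairing m (ratray h) = 0.
  by rewrite gE finset.in_setD1 => /andP[hi hS]; apply: mJ.
have ratperp (m' : 'rV[rat]_d) z : (forall h, h \in rays gamma -> pairing m' (ratray h) = 0) ->
    z \in U -> pairing (map_mx ratr m') z = 0.
  move=> m'g; rewrite UE; apply: pairing_vspan_cone => h /m'g E.
  by rewrite realrayE pairing_ratr E rmorph0.
pose c := pairing m (e gamma sigma).
have tE : ratr c = t.
  have := congr1 (pairing (map_mx ratr m)) eE.
  by rewrite linearD linearZ /= realrayE !pairing_ratr mi rmorph1 mulr1 ratperp // addr0.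
exists c.
  apply/eqP => c0; have := congr1 (pairing (map_mx ratr m)) iE.
  rewrite linearD linearZ /= realrayE !pairing_ratr mi rmorph1 -/c c0 rmorph0 mulr0 ratperp //.
  by rewrite addr0 => /eqP; rewrite oner_eq0.
pose v := e gamma sigma - c *: ratray i.
have vE : map_mx ratr v = z1 :> 'rV[R]_d.
  have cE : map_mx ratr (c *: ratray i) = t *: realray i :> 'rV[R]_d.
    by rewrite -tE realrayE; apply/rowP => j; rewrite !mxE rmorphM.
  rewrite /v map_mxD map_mxN cE; apply/eqP; rewrite subr_eq addrC.
  exact/eqP.
(* The remainder is only known to lie in the real span; a separating rational form would contradict
   this, so it lies in the rational one. *)
have vU : v \in <<[seq ratray h | h <- enum (rays gamma)]>>%VS.
  apply: contraT => /exists_separating[s sU sv].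
  have : pairing (map_mx ratr s) z1 = 0.
    apply: ratperp => // h hJ; apply: sU; apply/memv_span/map_f.
    by rewrite mem_enum.
  by rewrite -vE pairing_ratr sv rmorph1 => /eqP; rewrite oner_eq0.
move=> w /killedP[_ wU].
have -> : e gamma sigma = c *: ratray i + v by rewrite /v addrC subrK.
by rewrite contractDl (wU v) ?addr0 // /span_face add0v.
Qed.

(** Cones are re-indexed by their ray sets; the sum has at most one term and is 0 outside the
    complex. *)
Definition transfer_fun (x : {ffun Sigma -> ext d}) : families :=
  [ffun J => \sum_(gamma : Sigma | rays (val gamma) == J) x gamma].

Lemma transfer_is_linear : linear transfer_fun.
Proof.
move=> c x y; apply/ffunP => J; rewrite !ffunE scaler_sumr -big_split.
by apply: eq_bigr => g _; rewrite !ffunE.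
Qed.

HB.instance Definition _ := GRing.isLinear.Build rat {ffun Sigma -> ext d} families *:%R
  transfer_fun transfer_is_linear.

Lemma transferE x gamma : transfer_fun x (rays (val gamma)) = x gamma.
Proof.
rewrite ffunE (big_pred1 gamma) // => g /=; apply/eqP/eqP => [|-> //].
by move/(rays_of_inj fanS raysS (fsvalP g) (fsvalP gamma))/val_inj.
Qed.

Lemma transfer_notin x J : J \notin Delta -> transfer_fun x J = 0.
Proof.
move=> JD; rewrite ffunE big1 // => g /eqP E; move: JD; rewrite -E.
by rewrite (rays_of_complex fanS raysS (fsvalP g)).
Qed.

Lemma complex_ex J : J \in Delta -> exists gamma : Sigma, rays (val gamma) = J.
Proof.
by move=> /(complexP fanS raysS)[JS JE]; exists [` JS]%fset.
Qed.

Lemma transfer_cochains j x : x \in ishida_space Sigma l j <-> transfer_fun x \in C j.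
Proof.
have E (gamma : Sigma) : (if cdim (val gamma) == j
      then extpow (l%:Z - j%:Z) (perp (val gamma)) else 0%VS) =
    (if #|rays (val gamma)| == j then forms (rays (val gamma)) else 0%VS).
  rewrite -(cdim_rays_of fanS raysS (fsvalP gamma)).
  by case: eqP => // <-; apply/extpow_perp/fsvalP.
split=> [/mem_ishida_space xI|/cochainsP xC].
  apply/cochainsP => J; have [JD|JD] := boolP (J \in Delta); last by rewrite transfer_notin.
  have [g gE] := complex_ex JD; have := xI g; rewrite E gE -gE transferE.
  by case: ifP => // _; rewrite memv0 => /eqP.
apply/mem_ishida_space => g; rewrite E; have := xC (rays (val g)).
rewrite (rays_of_complex fanS raysS (fsvalP g)) transferE /=.
by case: ifP => // _ ->; rewrite mem0v.
Qed.

Lemma transfer_surj (y : families) : (forall J, J \notin Delta -> y J = 0) ->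
  exists x, transfer_fun x = y.
Proof.
move=> y0; exists [ffun g : Sigma => y (rays (val g))]; apply/ffunP => J.
have [/complex_ex[g <-]|JD] := boolP (J \in Delta); first by rewrite transferE ffunE.
by rewrite transfer_notin // y0.
Qed.

Lemma multiplier_exists : exists c : {set 'I_n} -> 'I_n -> rat,
  forall sigma i, sigma \in Sigma -> i \in rays sigma -> c (rays sigma) i != 0 /\
    forall gamma w, gamma \in Sigma -> rays gamma = (rays sigma :\ i)%SET ->
      w \in forms (rays gamma) ->
      contract (e gamma sigma) w = c (rays sigma) i *: contract (ratray i) w.
Proof.
have [|c cP] := @choice _ _ (fun (Ji : {set 'I_n} * 'I_n) (c : rat) =>
    forall sigma, sigma \in Sigma -> rays sigma = Ji.1 -> Ji.2 \in Ji.1 -> c != 0 /\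
    forall gamma w, gamma \in Sigma -> rays gamma = (rays sigma :\ Ji.2)%SET ->
      w \in forms (rays gamma) ->
      contract (e gamma sigma) w = c *: contract (ratray Ji.2) w); last first.
  by exists (fun J i => c (J, i)) => sigma i sS iS; apply: (cP (rays sigma, i)).
move=> [J i] /=; have [JD|JD] := boolP (J \in Delta); last first.
  by exists 0 => sigma sS E; move: JD; rewrite -E (rays_of_complex fanS raysS sS).
have [iJ|_] := boolP (i \in J); last by exists 0.
have [s sE] := complex_ex JD; have sS := fsvalP s.
have gD : (J :\ i)%SET \in Delta by apply: (complexS fanS raysS JD); apply: finset.subD1set.
have [g gE] := complex_ex gD; have gS := fsvalP g.
rewrite -sE in gE iJ; have [c c0 cP] := contract_facet_vector gS sS iJ gE.
exists c => sigma sigS sigE _; split=> // gamma w gamS gamE wF.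
have -> : sigma = val s by apply: (rays_of_inj fanS raysS) => //; rewrite sigE sE.
have gamg : gamma = val g.
  by apply: (rays_of_inj fanS raysS) => //; rewrite gamE gE sigE sE.
by rewrite gamg cP // -gamg.
Qed.

Section Multiplier.
Variable c : {set 'I_n} -> 'I_n -> rat.
Hypothesis cP : forall sigma i, sigma \in Sigma -> i \in rays sigma -> c (rays sigma) i != 0 /\
    forall gamma w, gamma \in Sigma -> rays gamma = (rays sigma :\ i)%SET ->
      w \in forms (rays gamma) ->
      contract (e gamma sigma) w = c (rays sigma) i *: contract (ratray i) w.
Local Notation twisted := (twisted_coboundary ratray Delta c).

Let c_neq0 J i : J \in Delta -> i \in J -> c J i != 0.
Proof.
move=> /complex_ex[g <-] iJ; exact: (cP (fsvalP g) iJ).1.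
Qed.

(** Free of the degree [j], so that [delta] preserves it and the formula for [delta] can be applied
    twice. *)
Definition formed (x : {ffun Sigma -> ext d}) :=
  forall gamma : Sigma, x gamma \in forms (rays (val gamma)).

Lemma ishida_formed j x : x \in ishida_space Sigma l j -> formed x.
Proof.
move=> /mem_ishida_space xI gamma; have := xI gamma.
case: ifP => [/eqP <-|_]; first by rewrite (extpow_perp (fsvalP gamma)).
by rewrite memv0 => /eqP ->; rewrite mem0v.
Qed.

Lemma facet_rays (gamma sigma : Sigma) : facet (val gamma) (val sigma) ->
  exists2 i, i \in rays (val sigma) & rays (val gamma) = (rays (val sigma) :\ i)%SET.
Proof. by move/(facetP fanS raysS (fsvalP _) (fsvalP _)). Qed.

Lemma delta_formed x : formed x -> formed (delta Sigma e x).
Proof.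
move=> xF sigma; rewrite lfunE ffunE; apply: rpred_sum => g /asboolP/facet_rays[i iS gE].
have [_ ->] := cP (fsvalP sigma) iS => //; last exact: fsvalP.
apply: rpredZ; rewrite -(finset.setD1K iS) -gE; apply: face_forms_contract => //.
by rewrite gE !inE eqxx.
Qed.

Lemma transfer_delta x : formed x -> transfer_fun (delta Sigma e x) = twisted (transfer_fun x).
Proof.
move=> xF; apply/ffunP => J; rewrite [RHS]ffunE.
case: ifPn => [/complex_ex[s <-]|/transfer_notin -> //].
rewrite transferE lfunE ffunE.
transitivity (\sum_(i in rays (val s)) \sum_(g : Sigma | rays (val g) == (rays (val s) :\ i)%SET)
    contract (e (val g) (val s)) (x g)); last first.
  apply: eq_bigr => i iS; rewrite ffunE linear_sum scaler_sumr; apply: eq_bigr => g /eqP gE.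
  by have [_ ->] := cP (fsvalP s) iS => //; apply: fsvalP.
rewrite (exchange_big_dep predT) //= big_mkcond; apply: eq_bigr => g _.
case: ifPn => [/asboolP/facet_rays[i iS gE]|nf].
  rewrite (big_pred1 i) // => h /=; apply/andP/eqP => [[hS /eqP]|->]; last by rewrite iS gE eqxx.
  move=> E; apply/eqP; apply: contraT => hi.
  have : h \in rays (val g) by rewrite gE finset.in_setD1 hi hS.
  by rewrite E finset.in_setD1 eqxx.
rewrite big1 // => i /andP[iS /eqP gE]; case/negP: nf; apply/asboolP.
by apply/(facetP fanS raysS (fsvalP _) (fsvalP _)); exists i.
Qed.

Let twisted_twisted j y : y \in C j -> twisted (twisted y) = 0.
Proof.
move=> yC; have [|x xE] := transfer_surj (y := y).
  by move=> J JD; have /cochainsP/(_ J) := yC; rewrite (negbTE JD).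
have xI : x \in ishida_space Sigma l j by apply/transfer_cochains; rewrite xE.
have xF := ishida_formed xI.
rewrite -xE -!transfer_delta //; last exact: delta_formed.
by rewrite (complexD xI) linear0.
Qed.

Local Notation b := (untwisting c).

(** Rescaling each cone absorbs the multipliers: this map carries [delta] to the coboundary with all
    multipliers 1. *)
Definition untwisted_transfer_fun (x : {ffun Sigma -> ext d}) : families :=
  [ffun J => b J *: transfer_fun x J].

Lemma untwisted_transfer_is_linear : linear untwisted_transfer_fun.
Proof.
move=> t x y; apply/ffunP => J; rewrite ffunE linearP !ffunE scalerDr !scalerA.
by rewrite [b J * t]mulrC.
Qed.

HB.instance Definition _ := GRing.isLinear.Build rat {ffun Sigma -> ext d} families *:%R
  untwisted_transfer_fun untwisted_transfer_is_linear.

Definition untwisted_transfer := linfun untwisted_transfer_fun.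
Local Notation Phi := untwisted_transfer.

Let DeltaS J J' : J \in Delta -> J' \subset J -> J' \in Delta.
Proof. exact: complexS. Qed.

Lemma untwisted_transferE x J : Phi x J = b J *: transfer_fun x J.
Proof. by rewrite lfunE ffunE. Qed.

Lemma untwisted_transfer_inj : lker Phi == 0%VS.
Proof.
rewrite -subv0; apply/subvP => x; rewrite memv_ker memv0 => /eqP Px0; apply/eqP/ffunP => g.
have := congr1 (fun y : families => y (rays (val g))) Px0.
rewrite untwisted_transferE transferE !ffunE => /eqP.
rewrite scaler_eq0 (negbTE (untwisting_neq0 DeltaS c_neq0 _)); last first.
  exact: rays_of_complex (fsvalP g).
by move/eqP.
Qed.

Lemma untwisted_transfer_cochains j x : x \in ishida_space Sigma l j <-> Phi x \in C j.
Proof.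
rewrite transfer_cochains; split=> /cochainsP xC; apply/cochainsP => J; have := xC J;
  rewrite untwisted_transferE.
- by case: ifP => _ => [/(rpredZ (b J))//|->]; rewrite scaler0.
case: ifP => [/andP[JD _]|_].
  move/(rpredZ (b J)^-1); rewrite scalerA mulVf ?scale1r //.
  exact: (untwisting_neq0 DeltaS c_neq0).
have [JD|JD _] := boolP (J \in Delta); last by rewrite transfer_notin.
move/eqP; rewrite scaler_eq0 (negbTE (untwisting_neq0 DeltaS c_neq0 JD)).
by move/eqP.
Qed.

Lemma untwisted_transfer_img j : (Phi @: ishida_space Sigma l j)%VS = C j.
Proof.
apply/vspaceP => y; apply/memv_imgP/idP => [[x xI ->]|yC]; first exact/untwisted_transfer_cochains.
have [|x xE] := transfer_surj (y := [ffun J => (b J)^-1 *: y J]).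
  by move=> J JD; have /cochainsP/(_ J) := yC; rewrite ffunE (negbTE JD) => ->; rewrite scaler0.
have yE : y = Phi x.
  apply/ffunP => J; rewrite untwisted_transferE xE ffunE.
  have [JD|JD] := boolP (J \in Delta).
    by rewrite scalerA mulfV ?scale1r //; apply: (untwisting_neq0 DeltaS c_neq0).
  by have /cochainsP/(_ J) := yC; rewrite (negbTE JD) => ->; rewrite !scaler0.
by exists x => //; apply/untwisted_transfer_cochains; rewrite -yE.
Qed.

Lemma untwisted_transfer_delta j x : x \in ishida_space Sigma l j ->
  Phi (delta Sigma e x) = coboundary ratray Delta (Phi x).
Proof.
move=> xI; have xC : transfer_fun x \in C j by apply/transfer_cochains.
have := untwisting_coboundary DeltaS (free_ratray subdivS raysS) ld c_neq0 twisted_twisted xC.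
rewrite -transfer_delta; last exact: ishida_formed xI.
move=> E; have PE z : Phi z = [ffun J => b J *: transfer_fun z J].
  by apply/ffunP => J; rewrite untwisted_transferE [RHS]ffunE.
by rewrite !PE E.
Qed.

Lemma untwisted_transfer_cocycles k :
  (Phi @: cocycles Sigma e l k)%VS = abs_cocycles ratray Delta 0%VS l k.
Proof.
apply/vspaceP => y; apply/memv_imgP/idP => [[x]|].
  rewrite memv_cap memv_ker => /andP[xI /eqP dx] ->; apply/abs_cocyclesP.
  split; first exact/untwisted_transfer_cochains.
  by rewrite -(untwisted_transfer_delta xI) dx linear0.
move=> /abs_cocyclesP[]; rewrite -untwisted_transfer_img => /memv_imgP[x xI ->] dy.
exists x => //; rewrite memv_cap xI memv_ker; apply/eqP.
apply: (lker0P untwisted_transfer_inj); rewrite linear0.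
by rewrite (untwisted_transfer_delta xI).
Qed.

Lemma untwisted_transfer_coboundaries k :
  (Phi @: coboundaries Sigma e l k)%VS = abs_coboundaries ratray Delta 0%VS l k.
Proof.
case: k => [|j] /=; first exact: limg0.
rewrite -untwisted_transfer_img; apply/vspaceP => y; apply/memv_imgP/memv_imgP.
  by case=> _ /memv_imgP[x xI ->] ->; exists (Phi x); [exact: memv_img|exact: untwisted_transfer_delta xI].
case=> _ /memv_imgP[x xI ->] ->; exists (delta Sigma e x); first exact: memv_img.
by rewrite (untwisted_transfer_delta xI).
Qed.

Lemma hasdim_ishida_multiplier k :
  hasdim (ishida_cohomology Sigma e l k) (hdim ratray Delta 0%VS l k).
Proof.
have dimP U : \dim (Phi @: U) = \dim U.
  by apply: limg_dim_eq; have /eqP -> := untwisted_transfer_inj; rewrite capv0.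
apply: hasdim_quotmod.
  rewrite -(limg_ker0 _ _ untwisted_transfer_inj) untwisted_transfer_coboundaries.
  by rewrite untwisted_transfer_cocycles coboundaries_sub.
rewrite -dimP -[X in (_ + X)%N]dimP untwisted_transfer_coboundaries untwisted_transfer_cocycles.
by rewrite /hdim subnK // dimvS // coboundaries_sub.
Qed.

End Multiplier.

Lemma hasdim_ishida k :
  hasdim (ishida_cohomology Sigma e l k) (hdim ratray Delta 0%VS l k).
Proof. by have [c cP] := multiplier_exists; apply: hasdim_ishida_multiplier cP k. Qed.

End Identification.

Local Open Scope classical_set_scope.

Theorem theorem1p8 (R : realType) (d : nat)
    (Sigma : {fset set 'rV[R]_d}) (tau : set 'rV[R]_d)
    (n : nat) (ray : 'I_n -> 'rV[int]_d)
    (e : set 'rV[R]_d -> set 'rV[R]_d -> 'rV[rat]_d) (l k : nat) :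
  convex_cone tau ->
  simplicial_subdivision Sigma tau ->
  ray_generators Sigma ray ->
  facet_vectors Sigma e ->
  (l <= d)%N ->
  ishida_complex Sigma e l ->
  exists f : {linear ishida_cohomology Sigma e l k ->
                tensor (chow_degree Sigma ray k)
                       (subvs_of (extpow (l%:Z - k%:Z) (perp tau)))},
    bijective f.
Proof.
move=> convT subdivS raysS eP ld complexD; have [fanS _] := subdivS.
pose Delta := complex Sigma ray.
have DeltaS (J J' : {set 'I_n}) : J \in Delta -> J' \subset J -> J' \in Delta.
  exact: complexS.
have free_ray := free_ratray subdivS raysS.
(* [hdim_formula] is used with [B = 0]; the annihilator of the span of all rays is [perp tau]. *)
have formula : hdim (ratray ray) Delta 0%VS l k =
    (hdim (ratray ray) Delta 0%VS k k * \dim (extpow (l%:Z - k%:Z) (perp tau)))%N.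
  rewrite (perp_tau convT subdivS raysS) extpow_ann.
  have dim_rays := dim_span_rays convT subdivS raysS.
  have := @hdim_formula R d (ray_rank ray) n (coords R ray) Delta (ratray ray) DeltaS
    (coords_inj subdivS raysS) (fan_coordsD convT subdivS raysS)
    (coords_chamber convT subdivS raysS) free_ray dim_rays 0%VS l k.
  by rewrite add0v dimv0 dim_rays => ->.
apply: (hasdim_linear_bij (hasdim_ishida subdivS raysS eP ld complexD k)).
rewrite formula; have SRP g := stanley_reisnerP fanS raysS g.
have [f fbij] := hasdim_chow_degree k DeltaS free_ray SRP.
have [g gbij] := hasdim_subvs (extpow (l%:Z - k%:Z) (perp tau)).
exact: (hasdim_tensor fbij gbij).
Qed.
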